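(* Let $m,N\ge 1$ be integers and let $u_0\in L^2_{\rho^*}(\mathbb{R}^N)$, $u_0\neq0$. Let $u(x,t)$ be the solution of the Cauchy problem $u_t=-\mathrm{i}\,(-\Delta)^m u$ in $\mathbb{R}^N\times\mathbb{R}_+$, $u|_{t=0}=u_0$. Assume that $u$ has a zero at a point $(0,T)$ with $T>0$, i.e. $u(0,T)=0$. Then there exist a finite integer $l\ge1$ and a polynomial $\varphi_l^*\not\equiv0$, which is a linear combination of the generalized Hermite polynomials $\{\psi_\beta^*:\ |\beta|=l\}$ (i.e. an element of the eigenspace of $\mathbf{B}^*$ with eigenvalue $-\frac l{2m}$), such that $$u(x,t)=(T-t)^{\frac l{2m}}\Big[\varphi_l^*\Big(\frac{x}{(T-t)^{1/2m}}\Big)+o(1)\Big]\quad\text{as } t\to T^-$$ uniformly on compact sets in the variable $y=x/(T-t)^{1/2m}$.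
   Context: Functions are complex-valued. Set $\alpha=\frac{2m}{2m-1}$, $\rho^*(y)=e^{|y|^\alpha}$, and let $L^2_{\rho^*}(\mathbb{R}^N)$ be the space of $v$ with $\int_{\mathbb{R}^N}\rho^*|v|^2\,dy<\infty$. The rescaled kernel $F$ is the function with Fourier symbol $e^{-\mathrm{i}|\omega|^{2m}}$, i.e. $F(y)=(2\pi)^{-N}\int_{\mathbb{R}^N}e^{\mathrm{i}\omega\cdot y-\mathrm{i}|\omega|^{2m}}\,d\omega$ (oscillatory integral/inverse Fourier transform). The solution of the Cauchy problem is $u(x,t)=t^{-\frac N{2m}}\int_{\mathbb{R}^N}F\big((x-z)t^{-\frac1{2m}}\big)u_0(z)\,dz$ for $t>0$. The differential expression $\mathbf{B}^*$ is $\mathbf{B}^*=-\mathrm{i}(-\Delta)^m-\frac1{2m}\,y\cdot\nabla$. For a multiindex $\beta$, the generalized Hermite polynomial $\psi_\beta^*$ is $$\psi_\beta^*(y)=\frac1{\sqrt{\beta!}}\Big[y^\beta+\sum_{j=1}^{[|\beta|/2m]}\frac1{j!}\big(\mathrm{i}(-\Delta)^m\big)^j y^\beta\Big],$$ where $[\cdot]$ is the integer part; it is an (''extended'') eigenfunction of $\mathbf{B}^*$ with eigenvalue $\lambda_\beta=-\frac{|\beta|}{2m}$. *)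

(* Defs.v *)
From HB Require Import structures.
From mathcomp Require Import all_boot all_order all_algebra.
From mathcomp Require Import all_classical all_reals all_analysis.
From mathcomp Require Import complex.
From mathcomp Require mpoly.

Set Implicit Arguments.
Unset Strict Implicit.
Unset Printing Implicit Defensive.

Import Order.TTheory GRing.Theory Num.Theory numFieldNormedType.Exports.

Local Open Scope classical_set_scope.
Local Open Scope ring_scope.
Local Open Scope complex_scope.

(** * Lebesgue measure on R^n

    The measurable space is [n.-tuple R] with the product of the Borel
    sigma-algebras; the measure is built by recursion on the dimension, as the
    image of [lebesgue_measure \x lebesgueN n] under [(x, s) |-> x :: s]. *)

Section LebesgueN.
Variable R : realType.
Let B := measurableTypeR R.

Definition consT n (p : B * n.-tuple B) : n.+1.-tuple B :=
  [tuple of p.1 :: p.2].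

Definition unconsT n (s : n.+1.-tuple B) : B * n.-tuple B :=
  (thead s, [tuple of behead s]).

Lemma measurable_consT n : measurable_fun setT (@consT n).
Proof. exact: measurable_cons. Qed.

Lemma measurable_unconsT n : measurable_fun setT (@unconsT n).
Proof.
apply: measurable_fun_pair; last exact: measurable_behead.
exact: (measurable_tnth ord0).
Qed.

Lemma consTK n : cancel (@consT n) (@unconsT n).
Proof. by case=> x s; congr (_, _); exact: val_inj. Qed.

Section Step.
Variables (n : nat) (mu : {sigma_finite_measure set (n.-tuple B) -> \bar R}).

Definition lebesgue_cons : set (n.+1.-tuple B) -> \bar R :=
  pushforward ((@lebesgue_measure R) \x mu)%E (@consT n).

HB.instance Definition _ := Measure.copy lebesgue_cons
  (measure_function_pushforward__canonical__measure_function_Measure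
    ((@lebesgue_measure R) \x mu)%E (@measurable_consT n)).

Let lebesgue_cons_sigma_finite : sigma_finite setT lebesgue_cons.
Proof.
have /sigma_finiteP[F [FT ndF Foo]] := sigma_finiteT (@lebesgue_measure R).
have /sigma_finiteP[G [GT ndG Goo]] := sigma_finiteT mu.
exists (fun k => @unconsT n @^-1` (F k `*` G k)).
  rewrite -preimage_bigcup -[LHS](preimage_setT (@unconsT n)); congr (_ @^-1` _).
  apply/esym; rewrite -subTset => -[x y] _.
  have [i _ Fx] : (\bigcup_i F i) x by rewrite -FT.
  have [j _ Gy] : (\bigcup_j G j) y by rewrite -GT.
  exists (maxn i j) => //; split => /=.
  - by move: Fx; apply/subsetPset/ndF/leq_maxl.
  - by move: Gy; apply/subsetPset/ndG/leq_maxr.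
move=> k; have [mF Fk] := Foo k; have [mG Gk] := Goo k; split.
  by rewrite -[X in measurable X]setTI; apply: measurable_unconsT => //;
    exact: measurableX.
rewrite /lebesgue_cons /pushforward -comp_preimage.
rewrite (_ : _ \o _ = id) /=; last by apply/funext => x /=; rewrite consTK.
rewrite preimage_id product_measure1E// lte_mul_pinfty//.
by rewrite ge0_fin_numE.
Qed.

HB.instance Definition _ := @Measure_isSigmaFinite.Build _ _ _
  lebesgue_cons lebesgue_cons_sigma_finite.
End Step.

Fixpoint lebesgueN (n : nat) :
    {sigma_finite_measure set (n.-tuple B) -> \bar R} :=
  if n is k.+1 then lebesgue_cons (lebesgueN k) else \d_ ([tuple] : 0.-tuple B).

Lemma lebesgueN_box n (A : 'I_n -> set B) : (forall i, measurable (A i)) ->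
  lebesgueN n [set s | forall i, A i (tnth s i)] =
  (\prod_(i < n) lebesgue_measure (A i))%E.
Proof.
elim: n A => [|n IH] A mA.
  rewrite big_ord0 /= diracE (_ : _ \in _) //; apply/mem_set; by case.
rewrite big_ord_recl -(IH (fun i => A (lift ord0 i))) //=.
rewrite /lebesgue_cons /pushforward.
rewrite -product_measure1E //; last first.
  rewrite (_ : [set s | _] =
    \bigcap_(i in [set: 'I_n]) ((@tnth n B ^~ i) @^-1` A (lift ord0 i))).
    apply: fin_bigcap_measurable => [|i _]; first exact: finite_finset.
    rewrite -[X in measurable X]setTI; exact: measurable_tnth.
  by apply/seteqP; split => s /= h i; [move=> _|]; exact: (h i).
congr ((_ \x _)%E _); apply/seteqP; split => -[x s] /=.
  by move=> h; split => [|i]; [exact: (h ord0)|rewrite -(tnthS x); exact: h].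
case=> hx hs i; case: (unliftP ord0 i) => [j ->|-> //].
by rewrite tnthS.
Qed.

End LebesgueN.

(** * Functions on R^N

    Points of R^N are row vectors ['rV[R]_N]; [vec] identifies them with the
    tuples on which the measure lives. *)

Section Functions.
Variables (R : realType) (N : nat).
Implicit Types (x y w : 'rV[R]_N) (t : R).

Definition vec (s : N.-tuple (measurableTypeR R)) : 'rV[R]_N :=
  \row_i tnth s i.

Definition dot x y : R := \sum_(i < N) x 0 i * y 0 i.

(* The norm that MathComp-Analysis puts on ['rV[R]_N] is the sup norm. *)
Definition enorm x : R := Num.sqrt (dot x x).

Definition expC (z : R[i]) : R[i] :=
  (expR (complex.Re z))%:C * (cos (complex.Im z) +i* sin (complex.Im z)).

Definition integralC (f : 'rV[R]_N -> R[i]) : R[i] :=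
  (\int[lebesgueN R N]_s complex.Re (f (vec s))) +i*
  (\int[lebesgueN R N]_s complex.Im (f (vec s))).

(* Limit of the integrals of [chi (sqrt e * w) * a w] as [e --> 0+], with the
   Schwartz cut-off [chi w = exp (- |w|^2)]. *)
Definition oscillatory_integral (a : 'rV[R]_N -> R[i]) : R[i] :=
  let I (e : R) := integralC (fun w => (expR (- (e * enorm w ^+ 2)))%:C * a w) in
  (lim (complex.Re (I e) @[e --> 0^'+])) +i*
  (lim (complex.Im (I e) @[e --> 0^'+])).

Definition kernelF (m : nat) y : R[i] :=
  ((2 * pi) ^- N)%:C *
  oscillatory_integral
    (fun w => expC ('i * (dot w y)%:C - 'i * (enorm w ^+ (2 * m))%:C)).

Definition solution (m : nat) (u0 : 'rV[R]_N -> R[i]) x t : R[i] :=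
  (t `^ (- (N%:R / (2 * m)%:R)))%:C *
  integralC (fun z => kernelF m (t `^ (- (2 * m)%:R^-1) *: (x - z)) * u0 z).

Definition alpha (m : nat) : R := (2 * m)%:R / (2 * m - 1)%:R.

Definition rho_star (m : nat) y : R := expR (enorm y `^ alpha m).

Definition in_L2_rho_star (m : nat) (u0 : 'rV[R]_N -> R[i]) : Prop :=
  [/\ measurable_fun setT (fun s => complex.Re (u0 (vec s))),
      measurable_fun setT (fun s => complex.Im (u0 (vec s))) &
      (\int[lebesgueN R N]_s
         (rho_star m (vec s) * Normc.normc (u0 (vec s)) ^+ 2)%:E < +oo)%E].

Definition ae_zero (u0 : 'rV[R]_N -> R[i]) : Prop :=
  {ae lebesgueN R N, forall s, u0 (vec s) = 0}.

Definition o1_unif_on_compacts (T : R) (r : R -> 'rV[R]_N -> R[i]) : Prop :=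
  forall K : set 'rV[R]_N, compact K ->
  forall e : R, 0 < e ->
  \forall t \near T^'-, forall y, K y -> Normc.normc (r t y) < e.

End Functions.

(** * Generalized Hermite polynomials *)

(* The notations of [mpoly] clash with those of MathComp-Analysis. *)
Import -(notations) mpoly.

Section Hermite.
Variables (R : realType) (N : nat).
Local Notation poly := (mpoly N R[i]).
Implicit Types (p : poly) (b : multinom N).

Definition laplacian p : poly :=
  \sum_(i < N) mderiv i (mderiv i p).

Definition neg_laplacian_pow (m : nat) p : poly :=
  iter m (fun q => - laplacian q) p.

Definition Bstar (m : nat) p : poly :=
  - ('i *: neg_laplacian_pow m p) -
  ((2 * m)%:R^-1 : R[i]) *:
    \sum_(i < N) mpolyX R[i] (mnm1 i) * mderiv i p.

Definition multi_fact b : nat := (\prod_(i < N) (b i)`!)%N.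

Definition psi_star (m : nat) b : poly :=
  ((Num.sqrt ((multi_fact b)%:R : R))^-1)%:C *:
  (mpolyX R[i] b +
   \sum_(1 <= j < (mdeg b %/ (2 * m)).+1)
     ((j`!)%:R^-1 : R[i]) *:
     iter j (fun q => 'i *: neg_laplacian_pow m q) (mpolyX R[i] b)).

Definition in_span_psi_star (m l : nat) p : Prop :=
  exists c : bmultinom N l.+1 -> R[i],
    p = \sum_(b : bmultinom N l.+1 | mdeg (bmnm b) == l)
          c b *: psi_star m (bmnm b).

Definition evalp p (y : 'rV[R]_N) : R[i] :=
  meval (fun i => (y 0 i)%:C) p.

End Hermite.

(* Main.v *)
Require Import Defs.
From mathcomp Require Import all_boot all_order all_algebra.
From mathcomp Require Import all_classical all_reals all_analysis.
From mathcomp Require Import measurable_realfun complex.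
From mathcomp Require mpoly.
From mathcomp Require Import ring lra.

Set Implicit Arguments.
Unset Strict Implicit.
Unset Printing Implicit Defensive.

Import Order.TTheory GRing.Theory Num.Theory numFieldNormedType.Exports.
Import -(notations) mpoly.

Local Open Scope classical_set_scope.
Local Open Scope ring_scope.
Local Open Scope complex_scope.

(** The kernel [F] oscillates without decay, so the solution is first rewritten as an
    absolutely convergent integral. In the Fourier integral of the kernel the space of
    frequencies is rotated to [exp (- i th) R^N] for a small angle [th > 0]: there
    [exp (- i |w| ^ 2m)] decays like [exp (- sin (2m th) |w| ^ 2m)], while the plane
    waves grow only at the rate [sin th]. The value does not change, because the
    integral is constant under real dilations of the variable, hence to first order
    under complex ones (dilated_quadratic, kernelF_rotated). By an inequality of Young
    type and the choice of [th], the growth is absorbed by the weight [rho_star] of the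
    data and a part of the decay (young_small), and Fubini's theorem yields, with [s]
    the frequency,

      [u (x, t) = C * integral of exp (z s . x + (T - t) d |s| ^ 2m) * w (s) ds],

    where [z = i exp (- i th)], [d = i exp (- 2m i th)] and [w] decays like
    [exp (- c |s| ^ 2m)] (solutionE, profile_decay).

    At [x = sg y] and [T - t = sg ^ 2m] the exponent is [sg (z s . y) + sg ^ 2m d |s| ^ 2m],
    and the decay of [w] allows an expansion in powers of [sg] under the integral. The
    coefficients of this exponential are values of the generating function of the
    generalized Hermite polynomials (hermite_generating), so the term of order [k] is a
    combination of those of degree [k], whose coefficients are the moments
    [integral of (z s) ^ b / b! * w (s) ds] with [|b| = k] (evolved_expansion). Let [l] be
    the least degree of a nonzero moment: the expansion starts at [sg ^ l] with a nonzero
    eigenfunction, and the next order gives the remainder. The degree [l] is positive since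
    the moment of degree 0 is proportional to [u (0, T)].

    It remains to exclude that all moments vanish (some_moment_neq0). A function with
    exponential moments whose polynomial moments vanish is zero almost everywhere
    (moments_ae0). Applied to [w] this kills the Laplace transform of the data along the
    rotated frequencies, whose Taylor coefficients at 0 are the moments of the data;
    applied to the data it gives [u0 = 0] (laplace_injective). *)

(** * Complex-valued integrals *)

Local Notation Re := complex.Re.
Local Notation Im := complex.Im.
Local Notation normc := Normc.normc.

Section ComplexNumbers.
Variable R : realType.
Implicit Types z w : R[i].

Lemma normc_ge0 z : 0 <= normc z.
Proof. by case: z => a b; exact: sqrtr_ge0. Qed.

Lemma normc_sqr z : normc z ^+ 2 = Re z ^+ 2 + Im z ^+ 2.
Proof. by case: z => a b; rewrite /= sqr_sqrtr// addr_ge0// sqr_ge0. Qed.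

Lemma normcD z w : normc (z + w) <= normc z + normc w.
Proof. exact: (@le_normcD R). Qed.

Lemma normcNE z : normc (- z) = normc z.
Proof. exact: (@normcN R). Qed.

Lemma normcB z w : normc (z - w) <= normc z + normc w.
Proof. by rewrite -[normc w]normcNE normcD. Qed.

Lemma normc_real (a : R) : normc (a%:C) = `|a|.
Proof. by rewrite /= expr0n addr0 sqrtr_sqr. Qed.

Lemma normc_nat (k : nat) : normc (k%:R : R[i]) = k%:R.
Proof. by rewrite -(rmorph_nat (real_complex R)) normc_real normr_nat. Qed.

Lemma normcX z n : normc (z ^+ n) = normc z ^+ n.
Proof.
elim: n => [|n IH]; first by rewrite !expr0 Normc.normc1.
by rewrite !exprS Normc.normcM IH.
Qed.

Lemma normc_sum (I : Type) (r : seq I) (P : pred I) (F : I -> R[i]) :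
  normc (\sum_(i <- r | P i) F i) <= \sum_(i <- r | P i) normc (F i).
Proof.
elim/big_rec2: _ => [|i y x _ H]; first by rewrite Normc.normc0.
by apply: le_trans (normcD _ _) _; rewrite lerD2l.
Qed.

Lemma normc_Re z : `|Re z| <= normc z.
Proof.
case: z => a b /=; rewrite -[`|a|]sqrtr_sqr ler_wsqrtr//.
by rewrite lerDl sqr_ge0.
Qed.

Lemma normc_Im z : `|Im z| <= normc z.
Proof.
case: z => a b /=; rewrite -[`|b|]sqrtr_sqr ler_wsqrtr//.
by rewrite lerDr sqr_ge0.
Qed.

Lemma ReD z w : Re (z + w) = Re z + Re w. Proof. by case: z; case: w. Qed.
Lemma ImD z w : Im (z + w) = Im z + Im w. Proof. by case: z; case: w. Qed.
Lemma ReN z : Re (- z) = - Re z. Proof. by case: z. Qed.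
Lemma ImN z : Im (- z) = - Im z. Proof. by case: z. Qed.
Lemma ReM z w : Re (z * w) = Re z * Re w - Im z * Im w.
Proof. by case: z; case: w. Qed.
Lemma ImM z w : Im (z * w) = Re z * Im w + Im z * Re w.
Proof. by case: z => a b; case: w => c d. Qed.

Lemma ReImP z w : Re z = Re w -> Im z = Im w -> z = w.
Proof. by case: z w => [a b] [c d] /= -> ->. Qed.

Lemma Re_sum (I : Type) (r : seq I) (P : pred I) (F : I -> R[i]) :
  Re (\sum_(i <- r | P i) F i) = \sum_(i <- r | P i) Re (F i).
Proof. by elim/big_rec2: _ => // i y x _ <-; rewrite ReD. Qed.

(** Multiplying [z] by the conjugate of its phase gives its modulus; this reduces
    estimates of complex quantities to estimates of real parts. *)
Lemma normc_le_proj z (b : R) : 0 <= b ->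
  (forall u : R[i], normc u = 1 -> Re (u * z) <= b) -> normc z <= b.
Proof.
move=> b0 H; have [z0|z0] := eqVneq (normc z) 0; first by rewrite z0.
have zp : 0 < normc z by rewrite lt_def z0 normc_ge0.
suff <- : Re ((((normc z)^-1)%:C * (Re z -i* Im z)) * z) = normc z.
  apply: H; rewrite Normc.normcM normc_real ger0_norm ?invr_ge0 ?normc_ge0//.
  rewrite (_ : normc (_ -i* _) = normc z) ?mulVf//.
  by case: z {z0 zp} => a b' /=; rewrite sqrrN.
apply: (mulfI z0); rewrite -expr2 normc_sqr.
by case: z {H} z0 zp => a b' z0 zp; rewrite !(ReM, ImM) /=; field.
Qed.

End ComplexNumbers.

Section ComplexIntegral.
Context d (X : measurableType d) (R : realType).
Variable mu : {measure set X -> \bar R}.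
Implicit Types (f g : X -> R[i]) (h k : X -> R).

Definition Cmeas f :=
  measurable_fun setT (fun x => Re (f x)) /\
  measurable_fun setT (fun x => Im (f x)).

Definition Cint f : R[i] :=
  (\int[mu]_x Re (f x)) +i* (\int[mu]_x Im (f x)).

Definition Rintegrable h := mu.-integrable setT (EFin \o h).

Definition Cintegrable f :=
  Rintegrable (fun x => Re (f x)) /\ Rintegrable (fun x => Im (f x)).

Lemma CmeasD f g : Cmeas f -> Cmeas g -> Cmeas (fun x => f x + g x).
Proof.
by move=> [f1 f2] [g1 g2]; split; under eq_fun do rewrite (ReD, ImD);
  exact: measurable_funD.
Qed.

Lemma CmeasM f g : Cmeas f -> Cmeas g -> Cmeas (fun x => f x * g x).
Proof.
move=> [f1 f2] [g1 g2]; split; under eq_fun do rewrite (ReM, ImM).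
  by apply: measurable_funB; exact: measurable_funM.
by apply: measurable_funD; exact: measurable_funM.
Qed.

Lemma Cmeas_cst (c : R[i]) : Cmeas (fun=> c).
Proof. by split; exact: measurable_cst. Qed.

Lemma CmeasN f : Cmeas f -> Cmeas (fun x => - f x).
Proof.
move=> [f1 f2]; split; under eq_fun do rewrite (ReN, ImN);
exact: measurableT_comp.
Qed.

Lemma Cmeas_real h : measurable_fun setT h -> Cmeas (fun x => (h x)%:C).
Proof. by move=> mh; split => //=; exact: measurable_cst. Qed.

Lemma CmeasX f n : Cmeas f -> Cmeas (fun x => f x ^+ n).
Proof.
move=> mf; elim: n => [|n IH]; first by under eq_fun do rewrite expr0;
  exact: Cmeas_cst.
by under eq_fun do rewrite exprS; exact: CmeasM.
Qed.

Lemma Cmeas_sum (I : Type) (r : seq I) (P : pred I) (F : I -> X -> R[i]) :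
  (forall i, P i -> Cmeas (F i)) -> Cmeas (fun x => \sum_(i <- r | P i) F i x).
Proof.
move=> mF; elim: r => [|i r IH].
  by rewrite (eq_fun (fun x => big_nil _ _ _ _)); exact: Cmeas_cst.
rewrite (eq_fun (fun x => big_cons _ _ _ _ _ _)).
by case: (P i) (mF i) => // H; apply: CmeasD => //; exact: H.
Qed.

Lemma Cmeas_prod (I : Type) (r : seq I) (P : pred I) (F : I -> X -> R[i]) :
  (forall i, P i -> Cmeas (F i)) -> Cmeas (fun x => \prod_(i <- r | P i) F i x).
Proof.
move=> mF; elim: r => [|i r IH].
  by rewrite (eq_fun (fun x => big_nil _ _ _ _)); exact: Cmeas_cst.
rewrite (eq_fun (fun x => big_cons _ _ _ _ _ _)).
by case: (P i) (mF i) => // H; apply: CmeasM => //; exact: H.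
Qed.

Lemma measurable_normc f : Cmeas f -> measurable_fun setT (fun x => normc (f x)).
Proof.
move=> [f1 f2].
rewrite (_ : (fun x => normc (f x)) =
    (fun x => Num.sqrt (Re (f x) ^+ 2 + Im (f x) ^+ 2))).
  apply: (measurableT_comp (continuous_measurable_fun (@sqrt_continuous R))).
  by apply: measurable_funD; exact: measurable_funX.
by apply/funext => x; rewrite -normc_sqr sqrtr_sqr ger0_norm// normc_ge0.
Qed.

Lemma Cmeas_expC f : Cmeas f -> Cmeas (fun x => expC (f x)).
Proof.
move=> [f1 f2]; apply: CmeasM.
  apply: Cmeas_real; exact: measurableT_comp.
split => /=.
  exact: (measurableT_comp (continuous_measurable_fun (@continuous_cos R))).
exact: (measurableT_comp (continuous_measurable_fun (@continuous_sin R))).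
Qed.

Lemma Rintegrable_dom h k : measurable_fun setT h -> Rintegrable k ->
  (forall x, `|h x| <= k x) -> Rintegrable h.
Proof.
move=> mh ig hk; apply: (le_integrable measurableT _ _ ig).
  exact/measurable_EFinP.
move=> x _ /=; rewrite lee_fin.
exact: le_trans (hk x) (ler_norm _).
Qed.

Lemma RintegrableZ h (c : R) : Rintegrable h -> Rintegrable (fun x => c * h x).
Proof. by move=> ih; exact: (integrableZl measurableT c ih). Qed.

Lemma RintegrableD h k : Rintegrable h -> Rintegrable k ->
  Rintegrable (fun x => h x + k x).
Proof. by move=> ih ig; exact: (integrableD measurableT ih ig). Qed.

Lemma Rintegrable_measurable h : Rintegrable h -> measurable_fun setT h.
Proof. by move=> /integrableP[/measurable_EFinP]. Qed.

Lemma Rintegrable_norm h : Rintegrable h -> Rintegrable (fun x => `|h x|).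
Proof. by move=> ih; exact: (integrable_abse ih). Qed.

Lemma Cintegrable_dom f h : Cmeas f -> Rintegrable h ->
  (forall x, normc (f x) <= h x) -> Cintegrable f.
Proof.
move=> [f1 f2] ig fg; split; apply: (Rintegrable_dom _ ig) => // x.
  exact: le_trans (normc_Re _) (fg x).
exact: le_trans (normc_Im _) (fg x).
Qed.

Lemma Cintegrable_meas f : Cintegrable f -> Cmeas f.
Proof. by case=> f1 f2; split; exact: Rintegrable_measurable. Qed.

Lemma Cintegrable_normc f : Cintegrable f -> Rintegrable (fun x => normc (f x)).
Proof.
move=> fi; have [f1 f2] := fi.
apply: (Rintegrable_dom (measurable_normc (Cintegrable_meas fi))
  (RintegrableD (Rintegrable_norm f1) (Rintegrable_norm f2))) => x.
rewrite ger0_norm ?normc_ge0//.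
rewrite -(@ler_pXn2r _ 2)// ?nnegrE ?normc_ge0 ?addr_ge0//.
rewrite normc_sqr sqrrD !real_normK ?num_real// lerD2r lerDl.
by rewrite mulrn_wge0// mulr_ge0.
Qed.

Lemma Cintegrable_real h : Rintegrable h -> Cintegrable (fun x => (h x)%:C).
Proof. by move=> ih; split => //=; exact: integrable0. Qed.

Lemma CintegrableD f g : Cintegrable f -> Cintegrable g ->
  Cintegrable (fun x => f x + g x).
Proof.
move=> [f1 f2] [g1 g2]; split; rewrite /Rintegrable;
 under eq_fun do rewrite (ReD, ImD); exact: RintegrableD.
Qed.

Lemma CintegrableZ f (c : R[i]) : Cintegrable f ->
  Cintegrable (fun x => c * f x).
Proof.
move=> fi; apply: (@Cintegrable_dom _ (fun x => normc c * normc (f x))).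
- by apply: CmeasM; [exact: Cmeas_cst|exact: Cintegrable_meas].
- exact/RintegrableZ/Cintegrable_normc.
- by move=> x; rewrite Normc.normcM.
Qed.

Lemma CintegrableN f : Cintegrable f -> Cintegrable (fun x => - f x).
Proof.
by move=> /(CintegrableZ (-1)); under eq_fun do rewrite mulN1r.
Qed.

Lemma Cintegrable_sum (I : Type) (r : seq I) (P : pred I) (F : I -> X -> R[i]) :
  (forall i, P i -> Cintegrable (F i)) ->
  Cintegrable (fun x => \sum_(i <- r | P i) F i x).
Proof.
move=> mF; elim: r => [|i r IH].
  rewrite (eq_fun (fun x => big_nil _ _ _ _)).
  by split; exact: integrable0.
rewrite (eq_fun (fun x => big_cons _ _ _ _ _ _)).
by case: (P i) (mF i) => // H; apply: CintegrableD => //; exact: H.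
Qed.

Lemma CintD f g : Cintegrable f -> Cintegrable g ->
  Cint (fun x => f x + g x) = Cint f + Cint g.
Proof.
move=> [f1 f2] [g1 g2]; apply: ReImP; rewrite ?ReD ?ImD /=.
  by under eq_Rintegral do rewrite ReD; rewrite RintegralD.
by under eq_Rintegral do rewrite ImD; rewrite RintegralD.
Qed.

Lemma CintZ f (c : R[i]) : Cintegrable f ->
  Cint (fun x => c * f x) = c * Cint f.
Proof.
move=> [f1 f2]; have Z1 r := RintegrableZ r f1; have Z2 r := RintegrableZ r f2.
apply: ReImP; rewrite ?ReM ?ImM /=.
  under eq_Rintegral do rewrite ReM.
  by rewrite (RintegralB _ (Z1 _) (Z2 _))// !RintegralZl.
under eq_Rintegral do rewrite ImM.
by rewrite (RintegralD _ (Z2 _) (Z1 _))// !RintegralZl.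
Qed.

Lemma CintN f : Cintegrable f -> Cint (fun x => - f x) = - Cint f.
Proof.
move=> fi; rewrite -mulN1r -CintZ//; congr Cint.
by apply/funext => x; rewrite mulN1r.
Qed.

Lemma CintB f g : Cintegrable f -> Cintegrable g ->
  Cint (fun x => f x - g x) = Cint f - Cint g.
Proof. by move=> fi gi; rewrite CintD ?CintN//; exact: CintegrableN. Qed.

Lemma Cint0 : Cint (fun=> 0) = 0.
Proof. by rewrite /Cint /= !Rintegral_cst ?mul0r. Qed.

Lemma Cint_sum (I : Type) (r : seq I) (P : pred I) (F : I -> X -> R[i]) :
  (forall i, P i -> Cintegrable (F i)) ->
  Cint (fun x => \sum_(i <- r | P i) F i x) = \sum_(i <- r | P i) Cint (F i).
Proof.
move=> mF; elim: r => [|i r IH].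
  by rewrite (eq_fun (fun x => big_nil _ _ _ _)) big_nil Cint0.
rewrite (eq_fun (fun x => big_cons _ _ _ _ _ _)).
rewrite big_cons; case: (P i) (mF i) => // H; rewrite CintD ?IH//.
  exact: H.
exact: Cintegrable_sum.
Qed.

(** The triangle inequality for integrals follows from the real case by testing
    the integral against all unit directions. *)
Lemma normc_Cint f h : Cintegrable f -> Rintegrable h ->
  (forall x, normc (f x) <= h x) -> normc (Cint f) <= \int[mu]_x h x.
Proof.
move=> fi hi fh; apply: normc_le_proj => [|u u1].
  by apply: Rintegral_ge0 => x _; exact: le_trans (normc_ge0 _) (fh x).
rewrite -CintZ//=; have [z1 _] := CintegrableZ u fi.
apply: le_Rintegral => // x _.
apply: le_trans (ler_norm _) _; apply: le_trans (normc_Re _) _.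
by rewrite Normc.normcM u1 mul1r.
Qed.

End ComplexIntegral.

Section ComplexFubini.
Context d1 d2 (X : measurableType d1) (Y : measurableType d2) (R : realType).
Variables (m1 : {sigma_finite_measure set X -> \bar R}).
Variables (m2 : {sigma_finite_measure set Y -> \bar R}).

Lemma Cmeas_pair1 (f : X * Y -> R[i]) x : Cmeas f -> Cmeas (fun y => f (x, y)).
Proof.
by move=> [f1 f2]; split; [apply: (measurableT_comp f1)|apply: (measurableT_comp f2)];
  exact: measurable_pair1.
Qed.

Lemma Cmeas_pair2 (f : X * Y -> R[i]) y : Cmeas f -> Cmeas (fun x => f (x, y)).
Proof.
by move=> [f1 f2]; split; [apply: (measurableT_comp f1)|apply: (measurableT_comp f2)];
  exact: measurable_pair2.
Qed.

(** Tonelli's theorem for the majorant [g1 x * g2 y]. *)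
Lemma Rintegrable_prod (f : X * Y -> R) (g1 : X -> R) (g2 : Y -> R) :
  measurable_fun setT f -> Rintegrable m1 g1 -> Rintegrable m2 g2 ->
  (forall x y, `|f (x, y)| <= g1 x * g2 y) ->
  (m1 \x m2)%E.-integrable setT (EFin \o f).
Proof.
move=> mf ig1 ig2 fg; apply/integrable12ltyP; first exact/measurable_EFinP.
have ae1 := Rintegrable_norm ig1; have ae2 := Rintegrable_norm ig2.
have [mg1 mg2] := (Rintegrable_measurable ae1, Rintegrable_measurable ae2).
apply: (@le_lt_trans _ _ (\int[m1]_x (`|g1 x|%:E * \int[m2]_y `|g2 y|%:E))%E).
  apply: ge0_le_integral => //=.
  - by move=> x _; exact: integral_ge0.
  - apply: (@measurable_fun_fubini_tonelli_F _ _ _ _ _ _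
      (fun z => `|(f z)%:E|%E)) => //.
    by apply/measurableT_comp => //; exact/measurable_EFinP.
  - apply: emeasurable_funM; first exact/measurable_EFinP.
    exact: measurable_cst.
  - move=> x _; rewrite -ge0_integralZl//; last exact/measurable_EFinP.
    apply: ge0_le_integral => //=.
    + apply/measurable_EFinP/measurableT_comp => //.
    + exact: (measurableT_comp mf (measurable_pair1 x)).
    + by apply: measurable_funeM; apply/measurable_EFinP.
    + move=> y _; rewrite -EFinM lee_fin -normrM.
      exact: le_trans (fg x y) (ler_norm _).
rewrite ge0_integralZr//; last 2 first.
- exact/measurable_EFinP.
- exact: integral_ge0.
apply: lte_mul_pinfty; first exact: integral_ge0.
- have := integrable_fin_num measurableT ae1.
  by [].
- have := integrable_lty measurableT ae2.
  by [].
Qed.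

Variables (f : X * Y -> R[i]) (g1 : X -> R) (g2 : Y -> R).
Hypotheses (mf : Cmeas f) (ig1 : Rintegrable m1 g1) (ig2 : Rintegrable m2 g2).
Hypothesis fg : forall x y, normc (f (x, y)) <= g1 x * g2 y.

Let intRe : (m1 \x m2)%E.-integrable setT (EFin \o (fun z => Re (f z))).
Proof.
apply: (Rintegrable_prod mf.1 ig1 ig2) => x y.
exact: le_trans (normc_Re _) (fg x y).
Qed.

Let intIm : (m1 \x m2)%E.-integrable setT (EFin \o (fun z => Im (f z))).
Proof.
apply: (Rintegrable_prod mf.2 ig1 ig2) => x y.
exact: le_trans (normc_Im _) (fg x y).
Qed.

Lemma Cintegrable_pair1 x : Cintegrable m2 (fun y => f (x, y)).
Proof.
by apply: (Cintegrable_dom (Cmeas_pair1 x mf) (RintegrableZ (g1 x) ig2)).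
Qed.

Lemma Cintegrable_pair2 y : Cintegrable m1 (fun x => f (x, y)).
Proof.
apply: (Cintegrable_dom (Cmeas_pair2 y mf) (RintegrableZ (g2 y) ig1)) => x.
by rewrite mulrC.
Qed.

Lemma Cmeas_Cint1 : Cmeas (fun x => Cint m2 (fun y => f (x, y))).
Proof.
split => /=.
  have := measurable_fubini_F intRe.
  by move=> /(measurableT_comp (fine_measurable measurableT)).
have := measurable_fubini_F intIm.
by move=> /(measurableT_comp (fine_measurable measurableT)).
Qed.

Lemma Cmeas_Cint2 : Cmeas (fun y => Cint m1 (fun x => f (x, y))).
Proof.
split => /=.
  have := measurable_fubini_G intRe.
  by move=> /(measurableT_comp (fine_measurable measurableT)).
have := measurable_fubini_G intIm.
by move=> /(measurableT_comp (fine_measurable measurableT)).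
Qed.

Lemma Cintegrable_Cint1 : Cintegrable m1 (fun x => Cint m2 (fun y => f (x, y))).
Proof.
apply: (Cintegrable_dom Cmeas_Cint1 (RintegrableZ (\int[m2]_y g2 y) ig1)) => x.
rewrite mulrC -RintegralZl//; apply: normc_Cint => //.
- exact: Cintegrable_pair1.
- exact: RintegrableZ.
Qed.

Lemma Cint_Fubini :
  Cint m1 (fun x => Cint m2 (fun y => f (x, y))) =
  Cint m2 (fun y => Cint m1 (fun x => f (x, y))).
Proof.
apply: ReImP => /=; congr fine.
  transitivity (\int[m1]_x \int[m2]_y (Re (f (x, y)))%:E)%E.
    apply: eq_integral => x _ /=; rewrite fineK//.
    by apply: integrable_fin_num => //; case: (Cintegrable_pair1 x).
  rewrite (Fubini intRe); apply: eq_integral => y _ /=; rewrite fineK//.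
  by apply: integrable_fin_num => //; case: (Cintegrable_pair2 y).
transitivity (\int[m1]_x \int[m2]_y (Im (f (x, y)))%:E)%E.
  apply: eq_integral => x _ /=; rewrite fineK//.
  by apply: integrable_fin_num => //; case: (Cintegrable_pair1 x).
rewrite (Fubini intIm); apply: eq_integral => y _ /=; rewrite fineK//.
by apply: integrable_fin_num => //; case: (Cintegrable_pair2 y).
Qed.

End ComplexFubini.

(** * The complex exponential *)

Section ComplexExponential.
Variable R : realType.
Implicit Types (z w u : R[i]) (t r : R).

Lemma expCD z w : expC (z + w) = expC z * expC w.
Proof.
rewrite /expC ReD ImD expRD cosD sinD; apply: ReImP; rewrite !(ReM, ImM) /=; ring.
Qed.

Lemma normc_expC z : normc (expC z) = expR (Re z).
Proof.
rewrite Normc.normcM normc_real ger0_norm ?expR_ge0//=.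
by rewrite cos2Dsin2 sqrtr1 mulr1.
Qed.

Lemma expC0 : expC (0 : R[i]) = 1.
Proof. by rewrite /expC /= expR0 cos0 sin0 mul1r. Qed.

Lemma expC_neq0 z : expC z != 0.
Proof.
by apply/eqP => z0; have := expR_gt0 (Re z); rewrite -normc_expC z0 Normc.normc0 ltxx.
Qed.

Lemma expCX z n : expC z ^+ n = expC (n%:R * z).
Proof.
elim: n => [|n IH]; first by rewrite expr0 mul0r expC0.
by rewrite exprS IH -expCD -[n.+1]addn1 natrD mulrDl mul1r addrC.
Qed.

Lemma Re_expC z : Re (expC z) = expR (Re z) * cos (Im z).
Proof. by rewrite /expC ReM /= mul0r subr0. Qed.

Lemma Im_expC z : Im (expC z) = expR (Re z) * sin (Im z).
Proof. by rewrite /expC ImM /= mul0r addr0. Qed.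

Lemma Re_realM t z : Re (t%:C * z) = t * Re z.
Proof. by rewrite ReM /= mul0r subr0. Qed.

Lemma Im_realM t z : Im (t%:C * z) = t * Im z.
Proof. by rewrite ImM /= mul0r addr0. Qed.

Lemma expC_real t : expC (t%:C) = (expR t)%:C.
Proof. by rewrite /expC /= cos0 sin0; apply: ReImP; rewrite !(ReM, ImM) /=; ring. Qed.

Definition exp_trunc k z : R[i] := \sum_(j < k) (j`!%:R)^-1 * z ^+ j.

(** [expD k u z t] is the [u]-projection of the Taylor remainder of order [k]
    of the exponential at [t z]; its [t]-derivative is again of this form, which
    turns remainder estimates into inductions on [k]. *)
Let expP k u z : {poly R} := \sum_(j < k) ((j`!%:R)^-1 * Re (u * z ^+ j)) *: 'X^j.
Let expD k u z t := Re (u * expC (t%:C * z)) - (expP k u z).[t].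

Let expPE k u z t :
  (expP k u z).[t] = Re (u * exp_trunc k (t%:C * z)).
Proof.
rewrite /expP /exp_trunc mulr_sumr Re_sum horner_sum; apply: eq_bigr => j _.
rewrite !hornerE exprMn -rmorphXn/=.
rewrite (_ : (j`!%:R : R[i])^-1 = ((j`!%:R)^-1)%:C); last first.
  by rewrite fmorphV/= rmorph_nat.
by rewrite !(ReM, ImM) /=; ring.
Qed.

Let expDE k u z t :
  expD k u z t = Re (u * (expC (t%:C * z) - exp_trunc k (t%:C * z))).
Proof. by rewrite /expD expPE mulrBr ReD ReN. Qed.

Let expP_deriv k u z : (expP k.+1 u z)^`() = expP k (u * z) z.
Proof.
rewrite /expP big_ord_recl derivD /= expr0 alg_polyC derivC add0r.
rewrite raddf_sum; apply: eq_bigr => j _ /=.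
rewrite derivZ derivXn /= -[_ *+ bump 0 j]scaler_nat scalerA; congr (_ *: _).
rewrite exprS mulrA /bump /= factS natrM.
rewrite add1n; have a0 : j.+1%:R != 0 :> R by rewrite pnatr_eq0.
have b0 : j`!%:R != 0 :> R by rewrite pnatr_eq0 -lt0n fact_gt0.
by move: (j.+1%:R) (j`!%:R) a0 b0 => a b a0 b0; field; rewrite a0 b0.
Qed.

Let is_derive_exp u z t :
  is_derive t 1 (fun s => Re (u * expC (s%:C * z))) (Re (u * z * expC (t%:C * z))).
Proof.
rewrite (_ : (fun s => Re (u * expC (s%:C * z))) = (fun s =>
    expR (s * Re z) * (Re u * cos (s * Im z) - Im u * sin (s * Im z)))); last first.
  apply/funext => s; rewrite ReM Re_expC Im_expC Re_realM Im_realM; ring.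
apply: is_derive_eq; rewrite /GRing.scale/= (ReM (u * z)) (ReM u z) (ImM u z).
by rewrite Re_expC Im_expC Re_realM Im_realM; ring.
Qed.

Let is_derive_expD k u z t :
  is_derive t 1 (expD k.+1 u z) (expD k (u * z) z t).
Proof.
rewrite /expD -expP_deriv; have := is_derive_exp u z t => H.
exact: is_deriveB.
Qed.

Let expD0 k u z : expD k.+1 u z 0 = 0.
Proof.
rewrite expDE mul0r expC0 /exp_trunc big_ord_recl expr0 fact0 invr1 mulr1.
rewrite big1 ?addr0 ?subrr ?mulr0// => j _.
by rewrite exprS mul0r mulr0.
Qed.

(** The mean value theorem for [g - f]. *)
Lemma le_of_le_derive (f g df dg : R -> R) t : 0 <= t ->
  (forall s : R, is_derive s 1 f (df s)) ->
  (forall s : R, is_derive s 1 g (dg s)) ->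
  (forall s, 0 <= s -> s <= t -> df s <= dg s) -> f 0 <= g 0 -> f t <= g t.
Proof.
move=> t0 fd gd fg fg0.
have hd (s : R) : is_derive s 1 (g - f) (dg s - df s) by exact: is_deriveB.
have [c|c] := @MVT_segment R (g - f) (fun s => dg s - df s) 0 t t0
  (fun x _ => hd x).
  apply: derivable_within_continuous => x _; exact: (@ex_derive _ _ _ _ _ _ _ (hd x)).
rewrite in_itv /= => /andP[c0 ct]; rewrite subr0 !fctE => E.
have : 0 <= (dg c - df c) * t by rewrite mulr_ge0// subr_ge0 fg.
rewrite -E; lra.
Qed.

Let expD_le k u z t : 0 <= t ->
  expD k u z t <= expD k ((normc u)%:C) ((normc z)%:C) t.
Proof.
elim: k u t => [|k IH] u t t0.
  rewrite !expDE /exp_trunc !big_ord0 !subr0 -rmorphM expC_real -rmorphM/=.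
  apply: le_trans (ler_norm _) _; apply: le_trans (normc_Re _) _.
  rewrite Normc.normcM normc_expC ler_wpM2l ?normc_ge0// ler_expR ReM/= mul0r subr0.
  by rewrite ler_wpM2l//; exact: le_trans (ler_norm _) (normc_Re _).
apply: (le_of_le_derive t0 (is_derive_expD k u z) (is_derive_expD k _ _)).
  by move=> s s0 st; rewrite -rmorphM -Normc.normcM; exact: IH.
by rewrite !expD0.
Qed.

Let exp_rem k r : R := expR r - \sum_(j < k) (j`!%:R)^-1 * r ^+ j.

Let expD_real k t r : expD k 1 (r%:C) t = exp_rem k (t * r).
Proof.
rewrite /expD -rmorphM expC_real mul1r/= /exp_rem; congr (_ - _).
rewrite /expP horner_sum; apply: eq_bigr => j _.
by rewrite !hornerE ?mul1r -rmorphXn/= exprMn -!mulrA [_ * r ^+ _]mulrC.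
Qed.

Let is_derive_exp_rem k r : is_derive r 1 (exp_rem k.+1) (exp_rem k r).
Proof.
have H := is_derive_expD k 1 (1%:C) r.
have E j : expD j 1 1%:C = exp_rem j.
  by apply/funext => t; rewrite expD_real mulr1.
by rewrite -!E; move: H; rewrite mul1r.
Qed.

Let exp_rem0 k : exp_rem k.+1 0 = 0.
Proof. by have := expD0 k 1 (1%:C); rewrite expD_real mul0r. Qed.

Let exp_rem_scale k r t : 0 <= t <= 1 -> 0 <= r ->
  exp_rem k (t * r) <= t ^+ k * exp_rem k r.
Proof.
move=> /andP[t0 t1].
elim: k r => [|k IH] r r0.
  rewrite /exp_rem !big_ord0 !subr0 expr0 mul1r ler_expR.
  by rewrite ler_piMl.
apply: (@le_of_le_derive (fun r => exp_rem k.+1 (t * r))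
  (fun r => t ^+ k.+1 * exp_rem k.+1 r) (fun r => t * exp_rem k (t * r))
  (fun r => t ^+ k.+1 * exp_rem k r)) => //.
- move=> s; have := is_derive_exp_rem k (t * s) => Hd.
  have Hm : is_derive s 1 (fun x : R => t * x) t.
    apply: is_derive_eq; rewrite /GRing.scale /=; ring.
  have := @is_derive1_comp R (exp_rem k.+1) (fun x => t * x) s _ _ Hd Hm.
  by rewrite mulrC.
- move=> s; have := is_derive_exp_rem k s => Hd.
  exact: is_deriveZ.
- by move=> s s0 sr; rewrite exprS -mulrA ler_wpM2l// IH.
- by rewrite mulr0 exp_rem0 mulr0.
Qed.

Let exp_rem_le k r : 0 <= r -> exp_rem k r <= expR r.
Proof.
move=> r0; rewrite /exp_rem gerBl; apply: sumr_ge0 => j _.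
by rewrite mulr_ge0 ?exprn_ge0// invr_ge0.
Qed.

Let exp_rem_ge0 k r : 0 <= r -> 0 <= exp_rem k r.
Proof.
elim: k r => [|k IH] r r0; first by rewrite /exp_rem big_ord0 subr0 expR_ge0.
apply: (@le_of_le_derive (fun=> 0) (exp_rem k.+1) (fun=> 0) (exp_rem k)) => //.
- by move=> s s0 _; exact: IH.
- by rewrite exp_rem0.
Qed.

Lemma normc_exp_trunc k z : normc (exp_trunc k z) <= expR (normc z).
Proof.
apply: le_trans (normc_sum _ _ _) _.
have := exp_rem_ge0 k (normc_ge0 z); rewrite /exp_rem subr_ge0; apply: le_trans.
apply: ler_sum => j _; rewrite Normc.normcM normcX Normc.normcV.
by rewrite normc_nat.
Qed.

(** Through their derivatives, the projections of the remainder are dominated by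
    the remainder of the real exponential at [t * |z|], all of whose terms carry at
    least the factor [t ^ k]. *)
Lemma expC_taylor k t z : 0 <= t <= 1 ->
  normc (expC (t%:C * z) - exp_trunc k (t%:C * z)) <= t ^+ k * expR (normc z).
Proof.
move=> /andP[t0 t1]; apply: normc_le_proj => [|u u1].
  by rewrite mulr_ge0 ?exprn_ge0 ?expR_ge0.
rewrite -expDE; apply: le_trans (expD_le k u z t0) _.
rewrite u1 expD_real.
apply: le_trans (exp_rem_scale k _ (normc_ge0 z)) _; first exact/andP.
by rewrite ler_wpM2l ?exprn_ge0// exp_rem_le// normc_ge0.
Qed.

(** In the closed left half-plane the derivative of the exponential has modulus at
    most 1. *)
Lemma normc_expC_sub1 z : Re z <= 0 -> normc (expC z - 1) <= normc z.
Proof.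
move=> z0; apply: normc_le_proj => [|u u1]; first exact: normc_ge0.
suff : expD 1 u z 1 <= 1 * normc z.
  rewrite expDE mul1r /exp_trunc big_ord_recl big_ord0 addr0 expr0 fact0 invr1.
  by rewrite !mul1r.
apply: (@le_of_le_derive (expD 1 u z) (fun t => t * normc z)
  (expD 0 (u * z) z) (fun=> normc z)) => //.
- by move=> s; apply: is_derive_eq; rewrite /GRing.scale/= mulr1 mulr0 add0r.
- move=> s s0 s1; rewrite expDE /exp_trunc big_ord0 subr0.
  apply: le_trans (ler_norm _) _; apply: le_trans (normc_Re _) _.
  rewrite (Normc.normcM (u * z)) (Normc.normcM u) normc_expC u1 mul1r ler_piMr ?normc_ge0//.
  by rewrite -expR0 ler_expR Re_realM mulr_ge0_le0.
- by rewrite expD0 mul0r.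
Qed.

Lemma normc_expCB z w :
  normc (expC z - expC w) <= normc (z - w) * Num.max (expR (Re z)) (expR (Re w)).
Proof.
wlog zw : z w / Re z <= Re w.
  move=> H; have [|/ltW zw] := leP (Re z) (Re w); first exact: H.
  by rewrite -normcNE opprB -[normc (z - w)]normcNE opprB maxC H.
rewrite (_ : expC z - expC w = expC w * (expC (z - w) - 1)); last first.
  by rewrite mulrBr mulr1 -expCD addrCA subrr addr0.
rewrite Normc.normcM normc_expC mulrC ler_pM ?normc_ge0 ?expR_ge0//.
  by rewrite normc_expC_sub1// ReD ReN subr_le0.
by rewrite le_max lexx orbT.
Qed.

End ComplexExponential.

(** * Scaling and integrability on R^N *)

Section LebesgueScaling.
Variable R : realType.
Local Notation B := (measurableTypeR R).

Definition scaleT n (c : R) (s : n.-tuple B) : n.-tuple B :=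
  [tuple of map ( *%R c) s].

Lemma tnth_scaleT n (c : R) (s : n.-tuple B) i :
  tnth (scaleT c s) i = c * tnth s i.
Proof. by rewrite tnth_map. Qed.

Lemma measurable_scaleT n (c : R) : measurable_fun setT (@scaleT n c).
Proof.
apply/measurable_fun_tnthP => i.
rewrite (_ : _ \o _ = (fun s => c * tnth s i)); last first.
  by apply/funext => s /=; rewrite tnth_scaleT.
apply: (measurableT_comp (@mulrl_measurable R setT c)).
exact: measurable_tnth.
Qed.

Lemma scaleT_consT n (c x : R) (s : n.-tuple B) :
  scaleT c (consT (x, s)) = consT (c * x, scaleT c s).
Proof. exact: val_inj. Qed.

(** The image of Lebesgue measure by a dilation is identified on intervals. *)
Lemma ge0_integral_scale1 (c : R) (f : B -> \bar R) : 0 < c ->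
  measurable_fun setT f -> (forall x, 0 <= f x)%E ->
  (\int[lebesgue_measure]_x f (c * x)%R =
    (c^-1)%:E * \int[lebesgue_measure]_x f x)%E.
Proof.
move=> c0 mf f0; have cn0 := lt0r_neq0 c0.
have mc : measurable_fun setT ( *%R c : B -> B) by exact: mulrl_measurable.
have ci0 : 0 <= c^-1 by rewrite invr_ge0 ltW.
pose k := NngNum ci0.
pose nu := measure_function_pushforward__canonical__measure_function_Measure
  (@lebesgue_measure R) mc.
transitivity (\int[nu]_x f x)%E; first by rewrite ge0_integral_pushforward.
transitivity (\int[mscale k (@lebesgue_measure R)]_x f x)%E; last first.
  by rewrite ge0_integral_mscale.
apply: eq_measure_integral => A mA _.
have H : forall A, measurable A -> lebesgue_measure A =
    mscale (NngNum (ltW c0)) nu A.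
  apply: lebesgue_measure_unique => X [[a b] _ <-] /=.
  rewrite /mscale/= /pushforward.
  rewrite (_ : _ @^-1` _ = `]c^-1 * a, c^-1 * b]%classic); last first.
    apply/seteqP; split => x /=; rewrite !in_itv/= => /andP[h1 h2].
      by rewrite ltr_pdivrMl// ler_pdivlMl// h1 h2.
    by move: h1 h2; rewrite ltr_pdivrMl// ler_pdivlMl// => -> ->.
  rewrite !lebesgue_measure_itv/= !lte_fin ltr_pM2l ?invr_gt0//.
  case: ifPn => _; last by rewrite mule0.
  by rewrite -!EFinB -EFinM -mulrBr mulrA divff// mul1r.
change (nu A = ((c^-1)%:E * lebesgue_measure A)%E).
rewrite (H A mA) [in RHS]/mscale/= muleA -EFinM mulVf// mul1e.
by [].
Qed.

Lemma lebesgueN_tonelli n (f : n.+1.-tuple B -> \bar R) :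
  measurable_fun setT f -> (forall s, 0 <= f s)%E ->
  (\int[lebesgueN R n.+1]_s f s =
   \int[lebesgue_measure]_x \int[lebesgueN R n]_s f (consT (x, s)))%E.
Proof.
move=> mf f0.
transitivity (\int[pushforward ((@lebesgue_measure R) \x lebesgueN R n)%E
  (@consT R n)]_s f s)%E; first by [].
rewrite ge0_integral_pushforward//; last exact: measurable_consT.
rewrite preimage_setT fubini_tonelli1//.
  by apply: measurableT_comp => //; exact: measurable_consT.
by move=> x; exact: f0.
Qed.

Lemma ge0_integral_scaleT n (c : R) (f : n.-tuple B -> \bar R) : 0 < c ->
  measurable_fun setT f -> (forall s, 0 <= f s)%E ->
  (\int[lebesgueN R n]_s f (scaleT c s) =
   ((c ^+ n)^-1)%:E * \int[lebesgueN R n]_s f s)%E.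
Proof.
move=> c0; elim: n f => [|n IH] f mf f0.
  rewrite expr0 invr1 mul1e; apply: eq_integral => s _; congr f.
  by apply: eq_from_tnth => -[].
have mfs : measurable_fun setT (fun s => f (scaleT c s)).
  by apply: (measurableT_comp mf); exact: measurable_scaleT.
rewrite !lebesgueN_tonelli//.
under eq_integral => x _.
  under eq_integral do rewrite scaleT_consT.
  rewrite (IH (fun s => f (consT (c * x, s)))%R)//; last first.
    apply: (measurableT_comp mf); apply: (measurableT_comp (@measurable_consT R n)).
    exact: measurable_pair1.
  over.
have mF : measurable_fun setT
    (fun x : B => (\int[lebesgueN R n]_s f (consT (x, s)))%E).
  apply: (@measurable_fun_fubini_tonelli_F _ _ _ _ R (lebesgueN R n)
    (fun p => f (consT p))) => //.
  by apply: (measurableT_comp mf); exact: measurable_consT.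
have F0 (x : B) : (0 <= \int[lebesgueN R n]_s f (consT (x, s)))%E.
  by apply: integral_ge0 => s _; exact: f0.
rewrite ge0_integralZl//=; last 2 first.
- apply: (measurableT_comp mF); exact: mulrl_measurable.
- by rewrite lee_fin invr_ge0 exprn_ge0// ltW.
rewrite (@ge0_integral_scale1 c (fun x : B =>
   \int[lebesgueN R n]_s f (consT (x, s)))%E)//.
by rewrite muleA -EFinM -invfM -exprSr.
Qed.

Lemma Rintegral_scaleT n (c : R) (h : n.-tuple B -> R) : 0 < c ->
  Rintegrable (lebesgueN R n) h ->
  \int[lebesgueN R n]_s h (scaleT c s) =
  (c ^+ n)^-1 * \int[lebesgueN R n]_s h s.
Proof.
move=> c0 ih; have := ih => /integrableP[mh _].
rewrite /Rintegral.
suff -> : (\int[lebesgueN R n]_s (h (scaleT c s))%:E =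
    ((c ^+ n)^-1)%:E * \int[lebesgueN R n]_s (h s)%:E)%E.
  by rewrite fineM//; exact: integrable_fin_num.
rewrite integralE [in RHS]integralE muleBr//.
  rewrite -!ge0_integral_scaleT//; last 2 first.
  - exact: measurable_funeneg.
  - exact: measurable_funepos.
  rewrite (_ : (fun s => (h (scaleT c s))%:E) = (EFin \o h) \o scaleT c)//.
  by rewrite funepos_comp funeneg_comp.
apply: fin_num_adde_defl; rewrite fin_numN.
apply: (integrable_fin_num measurableT); exact: (integrable_funeneg measurableT).
Qed.

Lemma Cint_scaleT n (c : R) (f : n.-tuple B -> R[i]) : 0 < c ->
  Cintegrable (lebesgueN R n) f ->
  Cint (lebesgueN R n) f =
  (c ^+ n)%:C * Cint (lebesgueN R n) (fun s => f (scaleT c s)).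
Proof.
move=> c0 [f1 f2]; have cn0 : c ^+ n != 0 by rewrite expf_neq0// lt0r_neq0.
apply: ReImP; rewrite ?Re_realM ?Im_realM/=.
  by rewrite (@Rintegral_scaleT n c (fun s => Re (f s)))// mulrA divff// mul1r.
by rewrite (@Rintegral_scaleT n c (fun s => Im (f s)))// mulrA divff// mul1r.
Qed.

End LebesgueScaling.

Section EuclideanNorm.
Variables (R : realType) (N : nat).
Implicit Types (x y : 'rV[R]_N).
Local Notation B := (measurableTypeR R).

Lemma dotC x y : dot x y = dot y x.
Proof. by apply: eq_bigr => i _; rewrite mulrC. Qed.

Lemma dotDl x y z : dot (x + y) z = dot x z + dot y z.
Proof. by rewrite -big_split; apply: eq_bigr => i _; rewrite mxE mulrDl. Qed.

Lemma dotZl (c : R) x y : dot (c *: x) y = c * dot x y.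
Proof. by rewrite mulr_sumr; apply: eq_bigr => i _; rewrite mxE mulrA. Qed.

Lemma dotDr x y z : dot z (x + y) = dot z x + dot z y.
Proof. by rewrite dotC dotDl dotC [dot y z]dotC. Qed.

Lemma dotZr (c : R) x y : dot y (c *: x) = c * dot y x.
Proof. by rewrite dotC dotZl dotC. Qed.

Lemma dotNr x y : dot y (- x) = - dot y x.
Proof. by rewrite -scaleN1r dotZr mulN1r. Qed.

Lemma dot0r y : dot y 0 = 0.
Proof. by rewrite -(scale0r 0) dotZr mul0r. Qed.

Lemma dot_ge0 x : 0 <= dot x x.
Proof. by apply: sumr_ge0 => i _; rewrite -expr2 sqr_ge0. Qed.

Lemma enorm_ge0 x : 0 <= enorm x. Proof. exact: sqrtr_ge0. Qed.

Lemma enorm_sqr x : enorm x ^+ 2 = dot x x.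
Proof. by rewrite sqr_sqrtr// dot_ge0. Qed.

Lemma enormZ (c : R) x : enorm (c *: x) = `|c| * enorm x.
Proof. by rewrite /enorm dotZl dotZr mulrA -expr2 sqrtrM ?sqr_ge0// sqrtr_sqr. Qed.

Lemma enorm_coord x i : `|x 0 i| <= enorm x.
Proof.
rewrite -sqrtr_sqr ler_wsqrtr// /dot (bigD1 i)//= -expr2 lerDl.
by apply: sumr_ge0 => j _; rewrite -expr2 sqr_ge0.
Qed.

(** Cauchy-Schwarz up to the factor [N], which comes from bounding each coordinate
    by the norm; the constant is immaterial in what follows. *)
Lemma dot_le x y : `|dot x y| <= N%:R * (enorm x * enorm y).
Proof.
apply: le_trans (ler_norm_sum _ _ _) _.
apply: (@le_trans _ _ (\sum_(i < N) enorm x * enorm y)).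
  by apply: ler_sum => i _; rewrite normrM ler_pM// enorm_coord.
by rewrite sumr_const card_ord mulr_natl.
Qed.

Lemma vec_scaleT (c : R) (s : N.-tuple B) : vec (scaleT c s) = c *: vec s.
Proof. by apply/rowP => i; rewrite !mxE tnth_scaleT. Qed.

Section Measurability.
Context d (X : measurableType d).
Implicit Types (f g : X -> 'rV[R]_N).

Definition vmeas f := forall i, measurable_fun setT (fun a => f a 0 i).

Lemma measurable_dot f g : vmeas f -> vmeas g ->
  measurable_fun setT (fun a => dot (f a) (g a)).
Proof. by move=> mf mg; apply: measurable_sum => i; exact: measurable_funM. Qed.

Lemma measurable_enorm f : vmeas f -> measurable_fun setT (fun a => enorm (f a)).
Proof.
move=> mf.
apply: (measurableT_comp (continuous_measurable_fun (@sqrt_continuous R))).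
exact: measurable_dot.
Qed.

Lemma vmeas_cst x : vmeas (fun=> x).
Proof. by move=> i; exact: measurable_cst. Qed.

End Measurability.

Lemma vmeas_vec : vmeas (@vec R N).
Proof.
move=> i; rewrite (_ : (fun a => _) = (fun s => tnth s i)).
  exact: measurable_tnth.
by apply/funext => s; rewrite mxE.
Qed.

End EuclideanNorm.

Section ExponentialDecay.
Variable R : realType.
Local Notation B := (measurableTypeR R).

Lemma integral_expN_norm :
  (\int[lebesgue_measure]_(x in [set: R]) (expR (- `|x|))%:E < +oo)%E.
Proof.
rewrite ge0_symfun_integralT//=; last 2 first.
- move=> x; apply: continuous_comp; last exact: continuous_expR.
  by apply: continuousN; exact: norm_continuous.
- by move=> x /=; rewrite normrN.
rewrite lte_mul_pinfty//.
have H := @integral_exponential_pdf R 1 ltr01.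
apply: (@le_lt_trans _ _ 1%E); last by rewrite ltry.
rewrite -H [leRHS](_ : _ = \int[lebesgue_measure]_(x in [set: R])
   (exponential_pdf 1 x)%:E)%E//.
rewrite integral_mkcond; apply: ge0_le_integral => //=.
- by move=> x _; rewrite patchE; case: ifPn => //; rewrite lee_fin expR_ge0.
- apply/(measurable_restrictT _ _).1 => //.
    rewrite (_ : [set x | _] = `[0, +oo[%classic)//.
    by apply/seteqP; split => x /=; rewrite in_itv/= andbT.
  apply/measurable_EFinP; apply: measurableT_comp => //.
  by apply: measurableT_comp => //.
- by apply/measurable_EFinP; exact: measurable_exponential_pdf.
- move=> x _; rewrite patchE; case: ifPn => [|_]; last first.
    by rewrite lee_fin exponential_pdf_ge0.
  rewrite inE/= => x0; rewrite exponential_pdfE// mul1r mulN1r.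
  by rewrite ger0_norm.
Qed.

Definition coord_norm n (s : n.-tuple B) : R := \sum_(i < n) `|tnth s i|.

Lemma measurable_coord_norm n : measurable_fun setT (@coord_norm n).
Proof.
by apply: measurable_sum => i; apply: measurableT_comp => //; exact: measurable_tnth.
Qed.

Lemma coord_norm_consT n (x : R) (s : n.-tuple B) :
  coord_norm (consT (x, s)) = `|x| + coord_norm s.
Proof.
rewrite /coord_norm big_ord_recl /=; congr (`|_| + _).
by apply: eq_bigr => i _; rewrite tnthS.
Qed.

(** The function is a product of functions of one coordinate, which allows an
    induction on the dimension. *)
Lemma Rintegrable_expN_coord n :
  Rintegrable (lebesgueN R n) (fun s => expR (- coord_norm s)).
Proof.
have me k : measurable_fun setT (fun s : k.-tuple B => expR (- coord_norm s)).
  apply: measurableT_comp => //; apply: measurableT_comp => //.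
  exact: measurable_coord_norm.
apply/integrableP; split; first by apply/measurable_EFinP; exact: me.
under eq_integral => s _ do rewrite /= ger0_norm ?expR_ge0//.
elim: n => [|n IH].
  rewrite (_ : (\int[_]_x _ = \int[\d_ ([tuple] : 0.-tuple B)]_x
    (expR (- coord_norm x))%:E)%E)//.
  rewrite integral_dirac//; last by apply/measurable_EFinP; exact: me.
  by rewrite diracT mul1e ltry.
rewrite lebesgueN_tonelli//; last by apply/measurable_EFinP; exact: me.
under eq_integral => x _.
  under eq_integral do rewrite coord_norm_consT opprD expRD EFinM.
  rewrite ge0_integralZl//; last by apply/measurable_EFinP; exact: me.
  over.
rewrite ge0_integralZr//; last 2 first.
- apply/measurable_EFinP; apply: measurableT_comp => //.
  by apply: measurableT_comp => //.
- by apply: integral_ge0 => s _; rewrite lee_fin expR_ge0.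
apply: lte_mul_pinfty => //.
  by apply: integral_ge0 => s _; rewrite lee_fin expR_ge0.
rewrite ge0_fin_numE; first exact: integral_expN_norm.
by apply: integral_ge0 => s _; rewrite lee_fin expR_ge0.
Qed.

Lemma coord_norm_le n (s : n.-tuple B) : coord_norm s <= n%:R * enorm (vec s).
Proof.
apply: (@le_trans _ _ (\sum_(i < n) enorm (vec s))).
  by apply: ler_sum => i _; rewrite -[tnth s i](_ : vec s 0 i = _) ?enorm_coord// mxE.
by rewrite sumr_const card_ord mulr_natl.
Qed.

Lemma Rintegrable_expN n : Rintegrable (lebesgueN R n)
  (fun s => expR (- (n%:R * enorm (vec s)))).
Proof.
apply: (Rintegrable_dom _ (Rintegrable_expN_coord n)) => [|s].
  apply: measurableT_comp => //; apply: measurableT_comp => //.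
  apply: measurable_funM => //; apply: measurable_enorm; exact: vmeas_vec.
by rewrite ger0_norm ?expR_ge0// ler_expR lerN2 coord_norm_le.
Qed.

Lemma measurable_vec_fun n (g : R -> R) : measurable_fun setT g ->
  measurable_fun setT (fun s : n.-tuple B => g (enorm (vec s))).
Proof.
move=> mg; apply: (measurableT_comp mg); apply: measurable_enorm; exact: vmeas_vec.
Qed.

(** The source of integrability for all exponential integrands below: a continuous
    exponent that tends to minus infinity faster than linearly satisfies the hypothesis
    for some [C]. *)
Lemma Rintegrable_exp_radial n (g : R -> R) (C : R) : measurable_fun setT g ->
  (forall r, 0 <= r -> g r <= C - n%:R * r) ->
  Rintegrable (lebesgueN R n) (fun s => expR (g (enorm (vec s)))).
Proof.
move=> mg gC.
apply: (Rintegrable_dom _ (RintegrableZ (expR C) (Rintegrable_expN n))) => [|s].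
  by apply: measurableT_comp => //; exact: measurable_vec_fun.
by rewrite ger0_norm ?expR_ge0// -expRD ler_expR gC// enorm_ge0.
Qed.

End ExponentialDecay.

(** * Rotating the contour in the kernel *)

Section Rotation.
Variables (R : realType) (N m : nat).
Hypothesis m_gt0 : (0 < m)%N.
Local Notation B := (measurableTypeR R).
Local Notation mu := (lebesgueN R N).
Implicit Types (s : N.-tuple B) (y : 'rV[R]_N) (a z d tau : R[i]).
Local Notation r := (fun s => enorm (vec s)).

Lemma sqr_le_pow (x : R) : 0 <= x -> x ^+ 2 <= 1 + x ^+ (2 * m).
Proof.
move=> x0; have [x1|x1] := leP x 1.
  by apply: ler_wpDr; rewrite ?exprn_ge0// expr_le1.
apply: ler_wpDl => //; apply: ler_weXn2l; first exact: ltW.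
by rewrite -[X in (X <= _)%N]muln1 leq_mul2l.
Qed.

Lemma le_expR (x : R) : x <= expR x.
Proof. by apply: le_trans (expR_ge1Dx x); rewrite lerDr. Qed.

Lemma pow_le_expR k (x : R) : 0 <= x -> x ^+ k <= k%:R ^+ k * expR x.
Proof.
case: k => [|k] x0; first by rewrite !expr0 mul1r -expR0 ler_expR.
have k0 : 0 < k.+1%:R :> R by rewrite ltr0n.
have : (x / k.+1%:R) ^+ k.+1 <= expR (x / k.+1%:R) ^+ k.+1.
  by rewrite ler_pXn2r ?nnegrE ?divr_ge0 ?expR_ge0 ?ler0n// le_expR.
rewrite -expRM_natl mulrCA divff ?lt0r_neq0// mulr1 exprMn exprVn.
by rewrite ler_pdivrMr ?exprn_gt0// mulrC.
Qed.

Lemma Rintegrable_gauss (C0 A b : R) : 0 < b ->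
  Rintegrable mu (fun s => expR (C0 + A * r s - b * r s ^+ 2)).
Proof.
move=> b0.
apply: (@Rintegrable_exp_radial _ _ (fun x => C0 + A * x - b * x ^+ 2)
  (C0 + (A + N%:R) ^+ 2 / (4 * b))).
  apply: measurable_funB; last exact: measurable_funM.
  by apply: measurable_funD => //; exact: measurable_funM.
move=> x x0; rewrite -subr_ge0.
rewrite (_ : _ - _ = b * (x - (A + N%:R) / (2 * b)) ^+ 2); last first.
  by field; rewrite lt0r_neq0.
by rewrite mulr_ge0 ?sqr_ge0// ltW.
Qed.

Lemma Rintegrable_pow (C0 A b : R) : 0 < b ->
  Rintegrable mu (fun s => expR (C0 + A * r s - b * r s ^+ (2 * m))).
Proof.
move=> b0.
apply: (Rintegrable_dom _ (Rintegrable_gauss (C0 + b) A b0)) => [|s].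
  apply: (measurable_vec_fun (g := fun x => expR (C0 + A * x - b * x ^+ (2 * m)))).
  apply: measurableT_comp => //.
  apply: measurable_funB; last exact: measurable_funM.
  by apply: measurable_funD => //; exact: measurable_funM.
rewrite ger0_norm ?expR_ge0// ler_expR.
have := sqr_le_pow (enorm_ge0 (vec s)).
by move=> /(ler_wpM2l (ltW b0)); lra.
Qed.

(** For [a = 0] and [z = d = i] this is the phase of the kernel. The coefficient
    [a] carries the Gaussian cut-off of the oscillatory integral, and complex values
    of [z] and [d] describe the integral over a rotated space. *)
Definition phase a z d y s : R[i] :=
  - (a * (r s ^+ 2)%:C) + z * (dot (vec s) y)%:C - d * (r s ^+ (2 * m))%:C.

Definition kernelJ a z d y : R[i] := Cint mu (fun s => expC (phase a z d y s)).

Lemma Cmeas_phase a z d y : Cmeas (phase a z d y).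
Proof.
have mr k : measurable_fun setT (fun s => r s ^+ k).
  exact: (measurable_vec_fun (g := fun x => x ^+ k)).
apply: CmeasD; first apply: CmeasD.
- by apply: CmeasN; apply: CmeasM; [exact: Cmeas_cst|exact: Cmeas_real].
- apply: CmeasM; [exact: Cmeas_cst|apply: Cmeas_real].
  by apply: measurable_dot; [exact: vmeas_vec|exact: vmeas_cst].
- by apply: CmeasN; apply: CmeasM; [exact: Cmeas_cst|exact: Cmeas_real].
Qed.

Lemma Re_Mreal z (x : R) : Re (z * x%:C) = Re z * x.
Proof. by rewrite mulrC Re_realM mulrC. Qed.

Lemma Re_phase_le a z d y s : Re (phase a z d y s) <=
  (normc z * N%:R * enorm y) * r s - Re a * r s ^+ 2 - Re d * r s ^+ (2 * m).
Proof.
rewrite /phase !ReD !ReN !Re_Mreal lerB// addrC lerB//.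
apply: le_trans (ler_norm _) _; rewrite normrM.
have /ler_pM H := normc_Re z; apply: le_trans (H _ _ _ _ (dot_le _ _)) _ => //.
by rewrite le_eqVlt; apply/orP; left; apply/eqP; ring.
Qed.

Lemma Cintegrable_gauss a z d y : 0 < Re a -> 0 <= Re d ->
  Cintegrable mu (fun s => expC (phase a z d y s)).
Proof.
move=> a0 d0; apply: (Cintegrable_dom (Cmeas_expC (Cmeas_phase _ _ _ _))
  (Rintegrable_gauss 0 (normc z * N%:R * enorm y) a0)) => s.
rewrite normc_expC ler_expR; apply: le_trans (Re_phase_le _ _ _ _ _) _.
by rewrite add0r gerBl mulr_ge0// exprn_ge0// enorm_ge0.
Qed.

Lemma Cintegrable_pow a z d y : 0 <= Re a -> 0 < Re d ->
  Cintegrable mu (fun s => expC (phase a z d y s)).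
Proof.
move=> a0 d0; apply: (Cintegrable_dom (Cmeas_expC (Cmeas_phase _ _ _ _))
  (Rintegrable_pow 0 (normc z * N%:R * enorm y) d0)) => s.
rewrite normc_expC ler_expR; apply: le_trans (Re_phase_le _ _ _ _ _) _.
by rewrite add0r lerD2r gerBl mulr_ge0// sqr_ge0.
Qed.

Lemma phase_scaleT (c : R) a z d y s : 0 < c -> phase a z d y (scaleT c s) =
  phase ((c ^+ 2)%:C * a) (c%:C * z) ((c ^+ (2 * m))%:C * d) y s.
Proof.
move=> c0; rewrite /phase vec_scaleT enormZ dotZl gtr0_norm// !exprMn.
by rewrite !rmorphM/=; ring.
Qed.

Lemma kernelJ_scale (c : R) a z d y : 0 < c -> 0 <= Re a -> 0 < Re d ->
  kernelJ a z d y = (c ^+ N)%:C *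
  kernelJ ((c ^+ 2)%:C * a) (c%:C * z) ((c ^+ (2 * m))%:C * d) y.
Proof.
move=> c0 a0 d0; rewrite /kernelJ (Cint_scaleT c0); last exact: Cintegrable_pow.
by congr (_ * Cint _ _); apply/funext => s; rewrite phase_scaleT.
Qed.

(** The integral after the complex dilation [s -> e ^ tau s] of the variable, with
    its Jacobian [e ^ (N tau)]. Being analytic in [tau] and constant for real [tau],
    it should be constant; the following lemmas prove this without complex analysis. *)
Definition dilated a z d y tau : R[i] :=
  expC (N%:R * tau) *
  kernelJ (a * expC (2 * tau)) (z * expC tau) (d * expC ((2 * m)%:R * tau)) y.

Lemma dilated_real a z d y (t : R) : 0 <= Re a -> 0 < Re d ->
  dilated a z d y t%:C = dilated a z d y 0.
Proof.
have E k : expC (k%:R * t%:C) = (expR t ^+ k)%:C.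
  by rewrite -expCX expC_real rmorphXn.
move=> a0 d0; rewrite /dilated !mulr0 expC0 mul1r !mulr1.
rewrite (_ : expC (2 * t%:C) = (expR t ^+ 2)%:C); last exact: (E 2).
rewrite !E expC_real [in RHS](kernelJ_scale _ _ (expR_gt0 t))//.
by rewrite !(mulrC _%:C).
Qed.

Lemma expC_sub_lin (k : nat) (e : R) (om : R[i]) : 0 <= e <= 1 ->
  normc om = 1 ->
  normc (expC (k%:R * (e%:C * om)) - 1 - k%:R * (e%:C * om)) <=
  e ^+ 2 * expR k%:R.
Proof.
move=> e01 om1; have := expC_taylor 2 (k%:R * om) e01.
rewrite /exp_trunc !big_ord_recl big_ord0 !fact0 /= expr0 expr1 !invr1 !mul1r addr0.
rewrite Normc.normcM om1 mulr1 (_ : normc k%:R = k%:R); last first.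
  by rewrite normc_nat.
by rewrite opprD addrA !(mulrCA _ e%:C).
Qed.

Section SecondOrder.
Variables (a z d : R[i]) (y : 'rV[R]_N).
Hypotheses (a_ge0 : 0 <= Re a) (d_gt0 : 0 < Re d).

(** [L] is the [tau]-derivative at 0 of the exponent of the dilated integrand, [W]
    its increment from 0 to [tau], and [M] majorizes the terms of both up to constants. *)
Let L s : R[i] := N%:R - 2 * a * (r s ^+ 2)%:C + z * (dot (vec s) y)%:C
  - (2 * m)%:R * d * (r s ^+ (2 * m))%:C.

Let M s : R := N%:R + normc a * r s ^+ 2 + normc z * `|dot (vec s) y|
  + normc d * r s ^+ (2 * m).

Let W tau s : R[i] := N%:R * tau
  + (phase (a * expC (2 * tau)) (z * expC tau) (d * expC ((2 * m)%:R * tau)) y s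
     - phase a z d y s).

Let M_ge0 s : 0 <= M s.
Proof. by rewrite !addr_ge0// mulr_ge0 ?normc_ge0 ?exprn_ge0 ?enorm_ge0. Qed.

Let m2 : (2 : R) <= (2 * m)%:R.
Proof. by rewrite ler_nat -[X in (X <= _)%N]muln1 leq_mul2l. Qed.

Let L_le s : normc (L s) <= (2 * m)%:R * M s.
Proof.
have t1 : 0 <= r s ^+ 2 by exact: sqr_ge0.
have t2 : 0 <= r s ^+ (2 * m) by rewrite exprn_ge0// enorm_ge0.
apply: le_trans (normcB _ _) _; apply: le_trans (lerD (normcD _ _) (lexx _)) _.
apply: le_trans (lerD (lerD (normcB _ _) (lexx _)) (lexx _)) _.
rewrite !Normc.normcM !normc_real !normc_nat (ger0_norm t1) (ger0_norm t2).
have h1 := mulr_ge0 (normc_ge0 a) t1.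
have h2 := mulr_ge0 (normc_ge0 z) (normr_ge0 (dot (vec s) y)).
have h3 : 0 <= (N%:R : R) by [].
have m1 : (1 : R) <= (2 * m)%:R by apply: le_trans m2; rewrite ler1n.
have := ler_wpM2r h1 m2; have := ler_wpM2r h2 m1; have := ler_wpM2r h3 m1.
rewrite /M; set c := (2 * m)%:R; lra.
Qed.

Let E : R := expR (2 * m)%:R.

Let W_lin (e : R) (om : R[i]) s : 0 <= e <= 1 -> normc om = 1 ->
  normc (W (e%:C * om) s - (e%:C * om) * L s) <= e ^+ 2 * E * M s.
Proof.
move=> e01 om1; set tau := _ * om.
have t1 : 0 <= r s ^+ 2 by exact: sqr_ge0.
have t2 : 0 <= r s ^+ (2 * m) by rewrite exprn_ge0// enorm_ge0.
pose p k : R[i] := expC (k%:R * tau) - 1 - k%:R * tau.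
have pE k : (k <= 2 * m)%N -> normc (p k) <= e ^+ 2 * E.
  move=> km; apply: le_trans (expC_sub_lin _ e01 om1) _.
  by rewrite ler_wpM2l ?sqr_ge0// ler_expR ler_nat.
have -> : W tau s - tau * L s =
    - (a * p 2 * (r s ^+ 2)%:C) + z * p 1 * (dot (vec s) y)%:C
    - d * p (2 * m)%N * (r s ^+ (2 * m))%:C.
  by rewrite /W /L /phase /p mul1r; ring.
have E0 : 0 <= e ^+ 2 * E by rewrite mulr_ge0 ?sqr_ge0 ?expR_ge0.
apply: le_trans (normcB _ _) _; apply: le_trans (lerD (normcD _ _) (lexx _)) _.
rewrite normcNE !Normc.normcM !normc_real (ger0_norm t1) (ger0_norm t2).
have m2' : (2 <= 2 * m)%N by rewrite -[X in (X <= _)%N]muln1 leq_mul2l.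
have := ler_wpM2l (mulr_ge0 (normc_ge0 a) t1) (pE 2 m2').
have := ler_wpM2l (mulr_ge0 (normc_ge0 z) (normr_ge0 (dot (vec s) y)))
  (pE 1 (ltnW m2')).
have := ler_wpM2l (mulr_ge0 (normc_ge0 d) t2) (pE (2 * m)%N (leqnn _)).
have := mulr_ge0 E0 (ler0n R N).
rewrite /M; set q := e ^+ 2 * E; lra.
Qed.

Let C1 : R := E + (2 * m)%:R.

Let C1_gt0 : 0 < C1.
Proof. by rewrite ltr_pwDl ?expR_gt0. Qed.

Let W_le (e : R) (om : R[i]) s : 0 <= e <= 1 -> normc om = 1 ->
  normc (W (e%:C * om) s) <= e * (C1 * M s).
Proof.
move=> e01 om1; have /andP[e0 e1] := e01.
rewrite -[W _ s](subrK ((e%:C * om) * L s)).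
apply: le_trans (normcD _ _) _.
apply: le_trans (lerD (W_lin s e01 om1) (lexx _)) _.
rewrite !Normc.normcM om1 mulr1 normc_real ger0_norm//.
have := ler_wpM2l e0 (L_le s).
have : e ^+ 2 * E * M s <= e * E * M s.
  by rewrite ler_wpM2r// ler_wpM2r ?expR_ge0// expr2 ler_piMl.
rewrite /C1; lra.
Qed.

Let d0 : R := Num.min 1 (Re d / (2 * C1 * (normc a + normc d + 1))).

Let d0_gt0 : 0 < d0.
Proof.
rewrite lt_min ltr01/= divr_gt0// mulr_gt0//; first by rewrite mulr_gt0.
by rewrite ltr_wpDl// addr_ge0// normc_ge0.
Qed.

Let d0_le1 : d0 <= 1.
Proof. by rewrite ge_min lexx. Qed.

(** The error terms cost a factor [exp (d0 C1 M)], which for small [d0] is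
    absorbed by half of the decay of the integrand. *)
Let maj s : R := expR (d0 * (C1 * M s)) * expR (Re (phase a z d y s)).

Let int_maj : exists2 h : N.-tuple B -> R, Rintegrable mu h & forall s, maj s <= h s.
Proof.
pose A := normc z * N%:R * enorm y.
exists (fun s => expR ((C1 * (N%:R + normc a)) + (C1 * A + A) * r s
   - (Re d / 2) * r s ^+ (2 * m))).
  by apply: Rintegrable_pow; rewrite divr_gt0.
move=> s; rewrite /maj -expRD ler_expR.
have x0 := enorm_ge0 (vec s).
have t2 : 0 <= r s ^+ (2 * m) by rewrite exprn_ge0.
have hM : M s <= (N%:R + normc a) + A * r s + (normc a + normc d) * r s ^+ (2 * m).
  rewrite /M.
  have := ler_wpM2l (normc_ge0 a) (sqr_le_pow x0).
  have := ler_wpM2l (normc_ge0 z) (dot_le (vec s) y).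
  by rewrite /A; lra.
have hM2 := ler_wpM2l (ltW C1_gt0) hM.
have A0 : 0 <= A by rewrite !mulr_ge0// ?normc_ge0 ?enorm_ge0.
have K1 : 0 <= C1 * ((N%:R + normc a) + A * r s).
  apply: mulr_ge0; first exact: ltW.
  by rewrite !addr_ge0// ?normc_ge0// mulr_ge0.
have K2 : d0 * (C1 * (normc a + normc d)) <= Re d / 2.
  have hle : d0 <= Re d / (2 * C1 * (normc a + normc d + 1)).
    by rewrite ge_min lexx orbT.
  have nn : 0 <= normc a + normc d by rewrite addr_ge0// normc_ge0.
  apply: (@le_trans _ _ (d0 * (C1 * (normc a + normc d + 1)))).
    by rewrite ler_wpM2l// ?(ltW d0_gt0)// ler_wpM2l ?(ltW C1_gt0)// lerDl.
  rewrite -ler_pdivlMr; last by rewrite mulr_gt0// ltr_wpDl.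
  apply: le_trans hle _; rewrite le_eqVlt; apply/orP; left; apply/eqP.
  by field; rewrite !lt0r_neq0// ltr_wpDl.
have K3 := ler_wpM2r t2 K2.
have K4 : d0 * (C1 * ((N%:R + normc a) + A * r s)) <= C1 * ((N%:R + normc a) + A * r s).
  by rewrite ler_piMl.
have K5 := Re_phase_le a z d y s.
have K6 : 0 <= Re a * r s ^+ 2 by rewrite mulr_ge0 ?sqr_ge0.
have K7 := ler_wpM2l (ltW d0_gt0) hM2.
rewrite -/A in K5; lra.
Qed.

Let F tau s := expC (N%:R * tau + phase (a * expC (2 * tau)) (z * expC tau)
   (d * expC ((2 * m)%:R * tau)) y s).

Let FE tau s : F tau s = expC (W tau s) * expC (phase a z d y s).
Proof. by rewrite -expCD /F /W; congr expC; ring. Qed.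

Let F0 s : F 0 s = expC (phase a z d y s).
Proof. by rewrite /F !mulr0 !expC0 !mulr1 add0r. Qed.

Let F_taylor (e : R) (om : R[i]) s : 0 < e -> e <= d0 -> normc om = 1 ->
  normc (F (e%:C * om) s - F 0 s - (e%:C * om) * (L s * F 0 s)) <=
  e ^+ 2 * ((2 / d0 ^+ 2) * maj s).
Proof.
move=> e0 ed om1; set tau := _ * om.
have e1 : e <= 1 := le_trans ed d0_le1.
have e01 : 0 <= e <= 1 by rewrite ltW.
have -> : F tau s - F 0 s - tau * (L s * F 0 s) =
   ((expC (W tau s) - 1 - W tau s) + (W tau s - tau * L s))
    * expC (phase a z d y s).
  by rewrite FE F0; ring.
rewrite Normc.normcM normc_expC /maj.
rewrite [leRHS](_ : _ = (2 * ((e / d0) ^+ 2 * expR (d0 * (C1 * M s))))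
   * expR (Re (phase a z d y s))); last first.
  by rewrite expr_div_n; ring.
rewrite ler_wpM2r ?expR_ge0//; apply: le_trans (normcD _ _) _.
rewrite mulr2n mulrDl mul1r lerD//.
  have q01 : 0 <= e / d0 <= 1.
    by apply/andP; split; [rewrite divr_ge0// ltW|rewrite ler_pdivrMr// mul1r].
  (* Expanding from the scale [d0], where [|W|] is at most [d0 C1 M], costs only the
     factor [exp (d0 C1 M)], which the majorant can afford. *)
  have := expC_taylor 2 ((d0 / e)%:C * W tau s) q01.
  rewrite mulrA -rmorphM/= (_ : e / d0 * (d0 / e) = 1); last first.
    by field; rewrite !lt0r_neq0.
  rewrite mul1r /exp_trunc !big_ord_recl big_ord0 !fact0 /= expr0 expr1 !invr1 !mul1r.
  rewrite addr0 opprD addrA => h; apply: le_trans h _.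
  rewrite ler_wpM2l ?sqr_ge0// ler_expR Normc.normcM normc_real ger0_norm; last first.
    by rewrite divr_ge0 ?ltW.
  have := W_le s e01 om1; rewrite -/tau => h.
  apply: le_trans (ler_wpM2l _ h) _; first by rewrite divr_ge0 ?ltW.
  by rewrite [leLHS]mulrA divfK ?lt0r_neq0.
apply: le_trans (W_lin s e01 om1) _.
rewrite -[leLHS]mulrA expr_div_n -[leRHS]mulrA ler_wpM2l ?sqr_ge0//.
rewrite ler_pdivlMl ?exprn_gt0//.
apply: le_trans (le_expR _).
apply: (@le_trans _ _ (d0 * (E * M s))).
  rewrite ler_wpM2r//; first by rewrite mulr_ge0 ?expR_ge0.
  by rewrite expr2 ler_piMl// ltW.
by rewrite ler_wpM2l ?(ltW d0_gt0)// ler_wpM2r// /C1 lerDl.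
Qed.

(** The second-order expansion has the same linear coefficient [K1] in all complex
    directions. Along the reals the integral is constant, so [K1 = 0], and the
    increments are quadratically small in every direction. *)
Lemma dilated_quadratic : exists C e0 : R, [/\ 0 <= C, 0 < e0 &
  forall (e : R) om, 0 <= e -> e <= e0 -> normc om = 1 ->
  normc (dilated a z d y (e%:C * om) - dilated a z d y 0) <= C * e ^+ 2].
Proof.
have [h ih hmaj] := int_maj.
have h0 s : 0 <= h s.
  by apply: le_trans (hmaj s); rewrite mulr_ge0// expR_ge0.
have mphase := Cmeas_phase.
have mF tau : Cmeas (F tau).
  by apply/Cmeas_expC/CmeasD => //; exact: Cmeas_cst.
have mr k : measurable_fun setT (fun s => r s ^+ k).
  exact: (measurable_vec_fun (g := fun x => x ^+ k)).
have mL : Cmeas L.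
  apply: CmeasD; first apply: CmeasD; first apply: CmeasD.
  - exact: Cmeas_cst.
  - by apply: CmeasN; apply: CmeasM; [exact: Cmeas_cst|exact: Cmeas_real].
  - apply: CmeasM; [exact: Cmeas_cst|apply: Cmeas_real].
    by apply: measurable_dot; [exact: vmeas_vec|exact: vmeas_cst].
  - by apply: CmeasN; apply: CmeasM; [exact: Cmeas_cst|exact: Cmeas_real].
have iF0 : Cintegrable mu (F 0).
  by rewrite (funext F0); exact: Cintegrable_pow.
have iLF : Cintegrable mu (fun s => L s * F 0 s).
  apply: (@Cintegrable_dom _ _ _ _ _ (fun s => ((2 * m)%:R / (d0 * C1)) * h s)).
  - exact: CmeasM.
  - exact: RintegrableZ.
  move=> s; rewrite Normc.normcM F0 normc_expC.
  apply: (@le_trans _ _ ((2 * m)%:R / (d0 * C1) * maj s)); last first.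
    by rewrite ler_wpM2l// divr_ge0// mulr_ge0 ?ltW.
  rewrite /maj [leRHS]mulrA ler_wpM2r ?expR_ge0//; apply: le_trans (L_le s) _.
  rewrite -mulrA ler_wpM2l// ler_pdivlMl; last by rewrite mulr_gt0.
  by rewrite -mulrA le_expR.
pose c2 : R := 2 / d0 ^+ 2.
have c20 : 0 <= c2 by rewrite divr_ge0// exprn_ge0// ltW.
have iF tau (e : R) om : tau = e%:C * om -> 0 < e -> e <= d0 -> normc om = 1 ->
    Cintegrable mu (F tau).
  move=> -> e0 ed om1.
  apply: (@Cintegrable_dom _ _ _ _ _ (fun s => normc (F 0 s) +
     (e * normc (L s * F 0 s) + e ^+ 2 * (c2 * h s)))).
  - exact: mF.
  - apply: RintegrableD; first exact: Cintegrable_normc.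
    apply: RintegrableD; first by apply: RintegrableZ; exact: Cintegrable_normc.
    by do 2 apply: RintegrableZ.
  - move=> s; set tau' := e%:C * om.
    rewrite (_ : F tau' s = F 0 s + (tau' * (L s * F 0 s) +
      (F tau' s - F 0 s - tau' * (L s * F 0 s)))); last by ring.
    apply: le_trans (normcD _ _) _; rewrite lerD2l.
    apply: le_trans (normcD _ _) _; apply: lerD.
      by rewrite Normc.normcM /tau' Normc.normcM om1 mulr1 normc_real gtr0_norm.
    apply: le_trans (F_taylor s e0 ed om1) _.
    by rewrite ler_wpM2l ?sqr_ge0// ler_wpM2l.
have dE tau : dilated a z d y tau = expC (N%:R * tau) * Cint mu (fun s =>
    expC (phase (a * expC (2 * tau)) (z * expC tau) (d * expC ((2 * m)%:R * tau)) y s)).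
  by [].
have Re_expn (k : nat) tau : Cintegrable mu (F tau) ->
    dilated a z d y tau = Cint mu (F tau).
  move=> iFt; rewrite dE -CintZ.
    by congr Cint; apply/funext => s; rewrite -expCD.
  rewrite (_ : (fun s => _) = (fun s => expC (- (N%:R * tau)) * F tau s)).
    exact: CintegrableZ.
  by apply/funext => s; rewrite -expCD addrA addNr add0r.
pose I0 := Cint mu (F 0); pose K1 := Cint mu (fun s => L s * F 0 s).
pose C2 := c2 * \int[mu]_s h s.
have C20 : 0 <= C2 by rewrite mulr_ge0// Rintegral_ge0.
have quad (e : R) om : 0 < e -> e <= d0 -> normc om = 1 ->
    normc (dilated a z d y (e%:C * om) - dilated a z d y 0 - (e%:C * om) * K1)
    <= C2 * e ^+ 2.
  move=> e0 ed om1; have iFe := iF _ e om erefl e0 ed om1.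
  rewrite !(Re_expn 0)// -CintZ// -!CintB//; last 2 first.
  - by apply: CintegrableD => //; exact: CintegrableN.
  - exact: CintegrableZ.
  have ih2 : Rintegrable mu (fun s => e ^+ 2 * (c2 * h s)).
    by do 2 apply: RintegrableZ.
  apply: le_trans (normc_Cint _ ih2 _) _.
  - apply: CintegrableD; first by apply: CintegrableD => //; exact: CintegrableN.
    by apply: CintegrableN; exact: CintegrableZ.
  - move=> s; apply: le_trans (F_taylor s e0 ed om1) _.
    by rewrite ler_wpM2l ?sqr_ge0// ler_wpM2l.
  rewrite RintegralZl//; last exact: RintegrableZ.
  by rewrite RintegralZl// mulrC.
have K10 : K1 = 0.
  apply: Normc.eq0_normc; apply/eqP; rewrite eq_le normc_ge0 andbT.
  apply/ler_addgt0Pl => e egt0; rewrite addr0.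
  pose x := Num.min d0 (e / (C2 + 1)).
  have x0 : 0 < x by rewrite lt_min d0_gt0 divr_gt0// ltr_wpDl.
  have xd : x <= d0 by rewrite ge_min lexx.
  have n1 : normc (1 : R[i]) = 1 by exact: Normc.normc1.
  have := quad x 1 x0 xd n1.
  rewrite mulr1 dilated_real// subrr sub0r normcNE Normc.normcM normc_real gtr0_norm//.
  rewrite expr2 mulrCA ler_pM2l// => hh; apply: le_trans hh _.
  have : x <= e / (C2 + 1) by rewrite ge_min lexx orbT.
  rewrite ler_pdivlMr ?ltr_wpDl// => hx; apply: le_trans hx.
  by rewrite mulrC ler_pM2l// lerDl.
exists C2, d0; split => // e om; rewrite le_eqVlt => /orP[/eqP <- _ _|e0 ed om1].
  by rewrite mul0r subrr Normc.normc0 expr2 mul0r mulr0.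
by have := quad e om e0 ed om1; rewrite K10 mulr0 subr0.
Qed.

End SecondOrder.

End Rotation.

Lemma is_derive0_of_quadratic (R : realType) (f : R -> R) (x C e0 : R) :
  0 < e0 -> 0 <= C -> (forall h, `|h| <= e0 -> `|f (x + h) - f x| <= C * h ^+ 2) ->
  is_derive x 1 f 0.
Proof.
move=> e0gt0 C0 H.
have cv : h^-1 *: ((f \o shift x) (h *: (1 : R)) - f x) @[h --> 0^'] --> (0 : R).
  apply/cvgr0Pnorm_lt => e egt0; near=> h.
  have h0 : h != 0 by near: h; exact: nbhs_dnbhs_neq.
  have hn : 0 < `|h| by rewrite normr_gt0.
  have he : `|h| < Num.min e0 (e / (C + 1)).
    near: h; apply: dnbhs0_lt.
    by rewrite lt_min e0gt0 divr_gt0// ltr_wpDl.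
  rewrite /= normrM normrV ?unitfE// ltr_pdivrMl//.
  move: he; rewrite lt_min => /andP[he1]; rewrite ltr_pdivlMr ?ltr_wpDl// => he2.
  rewrite [X in f (X + x)](_ : _ = h); last exact: mulr1.
  rewrite [h + x]addrC; apply: le_lt_trans (H h (ltW he1)) _.
  rewrite -real_normK ?num_real// expr2 mulrCA ltr_pM2l//.
  by apply: le_lt_trans he2; rewrite mulrC ler_pM2l// lerDl.
apply: DeriveDef; first by apply/cvg_ex; exists 0.
exact: cvg_lim cv.
Unshelve. all: by end_near.
Qed.

(** Quadratically small increments force the derivative to vanish; integrals with
    such increments need not be differentiated under the integral sign. *)
Lemma constant_of_quadratic (R : realType) (f : R -> R) (a b : R) :
  (forall x, a < x < b -> exists C e0 : R, [/\ 0 <= C, 0 < e0 &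
     forall h, `|h| <= e0 -> `|f (x + h) - f x| <= C * h ^+ 2]) ->
  forall x y, a < x -> x <= y -> y < b -> f x = f y.
Proof.
move=> H x y ax xy yb.
have D z : z \in `[x, y]%R -> is_derive z 1 f 0.
  rewrite in_itv/= => /andP[xz zy].
  have [|C [e0 [C0 e00 h]]] := H z.
    by rewrite (lt_le_trans ax xz) (le_lt_trans zy yb).
  exact: is_derive0_of_quadratic e00 C0 h.
have H1 z : z \in `]x, y[%R -> is_derive z 1 f ((fun=> 0 : R) z).
  by rewrite in_itv/= => /andP[/ltW h1 /ltW h2]; apply: D; rewrite in_itv/= h1.
have H2 : {within `[x, y], continuous f}.
  by apply: derivable_within_continuous => z zI; have := D z zI => -[].
have [c _] := MVT_segment xy H1 H2.
by rewrite mul0r => /eqP; rewrite subr_eq0 => /eqP ->.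
Qed.

Section KernelFormula.
Variables (R : realType) (N m : nat).
Hypothesis m_gt0 : (0 < m)%N.
Local Notation B := (measurableTypeR R).
Local Notation mu := (lebesgueN R N).
Implicit Types (s : N.-tuple B) (y : 'rV[R]_N) (a z d tau : R[i]) (th e : R).
Local Notation r := (fun s => enorm (vec s)).

Lemma dilatedD a z d y t1 t2 : @dilated R N m a z d y (t1 + t2) =
  expC (N%:R * t1) * dilated m (a * expC (2 * t1)) (z * expC t1)
    (d * expC ((2 * m)%:R * t1)) y t2.
Proof. by rewrite /dilated !mulrDr !expCD !mulrA. Qed.

(** The logarithm of the rotation by the angle [- th]. *)
Definition turn th : R[i] := th%:C * - 'i%C.

Lemma turnD th th' : turn (th + th') = turn th + turn th'.
Proof. by rewrite /turn rmorphD mulrDl. Qed.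

Lemma expC_turn (k : nat) th :
  expC (k%:R * turn th) = cos (k%:R * th) -i* sin (k%:R * th).
Proof.
have -> : k%:R * turn th = 0 +i* - (k%:R * th).
  rewrite /turn -(rmorph_nat (real_complex R)) mulrA -rmorphM.
  by apply: ReImP; rewrite ?Re_realM ?Im_realM/= ?oppr0 ?mulr0 ?mulrN1.
by rewrite /expC/= expR0 mul1r cosN sinN.
Qed.

Lemma expC_turn1 th : expC (turn th) = cos th -i* sin th.
Proof. by have := expC_turn 1 th; rewrite !mul1r. Qed.

Lemma normc_expC_turn (k : nat) th : normc (expC (k%:R * turn th)) = 1.
Proof. by rewrite expC_turn /= sqrrN cos2Dsin2 sqrtr1. Qed.

Lemma normc_expC_turn1 th : normc (expC (turn th)) = 1.
Proof. by rewrite expC_turn1 /= sqrrN cos2Dsin2 sqrtr1. Qed.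

(** Angles for which the rotated Gaussian cut-off does not grow and the rotated
    factor [exp (- i |w| ^ 2m)] decays. *)
Definition admissible th := 0 < th < pi / (4 * m)%:R.

Lemma admissible_bounds th : admissible th ->
  [/\ 0 < th, (2 * m)%:R * th < pi & 2 * th <= pi / 2].
Proof.
move=> /andP[th0]; rewrite ltr_pdivlMr; last by rewrite ltr0n muln_gt0.
have m1 : (1 : R) <= m%:R by rewrite ler1n.
have pi0 : 0 < pi :> R := pi_gt0 R.
rewrite !natrM => h.
have : 0 <= th * (m%:R - 1) by rewrite mulr_ge0 ?subr_ge0// ltW.
by move=> h2; split => //; lra.
Qed.

Lemma Re_turn_gt0 th : admissible th ->
  0 < Re ('i%C * expC ((2 * m)%:R * turn th)).
Proof.
case/admissible_bounds => th0 h _; rewrite expC_turn ReM/= mul0r mul1r sub0r opprK.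
by apply: sin_gt0_pi; rewrite h mulr_gt0// ltr0n muln_gt0.
Qed.

Lemma Re_turn2_ge0 e th : 0 <= e -> admissible th ->
  0 <= Re (e%:C * expC (2 * turn th)).
Proof.
move=> e0 /admissible_bounds[th0 _ h]; rewrite Re_realM (expC_turn 2)/= mulr_ge0//.
apply: cos_ge0_pihalf; rewrite h andbT.
have pi0 : 0 < pi :> R := pi_gt0 R.
by move: pi0 th0 h; lra.
Qed.

(** The regularized kernel, computed over the rotated space [exp (- i th) R^N]. *)
Definition rotated e y th := @dilated R N m e%:C 'i%C 'i%C y (turn th).

(** Dilations compose, so the increments at the angle [th] are those at 0 of the
    integral with rotated coefficients. *)
Lemma rotated_quadratic e y th : 0 <= e -> admissible th ->
  exists C e0 : R, [/\ 0 <= C, 0 < e0 & forall h, `|h| <= e0 ->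
    normc (rotated e y (th + h) - rotated e y th) <= C * h ^+ 2].
Proof.
move=> e0 ath.
have [C [e1 [C0 e10 H]]] := dilated_quadratic m_gt0 ('i%C * expC (turn th)) y
  (Re_turn2_ge0 e0 ath) (Re_turn_gt0 ath).
have n1 : normc (- 'i%C : R[i]) = 1 by rewrite /= oppr0 sqrrN expr0n expr1n add0r sqrtr1.
have n2 : normc ('i%C : R[i]) = 1 by rewrite /= expr0n expr1n add0r sqrtr1.
exists C, e1; split => // h he.
rewrite /rotated turnD dilatedD.
have := dilatedD e%:C 'i%C 'i%C y (turn th) 0; rewrite addr0 => ->; rewrite -mulrBr.
rewrite Normc.normcM normc_expC_turn mul1r -real_normK ?num_real//.
have [h0|h0] := leP 0 h.
  rewrite [`|h|]ger0_norm// in he *; exact: H.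
rewrite [`|h|]ltr0_norm// in he *; rewrite /turn.
rewrite (_ : h%:C * - 'i%C = (- h)%:C * 'i%C); last by rewrite rmorphN mulNr mulrN.
by apply: H; rewrite // oppr_ge0 ltW.
Qed.

Lemma rotated_const e y th1 th2 : 0 <= e -> admissible th1 -> admissible th2 ->
  th1 <= th2 -> rotated e y th1 = rotated e y th2.
Proof.
move=> e0 /andP[a1 b1] /andP[a2 b2] h12.
have key (P : R[i] -> R) : (forall z w, P (z - w) = P z - P w) ->
    (forall z, `|P z| <= normc z) -> P (rotated e y th1) = P (rotated e y th2).
  move=> PB Pn.
  apply: (@constant_of_quadratic R (fun th => P (rotated e y th)) 0 (pi / (4 * m)%:R)) => //.
  move=> x ax; have [C [e1 [C0 e10 H]]] := rotated_quadratic y e0 ax.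
  exists C, e1; split => // h he; rewrite -PB.
  exact: le_trans (Pn _) (H h he).
apply: ReImP; apply: key.
- by move=> z w; rewrite ReD ReN.
- exact: normc_Re.
- by move=> z w; rewrite ImD ImN.
- exact: normc_Im.
Qed.

Lemma normc_expC_turnB1 (k : nat) th : 0 <= th ->
  normc (expC (k%:R * turn th) - 1) <= k%:R * th.
Proof.
move=> th0.
have E : k%:R * turn th = (k%:R * th)%:C * - 'i%C.
  by rewrite /turn rmorphM/= rmorph_nat mulrA.
apply: le_trans (normc_expC_sub1 _) _.
  by rewrite E Re_realM/= oppr0 mulr0.
rewrite E Normc.normcM normc_real ger0_norm ?mulr_ge0//.
by rewrite /= oppr0 sqrrN expr0n expr1n add0r sqrtr1 mulr1.
Qed.

(** At the angle 0 the factor [exp (- i |w| ^ 2m)] no longer decays, and only the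
    Gaussian cut-off makes the rotated integral continuous. *)
Lemma rotated_lipschitz0 e y : 0 < e -> exists C : R, 0 <= C /\
  forall th, 0 < th -> th <= 4^-1 -> admissible th ->
  normc (rotated e y th - rotated e y 0) <= C * th.
Proof.
move=> e0; set A := N%:R * enorm y.
have A0 : 0 <= A by rewrite mulr_ge0// enorm_ge0.
pose K := N%:R + 2 * e * 2 ^+ 2 + A + (2 * m)%:R * ((2 * m)%:R ^+ (2 * m)) : R.
have K0 : 0 <= K.
  by rewrite /K !addr_ge0// !mulr_ge0// ?exprn_ge0// ltW.
pose h s := K * expR (0 + (1 + A) * r s - (e / 2) * r s ^+ 2).
have e20 : 0 < e / 2 by rewrite divr_gt0.
have ih : Rintegrable mu h by apply: RintegrableZ; exact: Rintegrable_gauss.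
exists (\int[mu]_s h s); split.
  by apply: Rintegral_ge0 => s _; rewrite mulr_ge0 ?expR_ge0.
move=> th th0 th4 ath; have thn := ltW th0.
have [_ hpi _] := admissible_bounds ath.
pose tau := turn th.
pose f1 s := N%:R * tau + phase m (e%:C * expC (2 * tau)) ('i%C * expC tau)
   ('i%C * expC ((2 * m)%:R * tau)) y s.
pose f0 s := phase m e%:C 'i%C 'i%C y s.
have cos2 : e / 2 <= Re (e%:C * expC (2 * tau)).
  rewrite Re_realM ler_wpM2l ?(ltW e0)//.
  have := le_trans (normc_Re _) (normc_expC_turnB1 2 thn).
  rewrite ReD ReN /= -/tau ler_norml => /andP[hh _].
  by move: hh th4; lra.
have sin0 := Re_turn_gt0 ath.
have nI : normc ('i%C : R[i]) = 1 by rewrite /= expr0n expr1n add0r sqrtr1.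
have i1 : Cintegrable mu (fun s => expC (phase m (e%:C * expC (2 * tau))
   ('i%C * expC tau) ('i%C * expC ((2 * m)%:R * tau)) y s)).
  by apply: Cintegrable_gauss; [exact: lt_le_trans cos2|exact: ltW].
have i0 : Cintegrable mu (fun s => expC (f0 s)).
  by apply: Cintegrable_gauss.
have ReN0 : Re (N%:R * tau) = 0.
  by rewrite -(rmorph_nat (real_complex R)) Re_realM Re_realM/= oppr0 !mulr0.
have i1' : Cintegrable mu (fun s => expC (f1 s)).
  rewrite (_ : (fun s => _) = (fun s => expC (N%:R * tau) *
    expC (phase m (e%:C * expC (2 * tau))
      ('i%C * expC tau) ('i%C * expC ((2 * m)%:R * tau)) y s))).
    exact: CintegrableZ.
  by apply/funext => s; rewrite -expCD.
have -> : rotated e y th - rotated e y 0 = Cint mu (fun s => expC (f1 s) - expC (f0 s)).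
  rewrite CintB// /rotated {2}/turn mul0r /dilated !mulr0 expC0 !mulr1 mul1r.
  congr (_ - _); rewrite /kernelJ -CintZ//.
  by congr Cint; apply/funext => s; rewrite -expCD.
rewrite mulrC -RintegralZl//; apply: normc_Cint.
- by apply: CintegrableD => //; exact: CintegrableN.
- exact: RintegrableZ.
move=> s.
have r0 := enorm_ge0 (vec s).
have t1 : 0 <= r s ^+ 2 by exact: sqr_ge0.
have t2 : 0 <= r s ^+ (2 * m) by rewrite exprn_ge0.
have hmax : Num.max (expR (Re (f1 s))) (expR (Re (f0 s))) <=
    expR (0 + A * r s - (e / 2) * r s ^+ 2).
  rewrite ge_max !ler_expR /f1 ReD ReN0 !add0r; apply/andP; split.
    apply: le_trans (Re_phase_le _ _ _ _ _ _) _.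
    rewrite Normc.normcM nI normc_expC_turn1 !mul1r -/A.
    have h1 := ler_wpM2r t1 cos2; have h2 := mulr_ge0 (ltW sin0) t2.
    by rewrite /tau in h1 h2 *; lra.
  apply: le_trans (Re_phase_le _ _ _ _ _ _) _.
  rewrite nI /= !mul1r -/A mul0r.
  by have := mulr_ge0 (ltW e0) t1; lra.
apply: le_trans (normc_expCB _ _) _.
have hdiff : normc (f1 s - f0 s) <= th * (K * expR (r s)).
  rewrite /f1 /f0.
  have -> : N%:R * tau + phase m (e%:C * expC (2 * tau)) ('i%C * expC tau)
      ('i%C * expC ((2 * m)%:R * tau)) y s - phase m e%:C 'i%C 'i%C y s =
    N%:R * tau - e%:C * (expC (2 * tau) - 1) * (r s ^+ 2)%:C
    + 'i%C * (expC (1%:R * tau) - 1) * (dot (vec s) y)%:C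
    - 'i%C * (expC ((2 * m)%:R * tau) - 1) * (r s ^+ (2 * m))%:C.
    rewrite /phase (mul1r tau).
    ring.
  apply: le_trans (normcB _ _) _; apply: le_trans (lerD (normcD _ _) (lexx _)) _.
  apply: le_trans (lerD (lerD (normcB _ _) (lexx _)) (lexx _)) _.
  rewrite !Normc.normcM !normc_real nI !mul1r (ger0_norm t1) (ger0_norm t2) gtr0_norm//.
  rewrite (ger0_norm (ltW e0)).
  have nN : normc (N%:R : R[i]) = N%:R.
    by rewrite normc_nat.
  have nmi : normc (- 'i%C : R[i]) = 1.
    by rewrite /= oppr0 sqrrN expr0n expr1n add0r sqrtr1.
  rewrite nN nmi mulr1.
  have b2 := normc_expC_turnB1 2 thn; have b1 := normc_expC_turnB1 1 thn.
  have bm := normc_expC_turnB1 (2 * m) thn.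
  rewrite -/tau in b1 b2 bm; rewrite !mul1r in b1.
  have c2 := ler_wpM2r t1 (ler_wpM2l (ltW e0) b2).
  have cm := ler_wpM2r t2 bm.
  have c1 := ler_pM (normc_ge0 _) (normr_ge0 _) b1 (dot_le (vec s) y).
  have p2 : r s ^+ 2 <= 2 ^+ 2 * expR (r s) := pow_le_expR 2 r0.
  have pm : r s ^+ (2 * m) <= (2 * m)%:R ^+ (2 * m) * expR (r s) := pow_le_expR (2 * m) r0.
  have p1 := le_expR (r s).
  have p0 : 1 <= expR (r s) by rewrite -expR0 ler_expR.
  have q2 : 2 * e * (r s ^+ 2) <= 2 * e * (2 ^+ 2 * expR (r s)).
    by apply: ler_wpM2l => //; rewrite mulr_ge0// ltW.
  have qm := ler_wpM2l (ler0n R (2 * m)) pm.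
  have q1 := ler_wpM2l A0 p1.
  have q0 := ler_wpM2l (ler0n R N) p0.
  have tot := ler_wpM2l thn (lerD (lerD (lerD q0 q2) q1) qm).
  apply: le_trans _ (le_trans tot _).
    by rewrite /A; set b := (2 * m)%:R; lra.
  by rewrite /K; set b := (2 * m)%:R; rewrite le_eqVlt; apply/orP; left; apply/eqP; ring.
apply: le_trans (ler_pM (normc_ge0 _) _ hdiff hmax) _.
  by rewrite le_max expR_ge0.
rewrite -[leLHS]mulrA ler_wpM2l// /h -[leLHS]mulrA ler_wpM2l// -expRD ler_expR; lra.
Qed.

Lemma rotated_const0 e y th : 0 < e -> admissible th ->
  rotated e y 0 = rotated e y th.
Proof.
move=> e0 ath; have [C [C0 H]] := rotated_lipschitz0 y e0.
apply/eqP; rewrite eq_sym -subr_eq0; apply/eqP; apply: Normc.eq0_normc.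
apply/eqP; rewrite eq_le normc_ge0 andbT.
apply/ler_addgt0Pl => eps eps0; rewrite addr0.
have [th0 thpi] := andP ath.
pose t := Num.min th (Num.min 4^-1 (eps / (C + 1))).
have t0 : 0 < t.
  by rewrite !lt_min th0 invr_gt0 ltr0n divr_gt0// ltr_wpDl.
have tth : t <= th by rewrite ge_min lexx.
have t4 : t <= 4^-1 by rewrite !ge_min lexx orbT.
have at_ : admissible t by rewrite /admissible t0 (le_lt_trans tth).
rewrite -(rotated_const y (ltW e0) at_ ath tth).
apply: le_trans (H t t0 t4 at_) _.
have : t <= eps / (C + 1) by rewrite !ge_min lexx !orbT.
rewrite ler_pdivlMr ?ltr_wpDl// => hx; apply: le_trans hx.
by rewrite mulrC ler_pM2l// lerDl.
Qed.

Lemma kernelJ_lipschitz a z d y : 0 <= Re a -> 0 < Re d -> exists C : R, 0 <= C /\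
  forall e, 0 <= e -> normc (kernelJ m (e%:C * a) z d y - kernelJ m 0 z d y) <= C * e.
Proof.
move=> a0 d0; set A := normc z * N%:R * enorm y.
pose h s := normc a * 2 ^+ 2 * expR (0 + (1 + A) * r s - Re d * r s ^+ (2 * m)).
have ih : Rintegrable mu h by apply: RintegrableZ; exact: Rintegrable_pow.
exists (\int[mu]_s h s); split.
  by apply: Rintegral_ge0 => s _; rewrite !mulr_ge0 ?expR_ge0 ?exprn_ge0 ?normc_ge0.
move=> e e0; rewrite [leRHS]mulrC -RintegralZl//.
have rea : 0 <= Re (e%:C * a) by rewrite Re_realM mulr_ge0.
rewrite /kernelJ -CintB; last 2 first.
- exact: Cintegrable_pow.
- exact: Cintegrable_pow.
apply: normc_Cint.
- apply: CintegrableD; first exact: Cintegrable_pow.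
  by apply: CintegrableN; exact: Cintegrable_pow.
- exact: RintegrableZ.
move=> s.
have t1 : 0 <= r s ^+ 2 by exact: sqr_ge0.
have -> : expC (phase m (e%:C * a) z d y s) - expC (phase m 0 z d y s) =
   (expC (- (e%:C * a * (r s ^+ 2)%:C)) - 1) * expC (phase m 0 z d y s).
  by rewrite mulrBl mul1r -expCD; congr (expC _ - _); rewrite /phase; ring.
rewrite Normc.normcM normc_expC.
apply: (@le_trans _ _ ((e * (normc a * (2 ^+ 2 * expR (r s)))) *
   expR (A * r s - Re d * r s ^+ (2 * m)))).
  apply: ler_pM; rewrite ?normc_ge0 ?expR_ge0//.
    apply: le_trans (normc_expC_sub1 _) _.
      by rewrite ReN Re_Mreal oppr_le0 mulr_ge0.
    rewrite normcNE !Normc.normcM !normc_real !ger0_norm// -mulrA.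
    apply: ler_wpM2l => //; apply: ler_wpM2l; first exact: normc_ge0.
    exact: (pow_le_expR 2 (enorm_ge0 _)).
  rewrite ler_expR; apply: le_trans (Re_phase_le _ _ _ _ _ _) _.
  by rewrite /= mul0r subr0.
rewrite /h le_eqVlt; apply/orP; left; apply/eqP.
rewrite (_ : 0 + (1 + A) * r s - Re d * r s ^+ (2 * m) =
  r s + (A * r s - Re d * r s ^+ (2 * m))); last by ring.
by rewrite expRD; ring.
Qed.

Lemma lim_right0 (f : R -> R) (l C : R) : 0 <= C ->
  (forall e, 0 < e -> `|f e - l| <= C * e) -> lim (f e @[e --> 0^'+]) = l.
Proof.
move=> C0 H; apply: cvg_lim => //; apply/cvgrPdist_le => eps eps0.
near=> e.
have e0 : 0 < e by near: e; exact: nbhs_right_gt.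
rewrite distrC; apply: le_trans (H e e0) _.
have : e <= eps / (C + 1).
  by near: e; apply: nbhs_right_le; rewrite divr_gt0// ltr_wpDl.
rewrite ler_pdivlMr ?ltr_wpDl// => hx; apply: le_trans hx.
by rewrite mulrC ler_pM2l// lerDl.
Unshelve. all: by end_near.
Qed.

(** For each cut-off the integrals at the angles 0 and [th] agree. At the angle
    [th] there is decay uniformly in the cut-off, so that the limit defining the
    oscillatory integral can be taken under the integral sign. *)
Lemma kernelF_rotated y th : admissible th ->
  kernelF m y = ((2 * pi) ^- N)%:C * (expC (N%:R * turn th) *
    kernelJ m 0 ('i%C * expC (turn th)) ('i%C * expC ((2 * m)%:R * turn th)) y).
Proof.
move=> ath; rewrite /kernelF; congr (_ * _).
set L := expC _ * _.
have [C [C0 H]] := @kernelJ_lipschitz (expC (2 * turn th)) ('i%C * expC (turn th))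
  ('i%C * expC ((2 * m)%:R * turn th)) y
  ltac:(by have := Re_turn2_ge0 ler01 ath; rewrite rmorph1 mul1r) (Re_turn_gt0 ath).
pose I e := integralC (fun w : 'rV[R]_N => (expR (- (e * enorm w ^+ 2)))%:C *
  expC ('i * (dot w y)%:C - 'i * (enorm w ^+ (2 * m))%:C)).
have key e : 0 < e -> normc (I e - L) <= C * e.
  move=> e0; rewrite (_ : I e = rotated e y 0); last first.
    rewrite /rotated /turn mul0r /dilated !mulr0 expC0 mul1r !mulr1.
    rewrite /kernelJ; congr Cint; apply/funext => s.
    rewrite -expC_real -expCD /phase; congr expC.
    rewrite (_ : (- (e * r s ^+ 2))%:C = - (e%:C * (r s ^+ 2)%:C)).
      by rewrite addrA.
    by rewrite rmorphN rmorphM.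
  rewrite (rotated_const0 y e0 ath) /rotated /dilated /L -mulrBr.
  by rewrite Normc.normcM normc_expC_turn mul1r H// ltW.
have E1 : lim (Re (I e) @[e --> 0^'+]) = Re L.
  apply: (lim_right0 C0) => e e0.
  by rewrite -ReN -ReD; exact: le_trans (normc_Re _) (key e e0).
have E2 : lim (Im (I e) @[e --> 0^'+]) = Im L.
  apply: (lim_right0 C0) => e e0.
  by rewrite -ImN -ImD; exact: le_trans (normc_Im _) (key e e0).
rewrite (_ : oscillatory_integral _ =
  (lim (Re (I e) @[e --> 0^'+])) +i* (lim (Im (I e) @[e --> 0^'+])))//.
by rewrite E1 E2; case: (L).
Qed.

(** The self-similarity of the kernel is the real dilation by [t ^ (1 / 2m)]. *)
Lemma kernelF_scaled (t : R) (x : 'rV[R]_N) th : 0 < t -> admissible th ->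
  (t `^ (- (N%:R / (2 * m)%:R)))%:C * kernelF m (t `^ (- (2 * m)%:R^-1) *: x) =
  ((2 * pi) ^- N)%:C * (expC (N%:R * turn th) *
    kernelJ m 0 ('i%C * expC (turn th)) (t%:C * ('i%C * expC ((2 * m)%:R * turn th))) x).
Proof.
move=> t0 ath; rewrite (kernelF_rotated _ ath) mulrCA; congr (_ * _).
rewrite mulrCA; congr (_ * _).
set z := 'i%C * _; set d := 'i%C * _.
set c := t `^ (2 * m)%:R^-1.
have c0 : 0 < c by exact: powR_gt0.
have m0 : (2 * m)%:R != 0 :> R by rewrite pnatr_eq0 muln_eq0/= -lt0n.
have cm : c ^+ (2 * m) = t.
  by rewrite -powR_mulrn ?ltW// /c -powRrM mulVf// powRr1// ltW.
have cN : t `^ (- (N%:R / (2 * m)%:R)) = (c ^+ N)^-1.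
  by rewrite powRN -powR_mulrn ?ltW// /c -powRrM mulrC.
have re0 : 0 <= Re (0 : R[i]) by [].
rewrite cN powRN -/c (kernelJ_scale m_gt0 _ _ c0 re0 (Re_turn_gt0 ath)).
rewrite [LHS]mulrA -rmorphM/=.
rewrite mulVf ?expf_neq0 ?lt0r_neq0// mul1r mulr0 cm.
congr Cint; apply/funext => s; congr expC; rewrite /phase dotZr.
congr (_ + _ - _); rewrite [c%:C * z]mulrC -[z * c%:C * _]mulrA; congr (z * _).
by rewrite -rmorphM/= mulrA divff ?lt0r_neq0// mul1r.
Qed.

End KernelFormula.

(** * Functions with vanishing moments *)

Section SignByIteration.
Variable R : realType.
Implicit Types x : R.

(** Iterating this polynomial on [-1, 1] approaches the sign function by ring
    operations alone. *)
Definition sharpen x : R := (3 * x - x ^+ 3) / 2.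

Lemma sharpen_bound x : -1 <= x <= 1 -> -1 <= sharpen x <= 1.
Proof.
move=> /andP[h1 h2]; apply/andP; split; rewrite -subr_ge0 /sharpen.
  rewrite (_ : _ - _ = (1 + x) ^+ 2 * ((2 - x) / 2)); last by field.
  by rewrite mulr_ge0 ?sqr_ge0//; lra.
rewrite (_ : _ - _ = (1 - x) ^+ 2 * ((2 + x) / 2)); last by field.
by rewrite mulr_ge0 ?sqr_ge0//; lra.
Qed.

Lemma iter_sharpen_bound n x : -1 <= x <= 1 -> -1 <= iter n sharpen x <= 1.
Proof. by move=> x1; elim: n => //= n IH; exact: sharpen_bound. Qed.

Lemma sharpenN x : sharpen (- x) = - sharpen x.
Proof. by rewrite /sharpen; field. Qed.

Lemma iter_sharpenN n x : iter n sharpen (- x) = - iter n sharpen x.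
Proof. by elim: n => //= n ->; rewrite sharpenN. Qed.

(** On ]0, 1] the defect [1 - x] is multiplied at each step by a factor at most
    [1 - x / 2 < 1], so that the iterates converge to 1. *)
Lemma iter_sharpen_cvg1 x : 0 < x <= 1 -> iter n sharpen x @[n --> \oo] --> (1 : R).
Proof.
move=> /andP[x0 x1].
have key n : x <= iter n sharpen x <= 1 /\
    1 - iter n sharpen x <= (1 - x / 2) ^+ n.
  elim: n => [|n [/andP[h1 h2] h3]] /=; first by rewrite lexx x1 expr0; split => //; lra.
  set z := iter n sharpen x in h1 h2 h3 *.
  have E : 1 - sharpen z = ((2 - z - z ^+ 2) / 2) * (1 - z) by rewrite /sharpen; field.
  have F : sharpen z - z = z * (1 - z ^+ 2) / 2 by rewrite /sharpen; field.
  have z1 : z ^+ 2 <= 1 by rewrite expr_le1//; lra.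
  have z0 : 0 <= z * (1 - z ^+ 2) by rewrite mulr_ge0//; lra.
  split.
    have := @sharpen_bound z; rewrite h2 andbT => /(_ ltac:(lra)) /andP[_ ->].
    by rewrite andbT; move: F z0; lra.
  rewrite E [leRHS]exprS; apply: ler_pM; [| | |exact: h3].
  - by apply: divr_ge0 => //; lra.
  - lra.
  - have := sqr_ge0 z; lra.
apply/cvgrPdist_le => e e0.
have /cvgr0Pnorm_le/(_ e e0) : geometric 1 (1 - x / 2) n @[n --> \oo] --> (0 : R).
  by apply: cvg_geometric; rewrite ger0_norm; lra.
apply: filter_app; near=> n => /=; rewrite mul1r => H.
have [/andP[h1 h2] h3] := key n.
rewrite ger0_norm ?subr_ge0//; apply: le_trans h3 _.
by apply: le_trans H; rewrite ler_norm.
Unshelve. all: by end_near.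
Qed.

Lemma iter_sharpen_cvg x : -1 <= x <= 1 ->
  iter n sharpen x @[n --> \oo] --> Num.sg x.
Proof.
move=> /andP[h1 h2]; have [x0|x0|<-] := ltgtP 0 x.
- by rewrite gtr0_sg//; apply: iter_sharpen_cvg1; rewrite x0.
- rewrite ltr0_sg//.
  have : iter n sharpen (- x) @[n --> \oo] --> (1 : R).
    by apply: iter_sharpen_cvg1; rewrite oppr_gt0 x0 lerNl.
  rewrite (_ : (fun n => iter n sharpen x) = (fun n => - iter n sharpen (- x))).
    by move=> H; exact: (cvgN H).
  by apply/funext => n; rewrite iter_sharpenN opprK.
- rewrite sgr0 (_ : (fun n => _) = fun=> 0); first exact: cvg_cst.
  by apply/funext; elim=> //= n ->; rewrite /sharpen mulr0 expr0n subr0 mul0r.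
Qed.

End SignByIteration.

Section Uniqueness.
Variables (R : realType) (N : nat).
Local Notation B := (measurableTypeR R).
Local Notation mu := (lebesgueN R N).
Implicit Types (f g : N.-tuple B -> R) (eta : 'rV[R]_N) (c : R).

Definition wave eta c (s : N.-tuple B) : R := cos (dot eta (vec s) + c).

Lemma measurable_wave eta c : measurable_fun setT (wave eta c).
Proof.
apply: (measurableT_comp (continuous_measurable_fun (@continuous_cos R))).
apply: measurable_funD => //.
by apply: measurable_dot; [exact: vmeas_cst|exact: vmeas_vec].
Qed.

Lemma wave_bound eta c s : `|wave eta c s| <= 1.
Proof. by rewrite ler_norml cos_geN1 cos_le1. Qed.

(** The Fourier transform of [f] vanishes; the shift [c] accounts for sines and
    cosines at once. *)
Definition waveless f := Rintegrable mu f /\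
  forall eta c, \int[mu]_s (f s * wave eta c s) = 0.

(** Multipliers preserve the vanishing of the Fourier transform. Unlike the
    functions orthogonal to a given [f], they are closed under products, so that the
    indicator of every measurable set can be reached from plane waves by algebraic
    operations and bounded pointwise limits. *)
Definition multiplier g := [/\ measurable_fun setT g,
  exists K, forall s, `|g s| <= K &
  forall f, waveless f -> waveless (fun s => f s * g s)].

Lemma Rintegrable_bounded f g K : Rintegrable mu f -> measurable_fun setT g ->
  (forall s, `|g s| <= K) -> Rintegrable mu (fun s => f s * g s).
Proof.
move=> fi mg gK.
apply: (Rintegrable_dom _ (RintegrableZ K (Rintegrable_norm fi))) => [|s].
  by apply: measurable_funM => //; exact: (Rintegrable_measurable fi).
by rewrite normrM mulrC ler_wpM2r.
Qed.

(** A product of two cosines is a sum of cosines. *)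
Lemma multiplier_wave eta c : multiplier (wave eta c).
Proof.
split; [exact: measurable_wave|by exists 1 => s; exact: wave_bound|].
move=> f [fi f0]; have iw e c' : Rintegrable mu (fun s => f s * wave e c' s).
  exact: (Rintegrable_bounded fi (measurable_wave e c') (wave_bound e c')).
split; first exact: iw.
move=> eta' c'.
under eq_Rintegral => s _.
  rewrite (_ : _ * _ = 2^-1 * (f s * wave (eta + eta') (c + c') s +
    f s * wave (eta + - eta') (c - c') s)); last first.
    rewrite /wave !dotDl (dotC (- eta')) dotNr (dotC (vec s)).
    rewrite (_ : _ + _ + _ = (dot eta (vec s) + c) + (dot eta' (vec s) + c')); last by ring.
    rewrite (_ : _ - _ + _ = (dot eta (vec s) + c) - (dot eta' (vec s) + c')); last by ring.
    by move: (dot eta _ + c) (dot eta' _ + c') => x x'; rewrite cosD cosB; field.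
  over.
rewrite RintegralZl//; last by apply: RintegrableD; exact: iw.
by rewrite RintegralD ?f0 ?addr0 ?mulr0//; exact: iw.
Qed.

Lemma multiplier_cst c : multiplier (fun=> c).
Proof.
split; [exact: measurable_cst|by exists (`|c|)|].
move=> f [fi f0].
have fcE : (fun s => f s * c) = (fun s => c * f s) by apply/funext => s; rewrite mulrC.
split; first by rewrite fcE; exact: RintegrableZ.
move=> eta c'; under eq_Rintegral do rewrite mulrAC.
rewrite RintegralZr ?f0 ?mul0r//.
exact: (Rintegrable_bounded fi (measurable_wave _ _) (wave_bound _ _)).
Qed.

Lemma multiplierM g h : multiplier g -> multiplier h ->
  multiplier (fun s => g s * h s).
Proof.
move=> [mg [K gK] Hg] [mh [K' hK] Hh]; split; first exact: measurable_funM.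
  by exists (K * K') => s; rewrite normrM ler_pM.
move=> f /Hg/Hh; by under [X in waveless X -> _]eq_fun do rewrite -mulrA.
Qed.

Lemma multiplierD g h : multiplier g -> multiplier h ->
  multiplier (fun s => g s + h s).
Proof.
move=> [mg [K gK] Hg] [mh [K' hK] Hh]; split; first exact: measurable_funD.
  by exists (K + K') => s; apply: le_trans (ler_normD _ _) _; exact: lerD.
move=> f wf; have [i1 h1] := Hg f wf; have [i2 h2] := Hh f wf.
have E : (fun s => f s * (g s + h s)) = (fun s => f s * g s + f s * h s).
  by apply/funext => s; rewrite mulrDr.
split; first by rewrite E; exact: RintegrableD.
move=> eta c; under eq_Rintegral do rewrite mulrDr mulrDl.
rewrite RintegralD ?h1 ?h2 ?addr0//.
  exact: (Rintegrable_bounded i1 (measurable_wave _ _) (wave_bound _ _)).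
exact: (Rintegrable_bounded i2 (measurable_wave _ _) (wave_bound _ _)).
Qed.

Lemma multiplierZ g c : multiplier g -> multiplier (fun s => c * g s).
Proof. by move=> mg; exact: (multiplierM (multiplier_cst c) mg). Qed.

Lemma multiplierX g n : multiplier g -> multiplier (fun s => g s ^+ n).
Proof.
move=> mg; elim: n => [|n IH].
  by under eq_fun do rewrite expr0; exact: multiplier_cst.
by under eq_fun do rewrite exprS; exact: multiplierM.
Qed.

Lemma multiplier_lim (g_ : nat -> N.-tuple B -> R) g K :
  (forall n, multiplier (g_ n)) -> (forall n s, `|g_ n s| <= K) ->
  (forall s, g_ n s @[n --> \oo] --> g s) -> multiplier g.
Proof.
move=> mg gK cg.
have mgn n : measurable_fun setT (g_ n) by case: (mg n).
have m : measurable_fun setT g by exact: (measurable_fun_cvg mgn).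
have gb s : `|g s| <= K.
  have h : `|g_ n s| @[n --> \oo] --> `|g s| by exact: cvg_norm.
  rewrite -(cvg_lim (@Rhausdorff R) h); apply: limr_le; first exact: cvgP h.
  by apply: nearW => n; exact: gK.
split => //; first by exists K.
move=> f wf; have [fi f0] := wf.
have fgi : Rintegrable mu (fun s => f s * g s).
  exact: Rintegrable_bounded fi m gb.
split => // eta c.
have mf : measurable_fun setT f by exact: (Rintegrable_measurable fi).
have mw := measurable_wave eta c.
pose F_ n s := (f s * g_ n s * wave eta c s)%:E.
have [|||||_ _ ] := @dominated_convergence _ _ _ mu setT measurableT F_
    (fun s => (f s * g s * wave eta c s)%:E) (fun s => (K * `|f s|)%:E).
- move=> n; apply/measurable_EFinP; apply: measurable_funM => //.
  exact: measurable_funM.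
- by apply/measurable_EFinP; apply: measurable_funM => //; exact: measurable_funM.
- apply: aeW => s _; apply: cvg_EFin; first by apply: nearW.
  rewrite /F_ /=; apply: cvgMl; apply: cvgMr; exact: cg.
- exact: RintegrableZ (Rintegrable_norm fi).
- apply: aeW => s n _; rewrite /F_ lee_fin !normrM.
  apply: (@le_trans _ _ (`|f s| * K * 1)); last by rewrite mulr1 mulrC.
  by rewrite ler_pM ?mulr_ge0// ?wave_bound// ler_wpM2l.
have -> : [sequence (\int[mu]_s F_ n s)%E]_n = (fun=> 0%E).
  apply/funext => n; have [_ _ /(_ f wf)[i h]] := mg n.
  have hi := Rintegrable_bounded i mw (wave_bound _ _).
  by rewrite -[LHS]fineK ?(integrable_fin_num measurableT hi)//; congr EFin; exact: h.
move=> /(cvg_lim (@ereal_hausdorff R)) => H; rewrite /Rintegral -H.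
by rewrite (cvg_lim (@ereal_hausdorff R) (cvg_cst _)).
Qed.

(** The sign of the sine of [(s_i - b) / k] is a limit of polynomials in a plane
    wave, and for large [k] it is the sign of [s_i - b]. *)
Lemma multiplier_sg (b : R) i : multiplier (fun s => Num.sg (tnth s i - b)).
Proof.
pose sn k (s : N.-tuple B) : R := sin ((tnth s i - b) / k.+1%:R).
have mult_sn k : multiplier (sn k).
  pose e : 'rV[R]_N := (k.+1%:R)^-1 *: delta_mx 0 i.
  suff -> : sn k = wave e (- (b / k.+1%:R) - pi / 2) by exact: multiplier_wave.
  apply/funext => s; rewrite /sn /wave.
  have -> : dot e (vec s) = tnth s i / k.+1%:R.
    rewrite dotZl /dot (bigD1 i)//= big1 ?addr0 => [|j ji].
      by rewrite !mxE !eqxx mul1r mulrC.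
    by rewrite !mxE eqxx (negbTE ji) mul0r.
  rewrite addrA cosB cos_pihalf sin_pihalf mulr0 add0r mulr1; congr sin; ring.
have sn1 k s : -1 <= sn k s <= 1 by rewrite sin_geN1 sin_le1.
have b1 (x : R) : -1 <= x <= 1 -> `|x| <= 1 by move=> h; rewrite ler_norml.
have mult_sgsn k : multiplier (fun s => Num.sg (sn k s)).
  apply: (@multiplier_lim (fun n s => iter n (@sharpen R) (sn k s)) _ 1).
  - elim=> [|n IH]; first exact: mult_sn.
    rewrite (_ : (fun s => _) = (fun s => 2^-1 * (3 * iter n (@sharpen R) (sn k s)
      + (-1) * iter n (@sharpen R) (sn k s) ^+ 3))).
      by apply/multiplierZ/multiplierD; apply: multiplierZ => //; exact: multiplierX.
    by apply/funext => s; rewrite iterS /sharpen; field.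
  - by move=> n s; apply: b1; exact: iter_sharpen_bound.
  - by move=> s; exact: iter_sharpen_cvg.
apply: (@multiplier_lim (fun k s => Num.sg (sn k s)) _ 1) => //.
  by move=> k s; rewrite normr_sg; case: eqP.
move=> s; set x := tnth s i - b.
apply: cvg_near_cst; near=> k.
have xk : `|x| / k.+1%:R < pi.
  rewrite ltr_pdivrMr ?ltr0n// -ltr_pdivrMl ?pi_gt0//.
  near: k; exists (Num.Def.truncn (pi^-1 * `|x|)).+1 => // k /= hk.
  apply: lt_trans (truncnS_gt _) _.
  by rewrite ltr_nat ltnS.
rewrite /sn -/x.
have k0 : 0 < k.+1%:R :> R by rewrite ltr0n.
have [x0|x0|x0] := ltgtP 0 x.
- rewrite [RHS]gtr0_sg// gtr0_sg// sin_gt0_pi// divr_gt0//=.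
  by rewrite -[x]ger0_norm ?ltW.
- rewrite [RHS]ltr0_sg// ltr0_sg// -[x]opprK mulNr sinN oppr_lt0.
  rewrite sin_gt0_pi// divr_gt0 ?oppr_gt0//=.
  by rewrite -ltr0_norm.
- by rewrite -x0 mul0r sin0.
Unshelve. all: by end_near.
Qed.

Lemma multiplier_gt (b : R) i :
  multiplier (\1_[set s : N.-tuple B | b < tnth s i]).
Proof.
pose g (s : N.-tuple B) := Num.sg (tnth s i - b).
have mg : multiplier g by exact: multiplier_sg.
rewrite (_ : \1_ _ = (fun s => 2^-1 * (g s + g s * g s))).
  by apply/multiplierZ/multiplierD => //; exact: multiplierM.
apply/funext => s; rewrite indicE /g; have [h|h] := ltP b (tnth s i).
  by rewrite (_ : (s \in _) = true) ?gtr0_sg ?subr_gt0//=; [field|exact/mem_set].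
rewrite (_ : (s \in _) = false); last by apply/memNset => /=; rewrite ltNge h.
move: h; rewrite le_eqVlt => /orP[/eqP ->|h].
  by rewrite subrr sgr0 mul0r addr0 mulr0.
by rewrite ltr0_sg ?subr_lt0//=; field.
Qed.

Lemma multiplier_sigma_algebra :
  sigma_algebra setT [set A : set (N.-tuple B) | multiplier \1_A].
Proof.
split => [|A mA|A mA] /=.
- by rewrite indic0; exact: multiplier_cst.
- rewrite setTD (_ : \1_ _ = (fun s => 1 + (-1) * \1_A s)).
    apply: multiplierD; first exact: multiplier_cst.
    exact: multiplierZ.
  apply/funext => s; rewrite !indicE in_setC.
  by case: (s \in A); rewrite /= ?mulr1 ?mulr0 ?subrr ?addr0.
  (* The indicator of the complement of a union is a limit of finite products. *)
- pose p n s : R := \prod_(k < n) (1 + (-1) * \1_(A k) s).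
  have mp n : multiplier (p n).
    elim: n => [|n IH].
      rewrite (_ : p 0%N = fun=> 1); first exact: multiplier_cst.
      by apply/funext => s; rewrite /p big_ord0.
    rewrite (_ : p n.+1 = fun s => p n s * (1 + (-1) * \1_(A n) s)).
      apply: multiplierM => //; apply: multiplierD; first exact: multiplier_cst.
      by apply: multiplierZ; exact: mA.
    by apply/funext => s; rewrite /p big_ord_recr.
  have p01 n s : p n s = 1 \/ p n s = 0.
    elim: n => [|n IH]; first by left; rewrite /p big_ord0.
    rewrite /p big_ord_recr/= -/(p n s) indicE; case: (s \in A n).
      by right; rewrite mulr1 subrr mulr0.
    by rewrite mulr0 addr0 mulr1.
  rewrite (_ : \1_ _ = (fun s => 1 + (-1) * \1_(~` (\bigcup_k A k)) s)); last first.
    apply/funext => s; rewrite !indicE in_setC.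
    by case: (s \in _); rewrite /= ?mulr1 ?mulr0 ?subrr ?addr0.
  apply: multiplierD; first exact: multiplier_cst.
  apply: multiplierZ; apply: (@multiplier_lim p _ 1) => //.
    by move=> n s; case: (p01 n s) => ->; rewrite ?normr1 ?normr0.
  move=> s; have [[k _ Ak]|nA] := pselect ((\bigcup_k A k) s).
    rewrite indicE in_setC mem_set/=; last by exists k.
    apply: cvg_near_cst; exists k.+1 => // n /= kn.
    rewrite /p (bigD1 (Ordinal kn))//= indicE mem_set// mulr1 subrr mul0r.
    by [].
  rewrite indicE in_setC memNset//=; apply: cvg_near_cst; apply: nearW => n.
  rewrite /p big1// => j _; rewrite indicE memNset ?mulr0 ?addr0// => Aj.
  by apply: nA; exists j.
Qed.

Lemma multiplier_measurable (A : set (N.-tuple B)) : measurable A -> multiplier \1_A.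
Proof.
suff : measurable `<=` [set A : set (N.-tuple B) | multiplier \1_A] by apply.
apply: smallest_sub; first exact: multiplier_sigma_algebra.
apply: (big_ind (fun S => S `<=` _)) => [A' //|S S' hS hS' A' [/hS|/hS']//|i _].
move=> _ [Y mY <-].
have sa := @sigma_algebra_image _ _ setT (fun s : N.-tuple B => tnth s i) _
  multiplier_sigma_algebra.
suff : (measurable : set (set B)) `<=`
    image_set_system setT (fun s : N.-tuple B => tnth s i)
      [set A : set (N.-tuple B) | multiplier \1_A] by apply.
rewrite [X in X `<=` _]RGenOInfty.measurableE; apply: smallest_sub => // _ [b ->].
rewrite /image_set_system/= setTI; have := multiplier_gt b i; congr (multiplier \1_ _).
by apply/seteqP; split => s /=; rewrite in_itv/= andbT.
Qed.

(** Multiplying by the indicator of a measurable set and testing against the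
    constant wave shows that all integrals of [f] over measurable sets vanish. *)
Lemma waveless_ae0 f : waveless f -> {ae mu, forall s, f s = 0}.
Proof.
move=> [fi f0].
have : ae_eq mu setT (EFin \o f) (cst 0%E).
  apply: integral_ae_eq => //.
  move=> E _ mE; have [_ _ /(_ f (conj fi f0))[i h]] := multiplier_measurable mE.
  rewrite integral_cst ?mul0e// integral_mkcond.
  have hi := Rintegrable_bounded i (measurable_wave 0 0) (wave_bound 0 0).
  have E0 : (\int[mu]_s (f s * \1_E s * wave 0 0 s)%:E)%E = 0%E.
    by rewrite -[LHS]fineK ?(integrable_fin_num measurableT hi)//; congr EFin; exact: h.
  rewrite -[RHS]E0; apply: eq_integral => s _; rewrite patchE indicE /wave.
  rewrite dotC dot0r addr0 cos0 mulr1.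
  by case: ifPn => _; rewrite ?mulr1 ?mulr0.
by apply: filterS => s /(_ I) /= [].
Qed.

(** The truncations of the plane wave integrate to 0 against [f]; the remainder of
    order [k] is at most [2 ^ - k] times an exponential of twice the exponent, which is
    integrable against [f]. *)
Lemma waveless_of_moments f : measurable_fun setT f ->
  (forall a, Rintegrable mu (fun s => `|f s| * expR (a * enorm (vec s)))) ->
  (forall eta k, \int[mu]_s (f s * dot eta (vec s) ^+ k) = 0) -> waveless f.
Proof.
move=> mf iexp mom.
have fi : Rintegrable mu f.
  apply: (Rintegrable_dom mf (iexp 0)) => s; by rewrite mul0r expR0 mulr1.
split => // eta c.
pose D s := dot eta (vec s).
have mD : measurable_fun setT D.
  by apply: measurable_dot; [exact: vmeas_cst|exact: vmeas_vec].
pose A := N%:R * enorm eta.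
have A0 : 0 <= A by rewrite mulr_ge0// enorm_ge0.
have DA s : `|D s| <= A * enorm (vec s).
  by apply: le_trans (dot_le _ _) _; rewrite mulrA.
have ifD k : Rintegrable mu (fun s => f s * D s ^+ k).
  apply: (Rintegrable_dom _ (RintegrableZ (k%:R ^+ k) (iexp A))) => [|s].
    by apply: measurable_funM => //; exact: measurable_funX.
  rewrite normrM normrX mulrCA; apply: ler_wpM2l => //.
  apply: le_trans (pow_le_expR k (normr_ge0 _)) _.
  by rewrite ler_wpM2l ?exprn_ge0// ler_expR DA.
pose z s : R[i] := (D s)%:C * 'i%C.
have mz : Cmeas z by apply: CmeasM; [exact: Cmeas_real|exact: Cmeas_cst].
have nI : normc ('i%C : R[i]) = 1 by rewrite /= expr0n expr1n add0r sqrtr1.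
have nz s : normc (z s) = `|D s| by rewrite Normc.normcM nI mulr1 normc_real.
have Rez s : Re (z s) = 0 by rewrite Re_realM/= mulr0.
have ifC : Cintegrable mu (fun s => (f s)%:C * expC (z s)).
  apply: (Cintegrable_dom _ (Rintegrable_norm fi)) => [|s].
    by apply: CmeasM; [exact: Cmeas_real|exact: Cmeas_expC].
  by rewrite Normc.normcM normc_real normc_expC Rez expR0 mulr1.
have itr k : Cintegrable mu (fun s => (f s)%:C * exp_trunc k (z s)).
  under eq_fun do rewrite mulr_sumr.
  apply: Cintegrable_sum => j _.
  rewrite (_ : (fun s => _) = (fun s => ((j`!%:R)^-1 * 'i%C ^+ j) * (f s * D s ^+ j)%:C)).
    by apply: CintegrableZ; apply: Cintegrable_real.
  by apply/funext => s; rewrite /z exprMn rmorphM rmorphXn/=; ring.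
have tr0 k : Cint mu (fun s => (f s)%:C * exp_trunc k (z s)) = 0.
  under [X in Cint _ X]eq_fun do rewrite mulr_sumr.
  have E j : (fun s => (f s)%:C * ((j`!%:R)^-1 * z s ^+ j)) =
      (fun s => ((j`!%:R)^-1 * 'i%C ^+ j) * (f s * D s ^+ j)%:C).
    by apply/funext => s; rewrite /z exprMn rmorphM rmorphXn/=; ring.
  rewrite Cint_sum; last first.
    by move=> j _; rewrite E; apply: CintegrableZ; apply: Cintegrable_real.
  rewrite big1// => j _; rewrite E CintZ; last exact: Cintegrable_real.
  rewrite (_ : Cint _ _ = 0) ?mulr0//; apply: ReImP => /=; first exact: mom.
  by rewrite Rintegral_cst// mul0r.
have I0 : Cint mu (fun s => (f s)%:C * expC (z s)) = 0.
  apply: Normc.eq0_normc; apply/eqP; rewrite eq_le normc_ge0 andbT.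
  pose J := \int[mu]_s (`|f s| * expR ((2 * A) * enorm (vec s))).
  have J0 : 0 <= J by apply: Rintegral_ge0 => s _; rewrite mulr_ge0 ?expR_ge0.
  have bnd k : normc (Cint mu (fun s => (f s)%:C * expC (z s))) <= 2^-1 ^+ k * J.
    rewrite -[Cint _ _]subr0 -(tr0 k) -CintB// -RintegralZl//; last exact: (iexp (2 * A)).
    apply: normc_Cint.
    - by apply: CintegrableD => //; exact: CintegrableN.
    - by apply: RintegrableZ; exact: (iexp (2 * A)).
    - move=> s; rewrite -mulrBr Normc.normcM normc_real mulrCA ler_wpM2l//.
      have h01 : 0 <= (2^-1 : R) <= 1 by apply/andP; split; lra.
      have := expC_taylor k (2 * z s) h01.
      have -> : (2^-1 : R)%:C * (2 * z s) = z s.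
        by rewrite fmorphV/= rmorph_nat mulrA mulVf ?mul1r// pnatr_eq0.
      move=> h; apply: le_trans h _; rewrite ler_wpM2l ?exprn_ge0// ler_expR.
      rewrite Normc.normcM nz normc_nat.
      by rewrite -mulrA ler_wpM2l.
  apply/ler_addgt0Pl => e e0; rewrite addr0.
  have /cvgr0Pnorm_le : geometric J (2^-1) n @[n --> \oo] --> (0 : R).
    by apply: cvg_geometric; rewrite ger0_norm ?invr_ge0// invf_lt1// ltr1n.
  move=> /(_ e e0)[n _ /(_ n (leqnn n))] /= h.
  apply: le_trans (bnd n) _; apply: le_trans h.
  by rewrite mulrC ler_norm.
have E s : Re (expC (c%:C * 'i%C) * ((f s)%:C * expC (z s))) = f s * wave eta c s.
  rewrite mulrCA Re_realM -expCD /wave Re_expC ReD Rez Re_realM ImD !Im_realM.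
  by rewrite /= mulr0 addr0 expR0 mul1r !mulr1 addrC.
have := CintZ (expC (c%:C * 'i%C)) ifC; rewrite I0 mulr0 => H.
transitivity (Re (Cint mu (fun s => expC (c%:C * 'i%C) * ((f s)%:C * expC (z s))))).
  by apply: eq_Rintegral => s _; rewrite E.
by rewrite H.
Qed.

End Uniqueness.

(** The moments determine the Fourier transforms of the real and imaginary parts,
    and these determine the function. *)
Lemma moments_ae0 (R : realType) (N : nat)
    (f : N.-tuple (measurableTypeR R) -> R[i]) : Cmeas f ->
  (forall a, Rintegrable (lebesgueN R N)
     (fun s => normc (f s) * expR (a * enorm (vec s)))) ->
  (forall eta k, Cint (lebesgueN R N) (fun s => f s * (dot eta (vec s) ^+ k)%:C) = 0) ->
  {ae lebesgueN R N, forall s, f s = 0}.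
Proof.
move=> [m1 m2] iexp mom.
have mexp a : measurable_fun setT (fun s : N.-tuple (measurableTypeR R) =>
    expR (a * enorm (vec s))).
  apply: (measurable_vec_fun (g := fun x => expR (a * x))).
  by apply: measurableT_comp => //; exact: measurable_funM.
have part (P : R[i] -> R) : (forall z, `|P z| <= normc z) ->
    measurable_fun setT (fun s => P (f s)) ->
    (forall eta k, \int[lebesgueN R N]_s (P (f s) * dot eta (vec s) ^+ k) = 0) ->
    {ae lebesgueN R N, forall s, P (f s) = 0}.
  move=> Pn mP momP; apply: waveless_ae0; apply: waveless_of_moments => // a.
  apply: (Rintegrable_dom _ (iexp a)) => [|s].
    by apply: measurable_funM => //; apply: measurableT_comp.
  by rewrite normrM normr_id (ger0_norm (expR_ge0 _)) ler_wpM2r ?expR_ge0.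
have h1 := part _ (@normc_Re R) m1; have h2 := part _ (@normc_Im R) m2.
have {}h1 : {ae lebesgueN R N, forall s, Re (f s) = 0}.
  apply: h1 => eta k; have := congr1 (@complex.Re R) (mom eta k) => /= <-.
  by apply: eq_Rintegral => s _; rewrite mulrC [in RHS]mulrC Re_realM.
have {}h2 : {ae lebesgueN R N, forall s, Im (f s) = 0}.
  apply: h2 => eta k; have := congr1 (@complex.Im R) (mom eta k) => /= <-.
  by apply: eq_Rintegral => s _; rewrite mulrC [in RHS]mulrC Im_realM.
apply: filterS2 h1 h2 => s r0 i0; exact: ReImP.
Qed.

(** * The generalized Hermite polynomials *)

Section HermiteAlgebra.
Variables (R : realType) (N : nat).
Local Notation C := R[i].
Local Notation poly := (mpoly N C).
Implicit Types (p q : poly) (b : multinom N) (f g : poly -> poly).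

Definition is_linear f := forall (c : C) p q, f (c *: p + q) = c *: f p + f q.

Lemma is_linear0 f : is_linear f -> f 0 = 0.
Proof. by move=> lf; have := lf (-1) 0 0; rewrite scaler0 add0r scaleN1r addNr. Qed.

Lemma is_linearZ f c p : is_linear f -> f (c *: p) = c *: f p.
Proof. by move=> lf; rewrite -[c *: p]addr0 lf is_linear0// addr0. Qed.

Lemma is_linearD f p q : is_linear f -> f (p + q) = f p + f q.
Proof. by move=> lf; rewrite -[p]scale1r lf !scale1r. Qed.

Lemma is_linear_sum f (I : Type) (r : seq I) (P : pred I) (F : I -> poly) :
  is_linear f -> f (\sum_(i <- r | P i) F i) = \sum_(i <- r | P i) f (F i).
Proof.
by move=> lf; elim/big_rec2: _ => [|i y x _ <-]; [exact: is_linear0|exact: is_linearD].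
Qed.

Lemma is_linear_iter f n : is_linear f -> is_linear (iter n f).
Proof. by move=> lf; elim: n => [c p q //|n IH c p q]; rewrite !iterS IH lf. Qed.

Lemma laplacian_linear : is_linear (@laplacian R N).
Proof.
move=> c p q; rewrite /laplacian scaler_sumr -big_split; apply: eq_bigr => i _ /=.
by rewrite !mderivD !mderivZ.
Qed.

(** The generator of the backward evolution [v_t = i (- Laplacian) ^ m v]. *)
Definition backward_gen m p : poly := 'i *: neg_laplacian_pow m p.

Lemma neg_laplacian_linear : is_linear (fun p => - @laplacian R N p).
Proof. by move=> c p q; rewrite laplacian_linear opprD scalerN. Qed.

Lemma backward_gen_linear m : is_linear (backward_gen m).
Proof.
move=> c p q; rewrite /backward_gen /neg_laplacian_pow.
by rewrite (is_linear_iter m neg_laplacian_linear) scalerDr !scalerA mulrC.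
Qed.

Definition euler p : poly := \sum_(i < N) mpolyX C (mnm1 i) * mderiv i p.

Lemma euler_linear : is_linear euler.
Proof.
move=> c p q; rewrite /euler scaler_sumr -big_split; apply: eq_bigr => i _ /=.
by rewrite mderivD mderivZ mulrDr scalerAr.
Qed.

Lemma BstarE m p :
  Bstar m p = - backward_gen m p - ((2 * m)%:R^-1 : C) *: euler p.
Proof. by []. Qed.

Lemma Bstar_linear m : is_linear (@Bstar R N m).
Proof.
move=> c p q; rewrite !BstarE backward_gen_linear euler_linear.
move: (backward_gen m p) (backward_gen m q) (euler p) (euler q) (_^-1) => x x' y y' k.
by rewrite scalerBr scalerN !scalerDr !scalerA [k * c]mulrC !opprD addrACA.
Qed.

(** Homogeneity with an integer degree, so that the degree may be lowered without
    side conditions: only 0 is homogeneous of negative degree. *)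
Definition homog (d : int) p := forall b, mcoeff b p != 0 -> (mdeg b)%:Z = d.

Lemma homog_neg d p : d < 0 -> homog d p -> p = 0.
Proof.
move=> d0 hp; apply/mpolyP => b; rewrite mcoeff0; apply/eqP/negPn/negP => /hp E.
by move: d0; rewrite -E.
Qed.

Lemma homogN d p : homog d p -> homog d (- p).
Proof. by move=> hp b; rewrite mcoeffN oppr_eq0; exact: hp. Qed.

Lemma homogZ d c p : homog d p -> homog d (c *: p).
Proof. by move=> hp b; rewrite mcoeffZ mulf_eq0 negb_or => /andP[_]; exact: hp. Qed.

Lemma homog_sum d (I : Type) (r : seq I) (P : pred I) (F : I -> poly) :
  (forall i, P i -> homog d (F i)) -> homog d (\sum_(i <- r | P i) F i).
Proof.
move=> hF; elim/big_ind: _ => [b|p q hp hq b|i Pi]; last exact: hF.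
  by rewrite mcoeff0 eqxx.
rewrite mcoeffD => h; have [p0|] := eqVneq (mcoeff b p) 0; last exact: hp.
by apply: hq; move: h; rewrite p0 add0r.
Qed.

Lemma homog_mderiv d i p : homog d p -> homog (d - 1) (mderiv i p).
Proof.
move=> hp b; rewrite mcoeff_mderiv => h.
have /hp : mcoeff (mnm_add b (mnm1 i)) p != 0.
  by apply: contra_neq h => ->; rewrite mul0rn.
by rewrite mdegD mdeg1 => <-; rewrite PoszD addrK.
Qed.

Lemma homog_neg_laplacian_pow d m p : homog d p ->
  homog (d - (2 * m)%:Z) (neg_laplacian_pow m p).
Proof.
move=> hp; elim: m => [|m IH]; first by rewrite muln0 subr0.
rewrite /neg_laplacian_pow iterS; apply/homogN/homog_sum => i _.
have -> : d - (2 * m.+1)%:Z = d - (2 * m)%:Z - 1 - 1.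
  by rewrite mulnS PoszD; ring.
by do 2 apply: homog_mderiv.
Qed.

Lemma homog_backward_gen d m j p : homog d p ->
  homog (d - (2 * m * j)%:Z) (iter j (backward_gen m) p).
Proof.
move=> hp; elim: j => [|j IH]; first by rewrite muln0 subr0.
rewrite iterS; apply: homogZ.
have -> : d - (2 * m * j.+1)%:Z = d - (2 * m * j)%:Z - (2 * m)%:Z.
  by rewrite mulnS PoszD; ring.
exact: homog_neg_laplacian_pow.
Qed.

Lemma homogX b : homog (mdeg b)%:Z (mpolyX C b).
Proof. by move=> b'; rewrite mcoeffX; have [->//|_] := eqVneq b b'; rewrite mulr0n eqxx. Qed.

Lemma eulerX b : euler (mpolyX C b) = (mdeg b)%:R *: mpolyX C b.
Proof.
rewrite /euler mdegE natr_sum scaler_suml; apply: eq_bigr => i _.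
rewrite mderivX -scalerAr; have [->|bi] := eqVneq (b i) 0%N.
  by rewrite !scale0r.
rewrite -mpolyXD; congr (_ *: mpolyX _ _); apply/mnmP => j.
rewrite mnmDE mnmBE mnm1E; case: eqP => [<-|_]; last by rewrite subn0.
by rewrite subnKC// lt0n.
Qed.

Lemma euler_homog d p : homog d p -> euler p = d%:~R *: p.
Proof.
move=> hp; rewrite {1}(mpolyE p) (is_linear_sum _ _ _ euler_linear).
rewrite [in RHS](mpolyE p) scaler_sumr; apply: eq_big_seq => b.
rewrite mcoeff_msupp => /hp <-; rewrite (is_linearZ _ _ euler_linear).
by rewrite eulerX !scalerA mulrC pmulrn.
Qed.

(** The monic normalization of [psi_star]: the exponential series of the
    backward_gen applied to a monomial. *)
Definition hermite m b : poly :=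
  \sum_(j < (mdeg b %/ (2 * m)).+1) (j`!%:R)^-1 *: iter j (backward_gen m) (mpolyX C b).

Lemma psi_starE m b : psi_star R m b =
  ((Num.sqrt ((multi_fact b)%:R : R))^-1)%:C *: hermite m b.
Proof.
rewrite /psi_star /hermite; congr (_ *: _).
rewrite big_ord_recl fact0 invr1 scale1r; congr (_ + _).
by rewrite big_add1 big_mkord.
Qed.

Lemma backward_gen_iter_eq0 m b j : (mdeg b < 2 * m * j)%N ->
  iter j (backward_gen m) (mpolyX C b) = 0.
Proof.
move=> h; apply: (@homog_neg ((mdeg b)%:Z - (2 * m * j)%:Z)).
  by rewrite subr_lt0.
exact/homog_backward_gen/homogX.
Qed.

(** The backward generator shifts the exponential series by one term, while the
    Euler field multiplies its [j]-th term, of degree [|b| - 2mj], by this degree; the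
    parts [2mj] of these degrees compensate the shift. *)
Lemma Bstar_hermite m b : (0 < m)%N -> Bstar m (hermite m b) =
  - ((mdeg b)%:R / (2 * m)%:R) *: hermite m b.
Proof.
move=> m0; have m20 : (2 * m)%:R != 0 :> C by rewrite pnatr_eq0 muln_eq0 -lt0n.
rewrite BstarE; pose n := (mdeg b %/ (2 * m))%N.
have -> : backward_gen m (hermite m b) =
    \sum_(j < n) (j`!%:R)^-1 *: iter j.+1 (backward_gen m) (mpolyX C b).
  rewrite (is_linear_sum _ _ _ (backward_gen_linear m)) -/n.
  rewrite big_ord_recr /= (is_linearZ _ _ (backward_gen_linear m)).
  rewrite -iterS backward_gen_iter_eq0 ?scaler0 ?addr0; last first.
    by rewrite mulnC -ltn_divLR ?muln_gt0//.
  by apply: eq_bigr => j _; rewrite (is_linearZ _ _ (backward_gen_linear m)).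
have -> : euler (hermite m b) = (mdeg b)%:R *: hermite m b - (2 * m)%:R *:
    \sum_(j < n) (j`!%:R)^-1 *: iter j.+1 (backward_gen m) (mpolyX C b).
  rewrite (is_linear_sum _ _ _ euler_linear) /hermite -/n.
  have -> : \sum_(j < n) (j`!%:R)^-1 *: iter j.+1 (backward_gen m) (mpolyX C b) =
      \sum_(j < n.+1) ((j%:R : C) * (j`!%:R)^-1) *: iter j (backward_gen m) (mpolyX C b).
    rewrite big_ord_recl mul0r scale0r add0r; apply: eq_bigr => j _.
    congr (_ *: _); rewrite lift0 factS natrM invfM mulrA divff ?mul1r// pnatr_eq0.
  rewrite !scaler_sumr -sumrB; apply: eq_bigr => j _.
  rewrite (is_linearZ _ _ euler_linear).
  rewrite (euler_homog (@homog_backward_gen _ m j _ (@homogX b))).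
  rewrite !scalerA -scalerBl; congr (_ *: _).
  rewrite intrD rmorphN/= -!pmulrn natrM; ring.
rewrite scalerBr !scalerA mulVf// scale1r mulrC opprB addrA addNr add0r.
by rewrite scaleNr.
Qed.

(** Only the leading term has full degree; hence the polynomials of a given degree
    are linearly independent. *)
Lemma mcoeff_hermite m b b' : (0 < m)%N -> mdeg b = mdeg b' ->
  mcoeff b (hermite m b') = (b' == b)%:R.
Proof.
move=> m0 bb'; rewrite /hermite big_ord_recl fact0 invr1 scale1r mcoeffD mcoeffX /=.
rewrite raddf_sum big1 ?addr0// => j _; rewrite /= mcoeffZ.
have [->|] := eqVneq (mcoeff b (iter (lift ord0 j) (backward_gen m) (mpolyX C b'))) 0.
  by rewrite mulr0.
move=> /(@homog_backward_gen _ m _ _ (@homogX b')); rewrite bb' => /eqP.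
rewrite eq_sym subr_eq -subr_eq0 opprD addrA subrr add0r oppr_eq0.
by rewrite -[0]/(0%:Z) eqz_nat !muln_eq0 /= gtn_eqF.
Qed.

Section GeneratingFunction.
Variables (m : nat) (z : 'I_N -> C).

Definition linform : poly := \sum_(i < N) z i *: mpolyX C (mnm1 i).

Definition sqnorm : C := \sum_(i < N) z i ^+ 2.

(** [z^b / b!] *)
Definition divpow b : C := \prod_(i < N) (z i ^+ b i / (b i)`!%:R).

(** The divided powers of the linear form, extended by 0 to negative exponents. *)
Definition linpow (k : int) : poly :=
  if k is Posz n then (n`!%:R)^-1 *: linform ^+ n else 0.

Lemma mderiv_linform i : mderiv i linform = mpolyC N (z i).
Proof.
rewrite /linform raddf_sum /= (bigD1 i)//= big1 ?addr0 => [|j ji].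
  rewrite mderivZ mderivX mnm1E eqxx scale1r.
  rewrite (_ : mnm_sub _ _ = mnm0) ?mpolyX0 ?mul_mpolyC ?alg_mpolyC//.
  by apply/mnmP => j; rewrite mnmBE mnm0E subnn.
by rewrite mderivZ mderivX mnm1E (negbTE ji) scale0r scaler0.
Qed.

Lemma mderiv_linpow i k : mderiv i (linpow k) = z i *: linpow (k - 1).
Proof.
case: k => [[|n]|n]; last by rewrite /= mderiv0 scaler0.
  by rewrite /= expr0 mderivZ -mpolyC1 mderivC !scaler0.
have -> : n.+1%:Z - 1 = n%:Z by rewrite -addn1 PoszD addrK.
have D : forall k, mderiv i (linform ^+ k.+1) = (k.+1%:R * z i) *: linform ^+ k.
  elim=> [|k IH]; first by rewrite expr1 expr0 mderiv_linform mul1r -mul_mpolyC mulr1.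
  rewrite exprS mderivM IH mderiv_linform mul_mpolyC -scalerAr -exprS -scalerDl.
  by congr (_ *: _); rewrite -[k.+2]add1n natrD mulrDl mul1r.
rewrite /linpow mderivZ D !scalerA; congr (_ *: _).
have a0 : n.+1%:R != 0 :> C by rewrite pnatr_eq0.
have b0 : n`!%:R != 0 :> C by rewrite pnatr_eq0 -lt0n fact_gt0.
rewrite factS natrM; move: (n.+1%:R) (n`!%:R) a0 b0 => a c a0 c0.
by field; rewrite a0 c0.
Qed.

Lemma laplacian_linpow k : laplacian (linpow k) = sqnorm *: linpow (k - 2).
Proof.
rewrite /laplacian /sqnorm scaler_suml; apply: eq_bigr => i _.
rewrite mderiv_linpow mderivZ mderiv_linpow scalerA -expr2.
by rewrite -addrA -opprD.
Qed.

Lemma backward_gen_linpow j k : iter j (backward_gen m) (linpow k) =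
  ('i * (- sqnorm) ^+ m) ^+ j *: linpow (k - (2 * m * j)%:Z).
Proof.
have H n k' : neg_laplacian_pow n (linpow k') = (- sqnorm) ^+ n *: linpow (k' - (2 * n)%:Z).
  elim: n => [|n IH]; first by rewrite muln0 subr0 expr0 scale1r.
  rewrite /neg_laplacian_pow iterS -/(neg_laplacian_pow n _) IH.
  rewrite (is_linearZ _ _ laplacian_linear) laplacian_linpow -scalerN -scaleNr scalerA.
  rewrite -exprSr; congr (_ *: linpow _); rewrite mulnS PoszD; ring.
elim: j => [|j IH]; first by rewrite muln0 subr0 expr0 scale1r.
rewrite iterS IH (is_linearZ _ _ (backward_gen_linear m)) /backward_gen H !scalerA.
rewrite -mulrA -exprSr; congr (_ *: linpow _).
rewrite [(2 * m * j.+1)%N]mulnS PoszD; ring.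
Qed.

Lemma mcoeff_linpow (k : nat) b : mcoeff b (linpow k) = (mdeg b == k)%:R * divpow b.
Proof.
elim: k b => [|k IH] b.
  rewrite /= expr0 fact0 invr1 scale1r mcoeff1 mdeg_eq0.
  case: eqP => [->|_]; last by rewrite mul0r.
  by rewrite /divpow big1 ?mulr1// => i _; rewrite mnm0E expr0 fact0 divr1.
have [b0|] := eqVneq b mnm0.
  rewrite b0 mdeg0 mul0r /= mcoeffZ exprS.
  rewrite (_ : mcoeff _ (_ * _) = mcoeff mnm0 linform * mcoeff mnm0 (linform ^+ k)).
    rewrite (_ : mcoeff mnm0 linform = 0) ?mul0r ?mulr0//.
    rewrite raddf_sum big1// => i _ /=; rewrite mcoeffZ mcoeffX mnm1_eq0 mulr0.
    by [].
  by have [h _] := @mcoeff0_is_multiplicative N C; exact: h.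
rewrite -mdeg_eq0 {1}mdegE sum_nat_eq0 negb_forall => /existsP[i bi].
pose b' := mnm_sub b (mnm1 i).
have bE : b = mnm_add b' (mnm1 i).
  apply/mnmP => j; rewrite mnmDE mnmBE mnm1E; case: eqP => [<-|_].
    by rewrite subnK// lt0n.
  by rewrite subn0 addn0.
have c0 : (b' i).+1%:R != 0 :> C by rewrite pnatr_eq0.
have := mcoeff_mderiv i (linpow k.+1) b'; rewrite -bE mderiv_linpow => /esym.
rewrite -[_ *+ (b' i).+1]mulr_natr => E; apply: (mulIf c0); rewrite {}E -mulrA.
rewrite (_ : k.+1%:Z - 1 = k%:Z); last by rewrite -addn1 PoszD addrK.
rewrite mcoeffZ IH mulrCA; congr (_ * _).
  by rewrite bE mdegD mdeg1 addn1 eqSS.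
have bi1 : b i = (b' i).+1 by rewrite {1}bE mnmDE mnm1E eqxx addn1.
have PE : \prod_(j < N | j != i) (z j ^+ b' j / (b' j)`!%:R) =
    \prod_(j < N | j != i) (z j ^+ b j / (b j)`!%:R).
  by apply: eq_bigr => j ji; rewrite bE mnmDE mnm1E eq_sym (negbTE ji) addn0.
have f0 : (b' i)`!%:R != 0 :> C by rewrite pnatr_eq0 -lt0n fact_gt0.
rewrite /divpow (bigD1 i)//= PE [in RHS](bigD1 i)//= bi1 factS natrM exprS.
move: (\prod_(j < N | _) _) (z i ^+ b' i) ((b' i)`!%:R) ((b' i).+1%:R) f0 c0.
by move=> P x u v u0 v0; field; rewrite u0 v0.
Qed.

Lemma linpowE (k : nat) : linpow k =
  \sum_(b : bmultinom N k.+1 | mdeg (bmnm b) == k) divpow (bmnm b) *: mpolyX C (bmnm b).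
Proof.
apply/mpolyP => b; rewrite mcoeff_linpow raddf_sum /=.
under eq_bigr do rewrite mcoeffZ mcoeffX.
have [bk|bk] := eqVneq (mdeg b) k; last first.
  rewrite mul0r big1// => b' /eqP b'k; case: eqP => [E|_]; last by rewrite mulr0.
  by move: bk; rewrite -E b'k eqxx.
have bk1 : (mdeg b < k.+1)%N by rewrite bk.
rewrite (bigD1 (BMultinom bk1)) /=; last by rewrite bk.
rewrite eqxx mulr1 mul1r big1 ?addr0// => b' /andP[_ b'b].
by case: eqP => [E|_]; rewrite ?mulr0//; case/eqP: b'b; exact: val_inj.
Qed.

(** The generating function of the Hermite polynomials: the solution issued from
    the plane wave [exp (z . y)] expanded into homogeneous components. *)
Lemma hermite_generating (k : nat) :
  \sum_(b : bmultinom N k.+1 | mdeg (bmnm b) == k) divpow (bmnm b) *: hermite m (bmnm b)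
  = \sum_(j < (k %/ (2 * m)).+1) ((j`!%:R)^-1 * ('i * (- sqnorm) ^+ m) ^+ j) *:
      linpow (k - 2 * m * j)%N.
Proof.
transitivity (\sum_(j < (k %/ (2 * m)).+1)
    (j`!%:R)^-1 *: iter j (backward_gen m) (linpow k)).
  rewrite linpowE.
  under [RHS]eq_bigr => j _.
    rewrite (is_linear_sum _ _ _ (is_linear_iter j (backward_gen_linear m))).
    rewrite scaler_sumr; over.
  rewrite exchange_big /=; apply: eq_bigr => b /eqP bk.
  rewrite /hermite bk scaler_sumr; apply: eq_bigr => j _.
  rewrite (is_linearZ _ _ (is_linear_iter j (backward_gen_linear m))).
  by rewrite !scalerA mulrC.
apply: eq_bigr => j _; rewrite backward_gen_linpow scalerA; congr (_ *: linpow _).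
rewrite subzn//; have := ltn_ord j; rewrite ltnS => hj.
by apply: leq_trans (leq_trunc_div k (2 * m)); rewrite mulnC leq_mul2r hj orbT.
Qed.

End GeneratingFunction.

Lemma evalpZ c p (y : 'rV[R]_N) : evalp (c *: p) y = c * evalp p y.
Proof. exact: mevalZ. Qed.

Lemma evalp_sum (I : Type) (r : seq I) (P : pred I) (F : I -> poly) (y : 'rV[R]_N) :
  evalp (\sum_(i <- r | P i) F i) y = \sum_(i <- r | P i) evalp (F i) y.
Proof. by rewrite /evalp raddf_sum. Qed.

Lemma evalp_linpow (z : 'I_N -> C) (n : nat) (y : 'rV[R]_N) :
  evalp (linpow z n) y = (n`!%:R)^-1 * (\sum_(i < N) z i * (y 0 i)%:C) ^+ n.
Proof.
rewrite evalpZ; congr (_ * _); rewrite /evalp rmorphXn /=; congr (_ ^+ _).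
by rewrite /linform raddf_sum /=; apply: eq_bigr => i _; rewrite mevalZ mevalXU.
Qed.

End HermiteAlgebra.

(** * Decay of the data against growth of the kernel *)

Section Growth.
Variables (R : realType) (m : nat).
Hypothesis m_gt0 : (0 < m)%N.
Implicit Types (A kap r x : R).

Let gam : R := (2 * m - 1)%:R^-1.

Let deg_gt0 : (0 < 2 * m - 1)%N.
Proof. by rewrite subn_gt0; case: m m_gt0 => // k _; rewrite mulnS. Qed.

Let gam_gt0 : 0 < gam.
Proof. by rewrite invr_gt0 ltr0n. Qed.

Lemma powR_alpha r : 0 <= r -> r `^ alpha R m = r * r `^ gam.
Proof.
have -> : alpha R m = 1 + gam.
  have e : (2 * m)%:R = (2 * m - 1)%:R + 1 :> R.
    by rewrite -[1 in RHS]/(1%:R) -natrD subnK// muln_gt0.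
  by rewrite /alpha e mulrDl mul1r mulfV// pnatr_eq0 -lt0n.
rewrite le_eqVlt => /predU1P[<-|r0].
  by rewrite mul0r powR0// gt_eqF// addr_gt0.
by rewrite powRD ?powRr1 ?(ltW r0)// (gt_eqF r0) implybT.
Qed.

Let root_pow x : 0 <= x -> (x ^+ (2 * m - 1)) `^ gam = x.
Proof.
move=> x0; rewrite -powR_mulrn// -powRrM mulfV ?powRr1//.
by rewrite pnatr_eq0 -lt0n.
Qed.

Let le_root x r : 0 <= x -> x ^+ (2 * m - 1) <= r -> x <= r `^ gam.
Proof.
move=> x0 xr; rewrite -[leLHS]root_pow//; apply: ge0_ler_powR => //.
- exact: ltW.
- by rewrite nnegrE exprn_ge0.
- by rewrite nnegrE (le_trans _ xr)// exprn_ge0.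
Qed.

(** The exponent [alpha] exceeds 1. *)
Lemma line_le_powR A kap : 0 < kap -> exists C : R,
  forall r, 0 <= r -> A * r <= C + kap * r `^ alpha R m.
Proof.
move=> k0; pose r0 := (`|A| / kap) ^+ (2 * m - 1); exists (`|A| * r0) => r rge0.
have r00 : 0 <= r0 by rewrite exprn_ge0// divr_ge0// ltW.
apply: (@le_trans _ _ (`|A| * r)); first by rewrite ler_wpM2r// ler_norm.
have [rr0|/ltW r0r] := leP r r0.
  apply: (@le_trans _ _ (`|A| * r0)); first by rewrite ler_wpM2l.
  by rewrite lerDl mulr_ge0 ?powR_ge0// ltW.
rewrite powR_alpha//; apply: (@le_trans _ _ (kap * (r * r `^ gam))).
  rewrite mulrCA mulrC ler_wpM2l// mulrC -ler_pdivrMr//.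
  by apply: le_root r0r; rewrite divr_ge0// ltW.
by rewrite lerDr mulr_ge0.
Qed.

(** Either the product is dominated by the term in [r], or [r] is bounded by a
    multiple of the [2m-1]-st root of [rho]. In the second case the product is at most
    a multiple of [S * rho ^ alpha], which is small with [S]. *)
Lemma young_small (c t : R) : 0 <= c -> 0 < t -> exists2 S0 : R, 0 < S0 &
  forall S r rho, 0 <= S -> S <= S0 -> 0 <= r -> 0 <= rho ->
  c * S * r * rho <= t * S * r ^+ (2 * m) + rho `^ alpha R m / 4.
Proof.
move=> c0 t0; pose K := c * (c / t) `^ gam.
have K0 : 0 <= K by rewrite mulr_ge0// powR_ge0.
exists ((4 * (K + 1))^-1) => [|S r rho S0 S1 r0 h0].
  by rewrite invr_gt0 mulr_gt0// ltr_wpDl.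
have E : r ^+ (2 * m) = r * r ^+ (2 * m - 1).
  by rewrite -exprS subn1 prednK// muln_gt0.
have [H|/ltW H] := leP (c * rho) (t * r ^+ (2 * m - 1)).
  apply: (@le_trans _ _ (t * S * r ^+ (2 * m))); last first.
    by rewrite lerDl divr_ge0// powR_ge0.
  rewrite E (_ : c * S * r * rho = S * r * (c * rho)); last by ring.
  rewrite (_ : t * S * _ = S * r * (t * r ^+ (2 * m - 1))); last by ring.
  by rewrite ler_wpM2l// mulr_ge0.
apply: (@le_trans _ _ (rho `^ alpha R m / 4)); last first.
  by rewrite lerDr !mulr_ge0// ?exprn_ge0// ltW.
have rle : r <= (c / t) `^ gam * rho `^ gam.
  rewrite -powRM ?divr_ge0 ?(ltW t0)//; apply: le_root => //.
  by rewrite mulrAC ler_pdivlMr// mulrC.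
rewrite powR_alpha//.
apply: (@le_trans _ _ (S * K * (rho * rho `^ gam))).
  rewrite (_ : c * S * r * rho = (c * S * rho) * r); last by ring.
  rewrite (_ : S * K * _ = (c * S * rho) * ((c / t) `^ gam * rho `^ gam)).
    by rewrite ler_wpM2l// !mulr_ge0.
  by rewrite /K; ring.
rewrite [leRHS]mulrC ler_wpM2r ?mulr_ge0 ?powR_ge0//.
apply: (@le_trans _ _ ((4 * (K + 1))^-1 * (K + 1))).
  by apply: ler_pM => //; rewrite lerDl.
by rewrite invfM -mulrA mulVf ?mulr1// gt_eqF// ltr_wpDl.
Qed.

(** The rotated integrand grows at the rate [sin th] in space and decays at the
    rate [sin (2m th)] in frequency; small angles make the growth negligible without
    exceeding the decay. *)
Lemma choose_angle (S0 : R) : 0 < S0 -> exists th, [/\ admissible m th,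
  0 < sin th, sin th <= S0 & sin th <= sin ((2 * m)%:R * th)].
Proof.
move=> S00; have pi0 := pi_gt0 R.
have q0 : 0 < pi / (4 * m)%:R :> R by rewrite divr_gt0// ltr0n muln_gt0.
pose th := Num.min S0 (pi / (4 * m)%:R / 2).
have th0 : 0 < th by rewrite lt_min S00 divr_gt0.
have th1 : th < pi / (4 * m)%:R.
  by rewrite gt_min; apply/orP; right; rewrite ltr_pdivrMr// ltr_pMr// ltr1n.
have thm : (2 * m)%:R * th < pi / 2.
  move: th1; rewrite ltr_pdivlMr ?ltr0n ?muln_gt0// (_ : (4 * m)%:R = 2 * (2 * m)%:R).
    by move=> h; rewrite ltr_pdivlMr//; apply: le_lt_trans h; nra.
  by rewrite -natrM mulnA.
have thle : th <= (2 * m)%:R * th.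
  by rewrite ler_peMl ?(ltW th0)// ler1n muln_gt0.
exists th; split.
- by rewrite /admissible th0.
- by apply: sin_gt0_pi; rewrite th0; lra.
- apply: (@le_trans _ _ th); last by rewrite ge_min lexx.
  apply: (@le_of_le_derive R (@sin R) id (@cos R) (fun=> 1)) => //.
  + exact: ltW.
  + by rewrite sin0.
- set p := ((2 * m)%:R * th + th) / 2; set q := ((2 * m)%:R * th - th) / 2.
  have -> : (2 * m)%:R * th = p + q by rewrite /p /q; field.
  have -> : sin th = sin (p - q) by congr sin; rewrite /p /q; field.
  rewrite sinB sinD -subr_ge0 (_ : _ - _ = 2 * (cos p * sin q)); last by ring.
  rewrite mulr_ge0// mulr_ge0//.
    by apply: cos_ge0_pihalf; apply/andP; split; rewrite /p; lra.
  by apply: sin_ge0_pi; apply/andP; split; rewrite /q; lra.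
Qed.

Section Data.
Variables (N : nat) (u0 : 'rV[R]_N -> R[i]).
Hypothesis u0_L2 : in_L2_rho_star m u0.
Local Notation mu := (lebesgueN R N).
Local Notation U := (fun s => u0 (vec s)).

Lemma Cmeas_data : Cmeas U.
Proof. by case: u0_L2. Qed.

(** Cauchy-Schwarz against [exp (- |s| ^ alpha / 2)], in the pointwise form
    [2 x y <= x ^ 2 + y ^ 2]. *)
Lemma Rintegrable_data :
  Rintegrable mu (fun s => normc (U s) * expR (enorm (vec s) `^ alpha R m / 4)).
Proof.
pose g (r : R) := r `^ alpha R m.
have mg : measurable_fun setT (fun s : N.-tuple (measurableTypeR R) => g (enorm (vec s))).
  by apply: measurable_vec_fun; exact: measurable_powR.
have mU : measurable_fun setT (fun s => normc (U s)).
  exact: measurable_normc Cmeas_data.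
have i1 : Rintegrable mu (fun s => rho_star m (vec s) * normc (U s) ^+ 2).
  apply/integrableP; split.
    apply/measurable_EFinP/measurable_funM; last exact: measurable_funX.
    exact: measurableT_comp mg.
  case: u0_L2 => _ _; apply: le_lt_trans; rewrite le_eqVlt; apply/orP; left.
  apply/eqP; apply: eq_integral => s _ /=.
  by rewrite ger0_norm// mulr_ge0 ?expR_ge0// sqr_ge0.
have [C HC] := @line_le_powR N%:R 2^-1 ltac:(by rewrite invr_gt0).
have i2 : Rintegrable mu (fun s => expR ((fun r => - (g r / 2)) (enorm (vec s)))).
  apply: (@Rintegrable_exp_radial _ _ (fun r => - (g r / 2)) C).
    by apply: measurable_funN; apply: measurable_funM => //; exact: measurable_powR.
  by move=> r r0; have := HC _ r0; rewrite /g; lra.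
apply: (Rintegrable_dom _ (RintegrableZ 2^-1 (RintegrableD i1 i2))).
  apply: measurable_funM => //; apply: measurableT_comp => //.
  exact: measurable_funM.
move=> s; rewrite ger0_norm ?mulr_ge0 ?normc_ge0 ?expR_ge0//=.
rewrite /rho_star -/(g _); set x := normc _; set a := g _.
have -> : expR a = expR (a / 2) ^+ 2.
  by rewrite -expRM_natl; congr expR; field.
have -> : expR (- (a / 2)) = (expR (- (a / 4))) ^+ 2.
  by rewrite -expRM_natl; congr expR; field.
have -> : expR (a / 4) = expR (a / 2) * expR (- (a / 4)).
  by rewrite -expRD; congr expR; field.
have := sqr_ge0 (expR (a / 2) * x - expR (- (a / 4))); nra.
Qed.

Lemma Rintegrable_data_exp (a : R) :
  Rintegrable mu (fun s => normc (U s) * expR (a * enorm (vec s))).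
Proof.
have [C HC] := @line_le_powR a 4^-1 ltac:(by rewrite invr_gt0).
apply: (Rintegrable_dom _ (RintegrableZ (expR C) Rintegrable_data)).
  apply: measurable_funM; first exact: measurable_normc Cmeas_data.
  apply: (@measurable_vec_fun _ _ (fun r => expR (a * r))).
  by apply: measurableT_comp => //; exact: measurable_funM.
move=> s; rewrite ger0_norm ?mulr_ge0 ?normc_ge0 ?expR_ge0//.
rewrite [leRHS]mulrCA ler_wpM2l ?normc_ge0// -expRD ler_expR.
by apply: le_trans (HC _ (enorm_ge0 _)) _; rewrite [_^-1 * _]mulrC.
Qed.

End Data.
End Growth.

(** * The solution as an integral over frequencies *)

Section FrequencyIntegral.
Variables (R : realType) (m N : nat).
Hypothesis m_gt0 : (0 < m)%N.
Variable u0 : 'rV[R]_N -> R[i].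
Hypothesis u0_L2 : in_L2_rho_star m u0.
Variables (T th : R).
Hypotheses (T_gt0 : 0 < T) (th_adm : admissible m th).
Hypothesis sin_th_gt0 : 0 < sin th.
Hypothesis sin_th_le : sin th <= sin ((2 * m)%:R * th).
(* The angle is so small that the growth of the kernel is absorbed by the decay
   of the data. *)
Hypothesis growth : forall r rho : R, 0 <= r -> 0 <= rho ->
  N%:R * sin th * r * rho <= T / 8 * sin th * r ^+ (2 * m) + rho `^ alpha R m / 4.

Local Notation B := (measurableTypeR R).
Local Notation mu := (lebesgueN R N).
Local Notation U := (fun s => u0 (vec s)).
Implicit Types (s eta : N.-tuple B) (x y : 'rV[R]_N) (t : R).

Let S := sin th.
(** The coefficients of the phase of the kernel after the frequency variable [s]
    has been replaced by [exp (- i th) s]. *)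
Definition rot_freq : R[i] := 'i%C * expC (turn th).
Definition rot_decay : R[i] := 'i%C * expC ((2 * m)%:R * turn th).
Local Notation z := rot_freq.
Local Notation d := rot_decay.

Lemma Re_rot_freq : Re z = S.
Proof. by rewrite /rot_freq expC_turn1 ReM /= /S; ring. Qed.

Lemma Re_rot_decay : Re d = sin ((2 * m)%:R * th).
Proof. by rewrite /rot_decay expC_turn ReM /=; ring. Qed.

Lemma normc_rot_freq : normc z = 1.
Proof.
by rewrite /rot_freq Normc.normcM normc_expC_turn1 /= expr0n add0r expr1n sqrtr1 mulr1.
Qed.

Lemma normc_rot_decay : normc d = 1.
Proof.
by rewrite /rot_decay Normc.normcM normc_expC_turn /= expr0n add0r expr1n sqrtr1 mulr1.
Qed.

Lemma rot_freq_decay : 'i%C * (- z ^+ 2) ^+ m = d.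
Proof.
rewrite /rot_freq /rot_decay exprMn (_ : 'i%C ^+ 2 = -1); last exact: sqr_i.
by rewrite mulN1r opprK -exprM expCX.
Qed.

(** The Jacobian of the rotation and the normalization of the Fourier transform. *)
Definition rot_const : R[i] := ((2 * pi) ^- N)%:C * expC (N%:R * turn th).

Definition joint x t (p : N.-tuple B * N.-tuple B) : R[i] :=
  U p.1 * expC (phase m 0 z (t%:C * d) (x - vec p.1) p.2).

(** The Fourier transform of the solution at the time [T], along the rotated
    frequencies. *)
Definition profile eta : R[i] := Cint mu (fun s => joint 0 T (s, eta)).

Lemma Cmeas_joint x t : Cmeas (joint x t).
Proof.
apply: CmeasM.
  have [mU1 mU2] := Cmeas_data u0_L2.
  by split; [exact: (measurableT_comp mU1 measurable_fst)
            |exact: (measurableT_comp mU2 measurable_fst)].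
have v1 : vmeas (fun p : N.-tuple B * N.-tuple B => x - vec p.1).
  move=> i; under eq_fun do rewrite !mxE.
  apply: measurable_funB => //.
  exact: (measurableT_comp (measurable_tnth i) measurable_fst).
have v2 : vmeas (fun p : N.-tuple B * N.-tuple B => vec p.2).
  move=> i; under eq_fun do rewrite !mxE.
  exact: (measurableT_comp (measurable_tnth i) measurable_snd).
have mr := measurable_enorm v2.
apply: Cmeas_expC; apply: CmeasD; first apply: CmeasD.
- apply: CmeasN; apply: CmeasM; first exact: Cmeas_cst.
  by apply: Cmeas_real; exact: measurable_funX.
- apply: CmeasM; first exact: Cmeas_cst.
  by apply: Cmeas_real; exact: measurable_dot.
- apply: CmeasN; apply: CmeasM; first exact: Cmeas_cst.
  by apply: Cmeas_real; exact: measurable_funX.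
Qed.

Let g1 s : R := normc (U s) * expR (enorm (vec s) `^ alpha R m / 4).
Let g2 x eta : R := expR (0 + (S * N%:R * enorm x) * enorm (vec eta)
  - (3 / 8 * T * S) * enorm (vec eta) ^+ (2 * m)).

Let int_g1 : Rintegrable mu g1.
Proof. exact: Rintegrable_data. Qed.

Let S_gt0 : 0 < S. Proof. exact: sin_th_gt0. Qed.

Let int_g2 x : Rintegrable mu (g2 x).
Proof. by apply: Rintegrable_pow => //; rewrite !mulr_gt0// invr_gt0. Qed.

(** The hypothesis [growth] separates the space variable from the frequency; it
    costs [T / 8] of the available decay [t >= T / 2]. *)
Let joint_le x t s eta : T / 2 <= t ->
  normc (joint x t (s, eta)) <= g1 s * g2 x eta.
Proof.
move=> tT.
have -> : joint x t (s, eta) =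
  U s * expC (phase m 0 z (t%:C * d) (x - vec s) eta) by [].
rewrite Normc.normcM normc_expC /g1 /g2 -[leRHS]mulrA.
rewrite ler_wpM2l ?normc_ge0// -expRD ler_expR.
rewrite /phase mul0r oppr0 add0r ReD ReN 2!Re_Mreal Re_realM Re_rot_freq Re_rot_decay.
set r := enorm (vec eta); have r0 : 0 <= r := enorm_ge0 _.
set P := r ^+ (2 * m); have P0 : 0 <= P by rewrite exprn_ge0.
have H := growth r0 (enorm_ge0 (vec s)).
have H1 : S * dot (vec eta) (x - vec s) <=
    S * (N%:R * (r * enorm x)) + S * (N%:R * (r * enorm (vec s))).
  rewrite -mulrDr ler_wpM2l ?(ltW S_gt0)// dotDr dotNr.
  have := dot_le (vec eta) x; have := dot_le (vec eta) (vec s).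
  by rewrite -/r !ler_norml => /andP[h1 h2] /andP[h3 h4]; lra.
have H2 : T / 2 * S * P <= t * sin ((2 * m)%:R * th) * P.
  by rewrite ler_wpM2r// ler_pM// ?ltW// divr_gt0.
move: H H1 H2; rewrite -/P -/S; set ra := _ `^ _; lra.
Qed.

Lemma Cintegrable_joint2 x t eta : T / 2 <= t ->
  Cintegrable mu (fun s => joint x t (s, eta)).
Proof.
move=> tT; apply: (@Cintegrable_pair2 _ _ _ _ _ _ _ g1 (g2 x) (Cmeas_joint x t) int_g1) => a b.
exact: joint_le.
Qed.

Let T2 : T / 2 <= T.
Proof. by rewrite ler_pdivrMr// ler_pMr// ler1n. Qed.

Lemma Cmeas_profile : Cmeas profile.
Proof. by apply: (Cmeas_Cint2 (Cmeas_joint 0 T) int_g1 (int_g2 0)) => a b; exact: joint_le. Qed.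

Lemma profile_decay : exists2 I1 : R, 0 <= I1 & forall eta,
  normc (profile eta) <= I1 * expR (- (3 / 8 * T * S) * enorm (vec eta) ^+ (2 * m)).
Proof.
exists (\int[mu]_s g1 s).
  by apply: Rintegral_ge0 => s _; rewrite mulr_ge0 ?normc_ge0 ?expR_ge0.
move=> eta; rewrite -RintegralZr//.
apply: normc_Cint; first exact: Cintegrable_joint2.
  by under eq_fun do rewrite mulrC; exact: RintegrableZ.
move=> s; apply: le_trans (joint_le _ _ _ T2) _; rewrite /g2.
rewrite (_ : enorm (0 : 'rV[R]_N) = 0); last first.
  by rewrite -(scale0r 0) enormZ normr0 mul0r.
by rewrite mulr0 mul0r add0r add0r mulNr.
Qed.

(** Fubini's theorem exchanges the space and frequency integrals; the evolution
    from [T] back to [t] acts on the frequency side by an exponential factor. *)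
Lemma solutionE x t : T / 2 <= t -> solution m u0 x t = rot_const *
  Cint mu (fun eta => expC (z * (dot (vec eta) x)%:C +
    (T - t)%:C * (d * (enorm (vec eta) ^+ (2 * m))%:C)) * profile eta).
Proof.
move=> tT; have t0 : 0 < t by apply: lt_le_trans tT; rewrite divr_gt0.
have E s : (t `^ (- (N%:R / (2 * m)%:R)))%:C *
    (kernelF m (t `^ (- (2 * m)%:R^-1) *: (x - vec s)) * U s) =
    rot_const * Cint mu (fun eta => joint x t (s, eta)).
  have iP : Cintegrable mu (fun eta => expC (phase m 0 z (t%:C * d) (x - vec s) eta)).
    apply: Cintegrable_pow => //; rewrite Re_realM Re_rot_decay mulr_gt0//.
    exact: lt_le_trans sin_th_gt0 sin_th_le.
  rewrite -[Cint _ _]/(Cint mu (fun eta => U s *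
    expC (phase m 0 z (t%:C * d) (x - vec s) eta))) (CintZ (U s) iP).
  rewrite mulrA (kernelF_scaled m_gt0 _ t0 th_adm) /rot_const /kernelJ -/z -/d.
  ring.
have c0 : (t `^ (- (N%:R / (2 * m)%:R)))%:C != 0 :> R[i].
  by apply/eqP => -[h]; have := powR_gt0 (- (N%:R / (2 * m)%:R)) t0; rewrite h ltxx.
have iJ0 : Cintegrable mu (fun s => Cint mu (fun eta => joint x t (s, eta))).
  by apply: (Cintegrable_Cint1 (Cmeas_joint x t) int_g1 (int_g2 x)) => a b; exact: joint_le.
have iJ := CintegrableZ rot_const iJ0.
have iK : Cintegrable mu
    (fun s => kernelF m (t `^ (- (2 * m)%:R^-1) *: (x - vec s)) * U s).
  have := CintegrableZ (t `^ (- (N%:R / (2 * m)%:R)))%:C^-1 iJ.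
  by under eq_fun do rewrite -E mulKf//.
transitivity (Cint mu (fun s => rot_const * Cint mu (fun eta => joint x t (s, eta)))).
  rewrite /solution -[integralC _]/(Cint mu _) -CintZ//; congr Cint.
  by apply/funext => s; exact: E.
apply: (etrans (CintZ rot_const iJ0)).
apply: (congr1 (fun v : R[i] => rot_const * v)).
rewrite (Cint_Fubini (Cmeas_joint x t) int_g1 (int_g2 x)); last first.
  by move=> a b; exact: joint_le.
congr Cint; apply/funext => eta.
rewrite /profile -CintZ; last exact: Cintegrable_joint2.
congr Cint; apply/funext => s; rewrite /joint /= [RHS]mulrCA; congr (_ * _).
rewrite -expCD; congr expC; rewrite /phase dotDr sub0r raddfD /= raddfB /=; ring.
Qed.

End FrequencyIntegral.

(** * Expansion of the integrand *)

Section Expansion.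
Variables (R : realType) (M : nat).
Hypothesis M_gt0 : (0 < M)%N.
Implicit Types (A D a b : R[i]) (sg kap q : R).

(** The coefficient of [sg ^ k] in [exp (sg A + sg ^ M D)]. *)
Definition mixed_coef k A D : R[i] :=
  \sum_(j < (k %/ M).+1) ((j`!%:R)^-1 * D ^+ j) * (((k - M * j)`!%:R)^-1 * A ^+ (k - M * j)).

(** A power [b ^ j], with [b = sg ^ M D], already has degree [M j] in [sg], so the
    other factor is truncated at the order [n - M j]: exactly the terms of total degree
    less than [n] remain. *)
Let double_trunc n a b : R[i] :=
  \sum_(j < (n.-1 %/ M).+1) ((j`!%:R)^-1 * b ^+ j) * exp_trunc (n - M * j) a.

Let double_truncE l sg A D :
  double_trunc l.+1 (sg%:C * A) ((sg ^+ M)%:C * D) =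
  \sum_(k < l.+1) (sg ^+ k)%:C * mixed_coef k A D.
Proof.
pose F j k : R[i] := (sg ^+ k)%:C *
  (((j`!%:R)^-1 * D ^+ j) * (((k - M * j)`!%:R)^-1 * A ^+ (k - M * j))).
transitivity (\sum_(j < (l %/ M).+1) \sum_(k < l.+1 | (M * j <= k)%N) F j k).
  apply: eq_bigr => j _; rewrite /exp_trunc mulr_sumr /=.
  rewrite -(big_mkord xpredT (fun i =>
    ((j`!%:R)^-1 * ((sg ^+ M)%:C * D) ^+ j) * ((i`!%:R)^-1 * (sg%:C * A) ^+ i))).
  rewrite -(big_mkord (fun k => (M * j <= k)%N) (F j)).
  have Mj : (M * j <= l)%N by rewrite mulnC -leq_divRL// -ltnS.
  rewrite [RHS](@big_cat_nat _ _ _ (M * j)) ?(leq_trans Mj)//= [X in X + _]big_nat_cond.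
  rewrite [X in X + _]big_pred0 ?add0r => [|k]; last first.
    by apply/negbTE/negP => /andP[/andP[_ h1] h2]; move: (leq_trans h1 h2); rewrite ltnn.
  rewrite -{2}[(M * j)%N]add0n big_addn big_nat_cond [RHS]big_nat_cond.
  apply: eq_big => [k|k _]; first by rewrite leq_addl.
  rewrite /F addnK 2!exprMn -!rmorphXn -exprM exprD mulnC rmorphM /=; ring.
rewrite (exchange_big_dep xpredT)//=; apply: eq_bigr => k _.
rewrite /mixed_coef mulr_sumr.
rewrite -(big_mkord (fun j => (M * j <= k)%N) (fun j => F j k)).
rewrite -(big_mkord xpredT (fun j => F j k)).
have kl : ((k %/ M).+1 <= (l %/ M).+1)%N by rewrite ltnS leq_div2r// -ltnS.
rewrite (@big_cat_nat _ _ _ (k %/ M).+1)//= [X in _ + X]big_nat_cond.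
rewrite [X in _ + X]big_pred0 ?addr0 => [|j]; last first.
  rewrite mulnC -leq_divRL//; apply/negbTE; rewrite negb_and negb_and -!leqNgt.
  by case: (j <= k %/ M)%N; rewrite ?orbT.
rewrite big_nat_cond [RHS]big_nat_cond; apply: eq_bigl => j.
by rewrite mulnC -leq_divRL// ltnS; case: (j <= _)%N.
Qed.

(** Both exponentials are expanded from a fixed scale [kap], with the small
    parameter [sg / kap]; the scale controls the exponential growth of the bound. *)
Lemma mixed_expansion l sg kap A D : 0 <= sg -> sg <= kap -> 0 < kap ->
  normc (expC (sg%:C * A + (sg ^+ M)%:C * D)
         - \sum_(k < l.+1) (sg ^+ k)%:C * mixed_coef k A D) <=
  (2 / kap ^+ l.+1) * sg ^+ l.+1 * expR (kap * normc A + kap ^+ M * normc D).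
Proof.
move=> s0 sk k0; pose q := sg / kap; pose n := l.+1.
have q0 : 0 <= q by rewrite divr_ge0// ltW.
have q1 : q <= 1 by rewrite ler_pdivrMr// mul1r.
have q01 : 0 <= q <= 1 by rewrite q0.
have kge0 : 0 <= kap := ltW k0.
have sE : sg = q * kap by rewrite /q mulfVK ?gt_eqF.
set a := kap%:C * A; set b := (kap ^+ M)%:C * D.
have aE : sg%:C * A = q%:C * a by rewrite sE rmorphM -mulrA.
have bE : (sg ^+ M)%:C * D = (q ^+ M)%:C * b by rewrite sE exprMn rmorphM -mulrA.
have na : normc a = kap * normc A by rewrite Normc.normcM normc_real ger0_norm.
have nb : normc b = kap ^+ M * normc D.
  by rewrite Normc.normcM normc_real ger0_norm// exprn_ge0.
rewrite -double_truncE aE bE -na -nb expRD expCD /double_trunc /= -/n.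
have qM01 : 0 <= q ^+ M <= 1 by rewrite exprn_ge0// exprn_ile1.
set J := (l %/ M).+1.
pose tb : R[i] := exp_trunc J ((q ^+ M)%:C * b).
have nqa : normc (expC (q%:C * a)) <= expR (normc a).
  rewrite normc_expC ler_expR Re_realM.
  apply: le_trans (ler_norm _) _; rewrite normrM (ger0_norm q0).
  by apply: le_trans (ler_piMl _ q1) (normc_Re a).
have n1 : normc (expC (q%:C * a) * (expC ((q ^+ M)%:C * b) - tb)) <=
    q ^+ n * (expR (normc a) * expR (normc b)).
  rewrite Normc.normcM [leRHS]mulrCA; apply: ler_pM => //; rewrite ?normc_ge0//.
  apply: le_trans (expC_taylor _ _ qM01) _; rewrite ler_wpM2r ?expR_ge0//.
  rewrite -exprM; apply: ler_wiXn2l => //.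
  by rewrite /n /J mulnC ltn_ceil.
have n2 : normc (\sum_(j < J) ((j`!%:R)^-1 * ((q ^+ M)%:C * b) ^+ j) *
      (expC (q%:C * a) - exp_trunc (n - M * j) (q%:C * a))) <=
    q ^+ n * (expR (normc a) * expR (normc b)).
  apply: le_trans (normc_sum _ _ _) _.
  apply: (@le_trans _ _ (\sum_(j < J)
     (q ^+ n * expR (normc a)) * ((j`!%:R)^-1 * normc b ^+ j))).
    apply: ler_sum => j _.
    have Mj : (M * j <= n)%N.
      by rewrite ltnW// ltnS mulnC -leq_divRL// -ltnS.
    have T1 := @expC_taylor R (n - M * j) q a q01.
    rewrite Normc.normcM Normc.normcM Normc.normcV normc_nat normcX Normc.normcM normc_real.
    rewrite (ger0_norm (exprn_ge0 _ q0)) exprMn -exprM.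
    have -> : q ^+ n = q ^+ (M * j) * q ^+ (n - M * j) by rewrite -exprD subnKC.
    set x := j`!%:R^-1; set y := q ^+ (M * j); set w := normc b ^+ j.
    rewrite (_ : y * _ * _ * _ = (x * (y * w)) * (q ^+ (n - M * j) * expR (normc a))).
      by rewrite ler_wpM2l// !mulr_ge0// ?exprn_ge0 ?normc_ge0// invr_ge0 ler0n.
    ring.
  rewrite -mulr_sumr (mulrA (q ^+ n)) ler_wpM2l ?mulr_ge0 ?exprn_ge0 ?expR_ge0//.
  have h0 := normc_ge0 b; apply: le_trans (le_trans (normc_Re _) _).
    2: by rewrite -[X in expR X](ger0_norm h0) -normc_real; exact: (normc_exp_trunc J).
  rewrite /exp_trunc Re_sum; apply: le_trans (ler_norm _); apply: ler_sum => j _.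
  by rewrite -rmorphXn -(rmorph_nat (real_complex R)) -fmorphV -rmorphM.
rewrite (_ : _ - _ = expC (q%:C * a) * (expC ((q ^+ M)%:C * b) - tb) +
   \sum_(j < J) ((j`!%:R)^-1 * ((q ^+ M)%:C * b) ^+ j) *
      (expC (q%:C * a) - exp_trunc (n - M * j) (q%:C * a))).
  apply: le_trans (normcD _ _) _; apply: le_trans (lerD n1 n2) _.
  rewrite le_eqVlt; apply/orP; left; apply/eqP.
  rewrite /q expr_div_n; ring.
rewrite (eq_bigr _ (fun j _ => mulrBr _ _ _)) sumrB -mulr_suml -/tb.
rewrite /tb /exp_trunc; ring.
Qed.

End Expansion.

(** * Homogeneous expansion of a frequency integral *)

Section MomentExpansion.
Variables (R : realType) (N m : nat).
Hypothesis m_gt0 : (0 < m)%N.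
Variables (z d : R[i]).
Hypotheses (z_norm : normc z = 1) (d_norm : normc d = 1).
Hypothesis zd : 'i%C * (- z ^+ 2) ^+ m = d.
Local Notation B := (measurableTypeR R).
Local Notation mu := (lebesgueN R N).
Local Notation r := (fun s => enorm (vec s)).
Implicit Types (s eta : N.-tuple B) (y : 'rV[R]_N) (b : multinom N).
Variables (w : N.-tuple B -> R[i]) (I1 c : R).
Hypotheses (mw : Cmeas w) (I1_ge0 : 0 <= I1) (c_gt0 : 0 < c).
Hypothesis w_le : forall eta, normc (w eta) <= I1 * expR (- c * r eta ^+ (2 * m)).

Let Rintegrable_bound (A : R) :
  Rintegrable mu (fun eta => expR (A * r eta + c / 2 * r eta ^+ (2 * m)) * normc (w eta)).
Proof.
have c2 : 0 < c / 2 by rewrite divr_gt0.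
apply: (Rintegrable_dom _ (RintegrableZ I1 (@Rintegrable_pow R N m m_gt0 0 A _ c2))).
  apply: measurable_funM; last exact: measurable_normc.
  apply: (@measurable_vec_fun _ _ (fun r => expR (A * r + c / 2 * r ^+ (2 * m)))).
  apply: measurableT_comp => //; apply: measurable_funD; exact: measurable_funM.
move=> eta; rewrite ger0_norm ?mulr_ge0 ?expR_ge0 ?normc_ge0//.
apply: le_trans (ler_wpM2l (expR_ge0 _) (w_le eta)) _.
rewrite mulrCA ler_wpM2l// -expRD ler_expR.
by set P := _ ^+ (2 * m); lra.
Qed.

Lemma Cintegrable_weighted (f : N.-tuple B -> R[i]) (K A : R) : Cmeas f ->
  (forall eta, normc (f eta) <= K * expR (A * r eta + c / 2 * r eta ^+ (2 * m))) ->
  Cintegrable mu (fun eta => f eta * w eta).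
Proof.
move=> mf fK.
apply: (Cintegrable_dom (CmeasM mf mw) (RintegrableZ K (Rintegrable_bound A))) => eta.
by rewrite Normc.normcM mulrA ler_wpM2r ?normc_ge0.
Qed.

(** [(z s) ^ b / b!] *)
Definition freq_monomial b eta : R[i] := divpow (fun i => z * (vec eta 0 i)%:C) b.

Lemma Cmeas_freq_monomial b : Cmeas (freq_monomial b).
Proof.
rewrite /freq_monomial /divpow; apply: Cmeas_prod => i _.
apply: CmeasM; last exact: Cmeas_cst.
apply: CmeasX; apply: CmeasM; first exact: Cmeas_cst.
by apply: Cmeas_real; exact: vmeas_vec.
Qed.

Lemma normc_freq_monomial b eta : normc (freq_monomial b eta) <= r eta ^+ mdeg b.
Proof.
rewrite /freq_monomial /divpow mdegE.
elim/big_rec2: _ => [|i k p _ IH]; first by rewrite Normc.normc1.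
rewrite exprD Normc.normcM ler_pM ?normc_ge0// Normc.normcM normcX Normc.normcM.
rewrite z_norm mul1r normc_real Normc.normcV.
rewrite normc_nat.
rewrite -[leRHS]mulr1 ler_pM ?invr_ge0 ?exprn_ge0 ?ler0n//.
  by apply: lerXn2r; rewrite ?nnegrE ?enorm_ge0// enorm_coord.
by rewrite invf_le1 ?ltr0n ?fact_gt0// ler1n fact_gt0.
Qed.

Lemma Cintegrable_freq b : Cintegrable mu (fun eta => freq_monomial b eta * w eta).
Proof.
apply: (@Cintegrable_weighted _ ((mdeg b)%:R ^+ mdeg b) 1).
  exact: Cmeas_freq_monomial.
move=> eta; apply: le_trans (normc_freq_monomial _ _) _.
apply: le_trans (pow_le_expR _ (enorm_ge0 _)) _.
rewrite ler_wpM2l ?exprn_ge0// ler_expR mul1r lerDl.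
by rewrite mulr_ge0 ?exprn_ge0 ?enorm_ge0// ltW// divr_gt0.
Qed.

Definition freq_moment b : R[i] := Cint mu (fun eta => freq_monomial b eta * w eta).

(** The part of degree [k] of the expansion of the solution at its zero. *)
Definition profile_part k y : R[i] :=
  \sum_(b : bmultinom N k.+1 | mdeg (bmnm b) == k)
    freq_moment (bmnm b) * evalp (hermite R m (bmnm b)) y.

Let dotE eta y : \sum_(i < N) z * (vec eta 0 i)%:C * (y 0 i)%:C = z * (dot (vec eta) y)%:C.
Proof.
rewrite /dot rmorph_sum mulr_sumr; apply: eq_bigr => i _.
by rewrite rmorphM mulrA.
Qed.

(** The generating function of the Hermite polynomials at the complex frequency
    [z s]: by the choice of [d], the exponent of its evolution is [d |s| ^ 2m]. *)
Lemma mixed_coef_hermite k eta y :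
  mixed_coef (2 * m) k (z * (dot (vec eta) y)%:C) (d * (r eta ^+ (2 * m))%:C) =
  \sum_(b : bmultinom N k.+1 | mdeg (bmnm b) == k)
    freq_monomial (bmnm b) eta * evalp (hermite R m (bmnm b)) y.
Proof.
pose z' i : R[i] := z * (vec eta 0 i)%:C.
have := congr1 (fun p => evalp p y) (hermite_generating m z' k).
rewrite evalp_sum evalp_sum => H.
rewrite (eq_bigr (fun b : bmultinom N k.+1 =>
  evalp (divpow z' (bmnm b) *: hermite R m (bmnm b)) y)); last first.
  by move=> b _; rewrite evalpZ.
rewrite H /mixed_coef; apply: eq_bigr => j _; rewrite evalpZ evalp_linpow dotE.
congr (_ * _ * _); congr (_ ^+ _).
have -> : sqnorm z' = z ^+ 2 * (r eta ^+ 2)%:C.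
  rewrite enorm_sqr /dot rmorph_sum mulr_sumr; apply: eq_bigr => i _.
  by rewrite /z' rmorphM -expr2 exprMn.
by rewrite -mulNr exprMn -rmorphXn -exprM mulrA -zd.
Qed.

Lemma Cint_mixed_coef k y :
  Cintegrable mu (fun eta => mixed_coef (2 * m) k (z * (dot (vec eta) y)%:C)
    (d * (r eta ^+ (2 * m))%:C) * w eta) /\
  Cint mu (fun eta => mixed_coef (2 * m) k (z * (dot (vec eta) y)%:C)
    (d * (r eta ^+ (2 * m))%:C) * w eta) = profile_part k y.
Proof.
have E : (fun eta => mixed_coef (2 * m) k (z * (dot (vec eta) y)%:C)
      (d * (r eta ^+ (2 * m))%:C) * w eta) =
    (fun eta => \sum_(b : bmultinom N k.+1 | mdeg (bmnm b) == k)
      evalp (hermite R m (bmnm b)) y * (freq_monomial (bmnm b) eta * w eta)).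
  apply/funext => eta; rewrite mixed_coef_hermite mulr_suml.
  by apply: eq_bigr => b _; rewrite mulrAC mulrC.
have I (b : bmultinom N k.+1) := CintegrableZ (evalp (hermite R m (bmnm b)) y)
  (Cintegrable_freq (bmnm b)).
rewrite E; split; first by apply: Cintegrable_sum.
rewrite Cint_sum//; apply: eq_bigr => b _.
by rewrite (CintZ _ (Cintegrable_freq (bmnm b))) mulrC.
Qed.

Lemma Cmeas_dot_freq (a : R[i]) y : Cmeas (fun eta => a * (dot (vec eta) y)%:C).
Proof.
apply: CmeasM; first exact: Cmeas_cst.
by apply: Cmeas_real; apply: measurable_dot; [exact: vmeas_vec|exact: vmeas_cst].
Qed.

Lemma Cmeas_pow_freq (a : R[i]) : Cmeas (fun eta => a * (r eta ^+ (2 * m))%:C).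
Proof.
apply: CmeasM; first exact: Cmeas_cst.
by apply: Cmeas_real; apply: measurable_funX; apply: measurable_enorm; exact: vmeas_vec.
Qed.

(** Up to a constant factor, the solution at the point [sg y] and the time
    [T - sg ^ 2m]. *)
Definition evolved sg y : R[i] := Cint mu (fun eta =>
  expC (z * (dot (vec eta) (sg *: y))%:C +
    (sg ^+ (2 * m))%:C * (d * (r eta ^+ (2 * m))%:C)) * w eta).

(** The scale [kap] is such that the growth of the remainder consumes only half of
    the decay of [w]. *)
Lemma evolved_expansion l (Y kap : R) : 0 <= Y -> 0 < kap -> kap ^+ (2 * m) <= c / 2 ->
  exists2 C : R, 0 <= C & forall sg y, 0 <= sg -> sg <= kap -> enorm y <= Y ->
  normc (evolved sg y - \sum_(k < l.+1) (sg ^+ k)%:C * profile_part k y) <=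
  C * sg ^+ l.+1.
Proof.
move=> Y0 k0 kc; pose A : R := kap * N%:R * Y.
have K0 : 0 <= 2 / kap ^+ l.+1 by rewrite divr_ge0// exprn_ge0// ltW.
exists (2 / kap ^+ l.+1 * \int[mu]_eta
    (expR (A * r eta + c / 2 * r eta ^+ (2 * m)) * normc (w eta))).
  rewrite mulr_ge0//; apply: Rintegral_ge0 => eta _.
  by rewrite mulr_ge0 ?expR_ge0 ?normc_ge0.
move=> sg y s0 sk yY.
pose e eta := expC (z * (dot (vec eta) (sg *: y))%:C +
    (sg ^+ (2 * m))%:C * (d * (r eta ^+ (2 * m))%:C)).
pose S eta := \sum_(k < l.+1) (sg ^+ k)%:C * mixed_coef (2 * m) k
  (z * (dot (vec eta) y)%:C) (d * (r eta ^+ (2 * m))%:C).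
have eE eta : normc (e eta - S eta) <= 2 / kap ^+ l.+1 * sg ^+ l.+1 *
    expR (A * r eta + c / 2 * r eta ^+ (2 * m)).
  have M0 : (0 < 2 * m)%N by rewrite muln_gt0.
  rewrite /e /S dotZr rmorphM [z * (_ * _)]mulrCA.
  apply: le_trans (mixed_expansion M0 l _ _ s0 sk k0) _.
  apply: ler_wpM2l; first by rewrite mulr_ge0// exprn_ge0.
  rewrite ler_expR lerD//.
    rewrite Normc.normcM z_norm mul1r normc_real /A.
    rewrite (_ : _ * _ * _ * _ = kap * (N%:R * (r eta * Y))); last by ring.
    rewrite ler_wpM2l ?(ltW k0)//; apply: le_trans (dot_le _ _) _.
    by rewrite ler_wpM2l// ler_wpM2l// enorm_ge0.
  rewrite Normc.normcM d_norm mul1r normc_real ger0_norm ?exprn_ge0 ?enorm_ge0//.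
  by rewrite ler_wpM2r// exprn_ge0 ?enorm_ge0.
have iS : Cintegrable mu (fun eta => S eta * w eta).
  rewrite /S; under eq_fun do rewrite mulr_suml.
  apply: Cintegrable_sum => k _; under eq_fun do rewrite -mulrA.
  by apply: CintegrableZ; case: (Cint_mixed_coef k y).
have SE : Cint mu (fun eta => S eta * w eta) =
    \sum_(k < l.+1) (sg ^+ k)%:C * profile_part k y.
  have -> : (fun eta => S eta * w eta) = (fun eta => \sum_(k < l.+1) (sg ^+ k)%:C *
      (mixed_coef (2 * m) k (z * (dot (vec eta) y)%:C) (d * (r eta ^+ (2 * m))%:C) * w eta)).
    apply/funext => eta; rewrite /S mulr_suml; apply: eq_bigr => k _; exact/esym/mulrA.
  rewrite Cint_sum => [|k _]; last by apply: CintegrableZ; case: (Cint_mixed_coef k y).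
  apply: eq_bigr => k _; have [i1 i2] := Cint_mixed_coef k y.
  by rewrite (CintZ _ i1) i2.
have me : Cmeas e.
  apply: Cmeas_expC; apply: CmeasD; first exact: Cmeas_dot_freq.
  by apply: CmeasM; [exact: Cmeas_cst|exact: Cmeas_pow_freq].
have mS : Cmeas S.
  apply: Cmeas_sum => k _; apply: CmeasM; first exact: Cmeas_cst.
  apply: Cmeas_sum => j _; apply: CmeasM; apply: CmeasM;
    by [exact: Cmeas_cst|apply: CmeasX; exact: Cmeas_pow_freq|
        apply: CmeasX; exact: Cmeas_dot_freq].
have ieS : Cintegrable mu (fun eta => (e eta - S eta) * w eta).
  by apply: (Cintegrable_weighted _ eE); apply: CmeasD => //; exact: CmeasN.
have ie : Cintegrable mu (fun eta => e eta * w eta).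
  have := CintegrableD ieS iS; congr Cintegrable.
  by apply/funext => eta; rewrite -mulrDl subrK.
rewrite -SE /evolved -[X in X - _]/(Cint mu (fun eta => e eta * w eta)) -(CintB ie iS).
under eq_fun do rewrite -mulrBl.
rewrite mulrAC -RintegralZl//; last exact: Rintegrable_bound.
apply: normc_Cint => //; first by apply: RintegrableZ; exact: Rintegrable_bound.
by move=> eta; rewrite Normc.normcM [leRHS]mulrA ler_wpM2r ?normc_ge0.
Qed.

(** The powers of a linear form are combinations of the monomials, so all moments
    of [w] vanish. *)
Lemma freq_moments_ae0 : (forall b, freq_moment b = 0) ->
  {ae mu, forall eta, w eta = 0}.
Proof.
move=> H; apply: moments_ae0 => // [a|y k].
  apply: (Rintegrable_dom _ (Rintegrable_bound a)).
    apply: measurable_funM; first exact: measurable_normc.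
    apply: (@measurable_vec_fun _ _ (fun r => expR (a * r))).
    by apply: measurableT_comp => //; exact: measurable_funM.
  move=> eta; rewrite ger0_norm ?mulr_ge0 ?normc_ge0 ?expR_ge0// mulrC.
  rewrite ler_wpM2r ?normc_ge0// ler_expR lerDl.
  by rewrite mulr_ge0 ?exprn_ge0 ?enorm_ge0// ltW// divr_gt0.
have z0 : z ^+ k != 0.
  apply: expf_neq0; apply/eqP => z0; move: z_norm; rewrite z0 Normc.normc0 => /eqP.
  by rewrite eq_sym oner_eq0.
have E eta : w eta * (dot y (vec eta) ^+ k)%:C = ((z ^+ k)^-1 * k`!%:R) *
    \sum_(b : bmultinom N k.+1 | mdeg (bmnm b) == k)
      evalp (mpolyX _ (bmnm b)) y * (freq_monomial (bmnm b) eta * w eta).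
  have := congr1 (fun p => evalp p y) (linpowE (fun i => z * (vec eta 0 i)%:C) k).
  rewrite evalp_sum evalp_linpow dotE => h.
  rewrite (eq_bigr (fun b : bmultinom N k.+1 => w eta *
    evalp (divpow (fun i => z * (vec eta 0 i)%:C) (bmnm b) *: mpolyX _ (bmnm b)) y)).
    rewrite -mulr_sumr -h dotC exprMn -rmorphXn.
    have f0 : k`!%:R != 0 :> R[i] by rewrite pnatr_eq0 -lt0n fact_gt0.
    by field; rewrite f0 z0.
  by move=> b _; rewrite evalpZ /freq_monomial; ring.
rewrite (funext E) CintZ; last first.
  by apply: Cintegrable_sum => b _; apply: CintegrableZ; exact: Cintegrable_freq.
rewrite Cint_sum => [|b _]; last by apply: CintegrableZ; exact: Cintegrable_freq.
rewrite big1 ?mulr0// => b _.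
by rewrite (CintZ _ (Cintegrable_freq _)) -/(freq_moment _) H mulr0.
Qed.

End MomentExpansion.

(** * Injectivity of the Laplace transform *)

Section LaplaceTransform.
Variables (R : realType) (N : nat).
Local Notation B := (measurableTypeR R).
Local Notation mu := (lebesgueN R N).
Variables (U : N.-tuple B -> R[i]) (v : R[i]).
Hypotheses (mU : Cmeas U) (v_norm : normc v = 1).
Hypothesis iU : forall a, Rintegrable mu (fun s => normc (U s) * expR (a * enorm (vec s))).
Implicit Types (s eta : N.-tuple B) (x y : 'rV[R]_N).

Definition laplace x : R[i] := Cint mu (fun s => U s * expC (v * (dot x (vec s))%:C)).

Let Cmeas_dot x : Cmeas (fun s : N.-tuple B => v * (dot x (vec s))%:C).
Proof.
apply: CmeasM; first exact: Cmeas_cst.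
by apply: Cmeas_real; apply: measurable_dot; [exact: vmeas_cst|exact: vmeas_vec].
Qed.

Let normc_vdot x s : normc (v * (dot x (vec s))%:C) = `|dot x (vec s)|.
Proof. by rewrite Normc.normcM v_norm mul1r normc_real. Qed.

Let Re_vdot_le x s : Re (v * (dot x (vec s))%:C) <= `|dot x (vec s)|.
Proof. by rewrite -normc_vdot; exact: le_trans (ler_norm _) (normc_Re _). Qed.

Let Cintegrable_weighted_data (f : N.-tuple B -> R[i]) (K a : R) : Cmeas f ->
  (forall s, normc (f s) <= K * expR (a * enorm (vec s))) ->
  Cintegrable mu (fun s => U s * f s).
Proof.
move=> mf fK; apply: (Cintegrable_dom (CmeasM mU mf) (RintegrableZ K (iU a))) => s.
by rewrite Normc.normcM [leRHS]mulrCA ler_wpM2l ?normc_ge0.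
Qed.

Let Cintegrable_laplace x : Cintegrable mu (fun s => U s * expC (v * (dot x (vec s))%:C)).
Proof.
apply: (@Cintegrable_weighted_data _ 1 (N%:R * enorm x)); first exact: Cmeas_expC.
move=> s; rewrite mul1r normc_expC ler_expR -mulrA.
exact: le_trans (Re_vdot_le _ _) (dot_le _ _).
Qed.

Let dotB_le x y (e : R) s : (forall i, `|y 0 i - x 0 i| <= e) ->
  `|dot y (vec s) - dot x (vec s)| <= e * (N%:R * enorm (vec s)).
Proof.
move=> H; rewrite /dot -sumrB; apply: le_trans (ler_norm_sum _ _ _) _.
apply: (@le_trans _ _ (\sum_(i < N) e * enorm (vec s))).
  apply: ler_sum => i _; rewrite -mulrBl normrM.
  by apply: ler_pM => //; exact: enorm_coord.
rewrite sumr_const card_ord -mulr_natr le_eqVlt; apply/orP; left; apply/eqP; ring.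
Qed.

Lemma laplace_lipschitz x : exists2 C : R, 0 <= C & forall y (e : R),
  e <= 1 -> (forall i, `|y 0 i - x 0 i| <= e) -> 0 <= e ->
  normc (laplace y - laplace x) <= C * e.
Proof.
pose a := N%:R * enorm x + N%:R + 1.
exists (N%:R * \int[mu]_s (normc (U s) * expR (a * enorm (vec s)))).
  rewrite mulr_ge0//; apply: Rintegral_ge0 => s _.
  by rewrite mulr_ge0 ?expR_ge0 ?normc_ge0.
move=> y e e1 H e0; rewrite /laplace -(CintB (Cintegrable_laplace y) (Cintegrable_laplace x)).
rewrite mulrAC -RintegralZl//; last exact: iU.
apply: normc_Cint.
- by apply: CintegrableD => //; exact: CintegrableN.
- exact: RintegrableZ.
move=> s; rewrite -mulrBr Normc.normcM [leRHS]mulrCA ler_wpM2l ?normc_ge0//.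
apply: le_trans (normc_expCB _ _) _.
set rr := enorm (vec s); have r0 : 0 <= rr := enorm_ge0 _.
have h1 := dotB_le s H; rewrite -/rr in h1.
have h2 : `|dot x (vec s)| <= N%:R * enorm x * rr by rewrite -mulrA dot_le.
have NR : 0 <= N%:R * rr by rewrite mulr_ge0.
have h3 : `|dot y (vec s)| <= (N%:R * enorm x + N%:R) * rr.
  have := ler_normD (dot y (vec s) - dot x (vec s)) (dot x (vec s)).
  rewrite subrK => h; apply: (le_trans h); rewrite mulrDl addrC lerD//.
  by apply: le_trans h1 _; rewrite ler_piMl.
have M : Num.max (expR (Re (v * (dot y (vec s))%:C))) (expR (Re (v * (dot x (vec s))%:C)))
    <= expR ((N%:R * enorm x + N%:R) * rr).
  rewrite ge_max !ler_expR (le_trans (Re_vdot_le _ _) h3)/=.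
  by apply: le_trans (Re_vdot_le _ _) (le_trans h2 _); rewrite mulrDl lerDl.
rewrite -mulrBr -rmorphB Normc.normcM v_norm mul1r normc_real.
apply: (@le_trans _ _ ((e * (N%:R * rr)) * expR ((N%:R * enorm x + N%:R) * rr))).
  by apply: ler_pM => //; rewrite le_max expR_ge0.
rewrite (_ : e * _ * _ = (N%:R * e) * (rr * expR ((N%:R * enorm x + N%:R) * rr))); last by ring.
rewrite ler_wpM2l ?mulr_ge0// /a [(_ + 1) * rr]mulrDl mul1r expRD [leRHS]mulrC.
by rewrite ler_wpM2r ?expR_ge0// le_expR.
Qed.

(** The transform is continuous, and boxes have positive measure. *)
Lemma laplace_eq0 : {ae mu, forall eta, laplace (vec eta) = 0} -> forall x, laplace x = 0.
Proof.
move=> H x; apply/eqP/negPn/negP => Vx.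
have V0 : 0 < normc (laplace x).
  by rewrite lt_def normc_ge0 andbT; apply: contraNneq Vx => /Normc.eq0_normc ->.
have [C C0 HC] := laplace_lipschitz x.
pose e := Num.min 1 (normc (laplace x) / (C + 1) / 2).
have C1 : 0 < C + 1 by rewrite ltr_wpDl.
have e0 : 0 < e by rewrite lt_min ltr01/= !divr_gt0.
have e1 : e <= 1 by rewrite ge_min lexx.
have Ce : C * e < normc (laplace x).
  apply: (@le_lt_trans _ _ ((C + 1) * (normc (laplace x) / (C + 1) / 2))).
    by apply: ler_pM => //; rewrite ?(ltW e0)// ?lerDl// ge_min lexx orbT.
  rewrite mulrA mulrCA mulfV ?gt_eqF// mulr1.
  by rewrite ltr_pdivrMr// ltr_pMr// ltr1n.
pose A (i : 'I_N) : set B := `[x 0 i - e, x 0 i + e]%classic.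
have mA i : measurable (A i) by exact: measurable_itv.
have mbox : measurable [set s : N.-tuple B | forall i, A i (tnth s i)].
  rewrite (_ : [set s | _] =
    \bigcap_(i in [set: 'I_N]) ((@tnth N B ^~ i) @^-1` A i)); last first.
    by apply/seteqP; split => s /= h i; [move=> _|]; exact: (h i).
  apply: fin_bigcap_measurable => [|i _]; first exact: finite_finset.
  by rewrite -[X in measurable X]setTI; exact: measurable_tnth.
have : mu [set s : N.-tuple B | forall i, A i (tnth s i)] = 0.
  apply/measure_negligible => //; apply: negligibleS H => s /= hs h0.
  have := HC (vec s) e e1; rewrite h0 sub0r normcNE => /(_ _ (ltW e0)) h.
  have : normc (laplace x) <= C * e.
    apply: h => i; rewrite mxE; have := hs i; rewrite /A/= in_itv/= => /andP[? ?].
    by rewrite ler_norml; apply/andP; split; lra.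
  by rewrite leNgt Ce.
rewrite lebesgueN_box// => /eqP; apply/negP; rewrite gt_eqF//.
elim/big_ind: _ => // [a b a0 b0|i _]; first exact: mule_gt0.
rewrite /A lebesgue_measure_itv/= lte_fin ifT; last by lra.
by rewrite -EFinB lte_fin; lra.
Qed.

Let Cmeas_pow x k : Cmeas (fun s : N.-tuple B => (v * (dot x (vec s))%:C) ^+ k).
Proof. exact: CmeasX. Qed.

Let Cintegrable_moment x k : Cintegrable mu (fun s => U s * (v * (dot x (vec s))%:C) ^+ k).
Proof.
apply: (@Cintegrable_weighted_data _ (k%:R ^+ k) (N%:R * enorm x)) => // s.
rewrite normcX normc_vdot; apply: le_trans (pow_le_expR _ (normr_ge0 _)) _.
by rewrite ler_wpM2l ?exprn_ge0// ler_expR -mulrA dot_le.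
Qed.

(** The moments of [U] are the Taylor coefficients at 0 of its Laplace transform
    along rays. *)
Lemma laplace_moments : (forall x, laplace x = 0) ->
  forall x k, Cint mu (fun s => U s * (v * (dot x (vec s))%:C) ^+ k) = 0.
Proof.
move=> V0 x; elim/ltn_ind => k IH.
pose Mk := Cint mu (fun s => U s * (v * (dot x (vec s))%:C) ^+ k).
pose f s := v * (dot x (vec s))%:C.
pose a := N%:R * enorm x.
pose C := \int[mu]_s (normc (U s) * expR (a * enorm (vec s))).
have f0 : k`!%:R != 0 :> R[i] by rewrite pnatr_eq0 -lt0n fact_gt0.
have f0R : 0 < k`!%:R :> R by rewrite ltr0n fact_gt0.
have H (t : R) : 0 < t -> t <= 1 -> normc Mk <= t * (k`!%:R * C).
  move=> t0 t1; have t01 : 0 <= t <= 1 by rewrite ltW.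
  have it j : Cintegrable mu (fun s => U s * ((j`!%:R)^-1 * (t%:C * f s) ^+ j)).
    have := CintegrableZ ((j`!%:R)^-1 * t%:C ^+ j) (Cintegrable_moment x j).
    congr Cintegrable; apply/funext => s.
    by rewrite [(t%:C * f s) ^+ j]exprMn /f; ring.
  have iT : Cintegrable mu (fun s => U s * exp_trunc k.+1 (t%:C * f s)).
    rewrite /exp_trunc; under eq_fun do rewrite mulr_sumr.
    by apply: Cintegrable_sum => j _; exact: it.
  have TE : Cint mu (fun s => U s * exp_trunc k.+1 (t%:C * f s)) =
      (k`!%:R)^-1 * t%:C ^+ k * Mk.
    rewrite /exp_trunc; under eq_fun do rewrite mulr_sumr.
    rewrite Cint_sum; last by move=> j _; exact: it.
    have jE (j : nat) : Cint mu (fun s => U s * ((j`!%:R)^-1 * (t%:C * f s) ^+ j)) =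
        ((j`!%:R)^-1 * t%:C ^+ j) * Cint mu (fun s => U s * f s ^+ j).
      rewrite -(CintZ _ (Cintegrable_moment x j)); congr Cint; apply/funext => s.
      by rewrite [(t%:C * f s) ^+ j]exprMn; ring.
    under eq_bigr do rewrite jE.
    rewrite big_ord_recr /= big1 ?add0r// => j _.
    by rewrite [Cint _ _]IH ?mulr0.
  have Lt : Cint mu (fun s => U s * expC (t%:C * f s)) = 0.
    rewrite -(V0 (t *: x)) /laplace; congr Cint; apply/funext => s.
    by rewrite dotZl rmorphM /f [v * (_ * _)]mulrCA.
  have iE : Cintegrable mu (fun s => U s * expC (t%:C * f s)).
    have := Cintegrable_laplace (t *: x); congr Cintegrable; apply/funext => s.
    by rewrite dotZl rmorphM /f [v * (_ * _)]mulrCA.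
  have : normc (Cint mu (fun s => U s * expC (t%:C * f s)) -
      Cint mu (fun s => U s * exp_trunc k.+1 (t%:C * f s))) <= t ^+ k.+1 * C.
    rewrite -(CintB iE iT) /C -RintegralZl//; last exact: iU.
    apply: normc_Cint; first by apply: CintegrableD => //; exact: CintegrableN.
      exact: RintegrableZ.
    move=> s; rewrite -mulrBr Normc.normcM [leRHS]mulrCA ler_wpM2l ?normc_ge0//.
    apply: le_trans (expC_taylor _ _ t01) _; rewrite ler_wpM2l ?exprn_ge0 ?(ltW t0)//.
    by rewrite ler_expR normc_vdot /a -mulrA dot_le.
  rewrite Lt TE sub0r normcNE Normc.normcM Normc.normcM Normc.normcV normcX normc_real.
  rewrite normc_nat (gtr0_norm t0).
  rewrite exprSr -!mulrA ler_pdivrMl// [leRHS]mulrCA ler_pM2l ?exprn_gt0//.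
  by rewrite [leRHS]mulrCA.
apply: Normc.eq0_normc; apply/eqP; rewrite eq_le normc_ge0 andbT.
apply/ler_addgt0Pl => e e0; rewrite addr0.
pose K := k`!%:R * C + 1.
have C0 : 0 <= C by apply: Rintegral_ge0 => s _; rewrite mulr_ge0 ?expR_ge0 ?normc_ge0.
have K0 : 0 < K by rewrite ltr_wpDl// mulr_ge0// ltW.
pose t := Num.min 1 (e / K).
have t0 : 0 < t by rewrite lt_min ltr01 divr_gt0.
apply: le_trans (H t t0 _) _; first by rewrite ge_min lexx.
apply: (@le_trans _ _ (e / K * K)); last by rewrite mulfVK// gt_eqF.
apply: ler_pM; rewrite ?(ltW t0) ?mulr_ge0 ?(ltW f0R)//.
  by rewrite ge_min lexx orbT.
by rewrite lerDl.
Qed.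

Lemma laplace_injective : {ae mu, forall eta, laplace (vec eta) = 0} ->
  {ae mu, forall s, U s = 0}.
Proof.
move=> /laplace_eq0 /laplace_moments H; apply: moments_ae0 => // x k.
have v0 : v ^+ k != 0.
  apply: expf_neq0; apply/eqP => v0; move: v_norm; rewrite v0 Normc.normc0 => /eqP.
  by rewrite eq_sym oner_eq0.
apply: (mulfI v0); rewrite mulr0 -(H x k) -CintZ.
  by congr Cint; apply/funext => s; rewrite rmorphXn exprMn; ring.
have := CintegrableZ (v ^+ k)^-1 (Cintegrable_moment x k); congr Cintegrable.
by apply/funext => s; rewrite exprMn rmorphXn mulrCA mulKf.
Qed.

End LaplaceTransform.

(** * The expansion at a zero *)

Lemma compact_enorm_bounded (R : realType) (N : nat) (K : set 'rV[R]_N) : compact K ->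
  exists2 Y : R, 0 <= Y & forall y, K y -> enorm y <= Y.
Proof.
move=> /compact_bounded [M [_ HM]]; pose Y := `|M| + 1.
have Y0 : 0 <= Y by rewrite addr_ge0.
have {}HM y : K y -> `|y| <= Y.
  by apply: HM; rewrite /Y; apply: le_lt_trans (ler_norm M) _; rewrite ltrDl.
exists (N%:R * Y) => [|y Ky]; first by rewrite mulr_ge0.
have c i : `|y 0 i| <= Y.
  apply: le_trans (HM _ Ky).
  have -> : `|y| = mx_norm y by [].
  rewrite mx_normrE.
  exact: (le_bigmax _ (fun j : 'I_1 * 'I_N => `|y j.1 j.2|) (0, i)).
have [N0|N0] := posnP N.
  rewrite /enorm /dot big1 ?sqrtr0 ?mulr_ge0// => i _.
  by have := ltn_ord i; rewrite {2}N0.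
rewrite -(@ler_pXn2r _ 2)// ?nnegrE ?enorm_ge0 ?mulr_ge0//.
rewrite enorm_sqr /dot; apply: (@le_trans _ _ (\sum_(i < N) Y ^+ 2)).
  by apply: ler_sum => i _; rewrite -expr2 -[_ ^+ 2]real_normK ?num_real// lerXn2r// nnegrE.
rewrite sumr_const card_ord exprMn -[leLHS]mulr_natl.
apply: ler_wpM2r; first exact: sqr_ge0.
by rewrite -natrX ler_nat -[leqLHS]expn1 leq_pexp2l.
Qed.

Lemma scaler_swap (K : comPzRingType) (V : lmodType K) (k k' : K) (v : V) :
  k *: (k' *: v) = k' *: (k *: v).
Proof. by rewrite !scalerA mulrC. Qed.

Section Zero.
Variables (R : realType) (m N : nat).
Hypothesis m_gt0 : (0 < m)%N.
Variable u0 : 'rV[R]_N -> R[i].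
Hypotheses (u0_L2 : in_L2_rho_star m u0) (u0_neq0 : ~ ae_zero u0).
Variables (T th : R).
Hypotheses (T_gt0 : 0 < T) (th_adm : admissible m th).
Hypothesis sin_th_gt0 : 0 < sin th.
Hypothesis sin_th_le : sin th <= sin ((2 * m)%:R * th).
Hypothesis growth : forall r rho : R, 0 <= r -> 0 <= rho ->
  N%:R * sin th * r * rho <= T / 8 * sin th * r ^+ (2 * m) + rho `^ alpha R m / 4.
Hypothesis u_zero : solution m u0 0 T = 0.
Local Notation B := (measurableTypeR R).
Local Notation mu := (lebesgueN R N).
Local Notation z := (rot_freq th).
Local Notation d := (rot_decay m th).
Local Notation w := (profile m u0 T th).
Implicit Types (y x : 'rV[R]_N) (b : multinom N).

Let mw : Cmeas w.
Proof. exact: Cmeas_profile. Qed.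

Let c : R := 3 / 8 * T * sin th.

Let c_gt0 : 0 < c.
Proof. by rewrite /c !mulr_gt0// invr_gt0. Qed.

Local Notation moment := (freq_moment z w).

Lemma profile_laplace eta : w eta = expC (- (T%:C * d * (enorm (vec eta) ^+ (2 * m))%:C)) *
  laplace (fun s => u0 (vec s)) (- z) (vec eta).
Proof.
have T2 : T / 2 <= T by rewrite ler_pdivrMr// ler_pMr// ler1n.
rewrite /laplace -CintZ.
  rewrite /profile; congr Cint; apply/funext => s; rewrite /joint /= [RHS]mulrCA.
  congr (_ * _); rewrite -expCD; congr expC.
  by rewrite /phase sub0r dotNr rmorphN /=; ring.
have := CintegrableZ (expC (T%:C * d * (enorm (vec eta) ^+ (2 * m))%:C))
  (Cintegrable_joint2 m_gt0 u0_L2 T_gt0 sin_th_gt0 sin_th_le growth 0 eta T2).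
congr Cintegrable; apply/funext => s; rewrite /joint /= mulrCA.
congr (_ * _); rewrite -expCD; congr expC.
by rewrite /phase sub0r dotNr rmorphN /=; ring.
Qed.

(** If all moments vanished, so would the profile, which is the Laplace transform
    of the data up to a nonvanishing factor, and then the data themselves. *)
Lemma some_moment_neq0 : exists b, moment b != 0.
Proof.
have [I1 I10 HI] := profile_decay m_gt0 u0_L2 T_gt0 sin_th_gt0 sin_th_le growth.
apply: contrapT => H; apply: u0_neq0.
have H0 b : moment b = 0.
  by apply/eqP/negPn/negP => h; apply: H; exists b.
have w0 := freq_moments_ae0 m_gt0 (normc_rot_freq th) mw I10 c_gt0 HI H0.
apply: (@laplace_injective R N (fun s => u0 (vec s)) (- z)).
- exact: Cmeas_data u0_L2.
- by rewrite normcNE normc_rot_freq.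
- by move=> a; exact: (Rintegrable_data_exp m_gt0 u0_L2 a).
have L eta : w eta = 0 -> laplace (fun s => u0 (vec s)) (- z) (vec eta) = 0.
  have cancel (e v u : R[i]) : e != 0 -> u = e * v -> u = 0 -> v = 0.
    by move=> e0 -> /eqP; rewrite mulf_eq0 (negbTE e0) => /eqP.
  exact: (cancel _ _ _ (expC_neq0 _) (profile_laplace eta)).
by apply: filterS w0 => eta; exact: L.
Qed.

Let rot_const_neq0 : rot_const N th != 0.
Proof.
rewrite mulf_neq0 ?expC_neq0//.
apply/eqP => -[h]; have : 0 < (2 * pi : R) ^- N by rewrite invr_gt0 exprn_gt0// mulr_gt0// pi_gt0.
by rewrite h ltxx.
Qed.

(** Up to [rot_const], the moment of degree 0 is the value of the solution at its
    zero. *)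
Lemma moment_mnm0 : moment mnm0 = 0.
Proof.
have T2 : T / 2 <= T by rewrite ler_pdivrMr// ler_pMr// ler1n.
move: u_zero; rewrite (solutionE m_gt0 u0_L2 T_gt0 th_adm sin_th_gt0 sin_th_le growth _ T2).
move/eqP; rewrite mulf_eq0 (negbTE rot_const_neq0) /= => /eqP <-.
rewrite /moment /freq_moment; congr Cint; apply/funext => eta; congr (_ * _).
rewrite dot0r subrr mulr0 mul0r addr0 expC0 /freq_monomial /divpow big1// => i _.
by rewrite mnm0E expr0 fact0 invr1 mulr1.
Qed.

(** The order of vanishing is the least degree of a nonzero moment. *)
Lemma vanishing_order : exists l, [/\ (0 < l)%N,
  exists2 b : bmultinom N l.+1, mdeg (bmnm b) = l & moment (bmnm b) != 0 &
  forall b, (mdeg b < l)%N -> moment b = 0].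
Proof.
pose P l := [exists b : bmultinom N l.+1, (mdeg (bmnm b) == l) && (moment (bmnm b) != 0)].
have Pmdeg b : moment b != 0 -> P (mdeg b).
  by move=> hb; apply/existsP; exists (BMultinom (ltnSn (mdeg b))); rewrite /= eqxx.
have exP : exists l, P l by have [b /Pmdeg ?] := some_moment_neq0; exists (mdeg b).
case: (ex_minnP exP) => l /existsP[b /andP[/eqP bl bn]] lmin; exists l; split.
- rewrite lt0n; apply: contraNneq bn => l0.
  have -> : bmnm b = mnm0 by apply/eqP; rewrite -mdeg_eq0 bl; apply/eqP.
  by rewrite moment_mnm0.
- by exists b.
- move=> b' b'l; apply/eqP/negPn/negP => /Pmdeg /lmin.
  by rewrite leqNgt b'l.
Qed.

(** The homogeneous part of degree [l] of the expansion of the solution at its zero,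
    as a polynomial of the similarity variable. *)
Definition blow_up l : mpoly N R[i] := rot_const N th *:
  \sum_(b : bmultinom N l.+1 | mdeg (bmnm b) == l)
    moment (bmnm b) *: hermite R m (bmnm b).

Lemma blow_up_neq0 l (b : bmultinom N l.+1) : mdeg (bmnm b) = l ->
  moment (bmnm b) != 0 -> blow_up l <> 0.
Proof.
move=> bl bn /(congr1 (mcoeff (bmnm b))); rewrite mcoeff0 /blow_up mcoeffZ raddf_sum /=.
rewrite (bigD1 b) ?bl//= mcoeffZ (mcoeff_hermite _ m_gt0)// eqxx mulr1.
rewrite big1 => [|b' /andP[/eqP b'l bb']].
  by rewrite addr0 => /eqP; rewrite mulf_eq0 (negbTE rot_const_neq0) (negbTE bn).
rewrite mcoeffZ (mcoeff_hermite _ m_gt0) ?bl ?b'l//.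
by rewrite -bmeqP (negbTE bb') mulr0.
Qed.

Lemma blow_up_span l : in_span_psi_star m l (blow_up l).
Proof.
exists (fun b' : bmultinom N l.+1 => rot_const N th * (moment (bmnm b') *
  (Num.sqrt ((multi_fact (bmnm b'))%:R : R))%:C)).
rewrite /blow_up scaler_sumr; apply: eq_bigr => b _.
rewrite psi_starE !scalerA -!mulrA; congr (_ *: _); congr (_ * _).
have s0 : 0 < Num.sqrt ((multi_fact (bmnm b))%:R : R).
  by rewrite sqrtr_gt0 ltr0n /multi_fact prodn_gt0// => i; exact: fact_gt0.
by rewrite -rmorphM mulfV ?gt_eqF// mulr1.
Qed.

Lemma blow_up_eigen l :
  Bstar m (blow_up l) = (- (l%:R / (2 * m)%:R) : R[i]) *: blow_up l.
Proof.
rewrite /blow_up (is_linearZ _ _ (Bstar_linear m)); set p := \sum_(b | _) _.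
have -> : Bstar m p = (- (l%:R / (2 * m)%:R) : R[i]) *: p.
  rewrite /p scaler_sumr (is_linear_sum _ _ _ (Bstar_linear m)).
  apply: eq_bigr => b /eqP bl; rewrite (is_linearZ _ _ (Bstar_linear m)).
  by rewrite (Bstar_hermite R (bmnm b) m_gt0) bl; exact: scaler_swap.
exact: scaler_swap.
Qed.

Lemma evalp_blow_up l y : evalp (blow_up l) y =
  rot_const N th * profile_part m z w l y.
Proof.
rewrite evalpZ evalp_sum; congr (_ * _).
by apply: eq_bigr => b _; rewrite evalpZ.
Qed.

Lemma solution_evolved (sg : R) y : 0 <= sg -> sg ^+ (2 * m) <= T / 2 ->
  solution m u0 (sg *: y) (T - sg ^+ (2 * m)) = rot_const N th * evolved m z d w sg y.
Proof.
move=> s0 sT; have t2 : T / 2 <= T - sg ^+ (2 * m) by lra.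
rewrite (solutionE m_gt0 u0_L2 T_gt0 th_adm sin_th_gt0 sin_th_le growth _ t2).
by rewrite /evolved opprB addrC subrK.
Qed.

(** All parts of degree less than [l] vanish, so that the expansion to order [l]
    consists of a single term. *)
Lemma solution_expansion l (Y : R) : 0 <= Y -> (forall b, (mdeg b < l)%N -> moment b = 0) ->
  exists kap C : R, [/\ 0 < kap, 0 <= C & forall sg y, 0 <= sg -> sg <= kap ->
  enorm y <= Y -> normc (solution m u0 (sg *: y) (T - sg ^+ (2 * m)) -
    (sg ^+ l)%:C * evalp (blow_up l) y) <= C * sg ^+ l.+1].
Proof.
move=> Y0 lmin.
have [I1 I10 HI] := profile_decay m_gt0 u0_L2 T_gt0 sin_th_gt0 sin_th_le growth.
pose kap := Num.min 1 (Num.min (c / 2) (T / 2)).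
have k0 : 0 < kap by rewrite !lt_min ltr01 !divr_gt0.
have k1 : kap <= 1 by rewrite ge_min lexx.
have kM : kap ^+ (2 * m) <= kap.
  by rewrite -[leRHS]expr1; apply: ler_wiXn2l; rewrite ?(ltW k0)// muln_gt0.
have kc : kap ^+ (2 * m) <= c / 2.
  by apply: le_trans kM _; rewrite !ge_min lexx orbT.
have kT : kap ^+ (2 * m) <= T / 2.
  by apply: le_trans kM _; rewrite !ge_min lexx !orbT.
have [C C0 HC] := evolved_expansion m_gt0 (normc_rot_freq th) (normc_rot_decay m th)
  (rot_freq_decay m th) mw I10 c_gt0 HI l Y0 k0 kc.
exists kap, (normc (rot_const N th) * C); split=> //; first by rewrite mulr_ge0 ?normc_ge0.
move=> sg y s0 sk yY; rewrite solution_evolved//; last first.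
  by apply: le_trans kT; apply: lerXn2r; rewrite ?nnegrE ?(ltW k0).
rewrite evalp_blow_up [_%:C * _]mulrCA -mulrBr Normc.normcM -mulrA.
rewrite ler_wpM2l ?normc_ge0//; have := HC sg y s0 sk yY.
rewrite big_ord_recr /= big1 ?add0r// => k _.
rewrite /profile_part big1 ?mulr0// => b /eqP bk.
by rewrite lmin ?mul0r// bk.
Qed.

End Zero.

Theorem theorem6p1 (R : realType) (m N : nat)
    (hm : (1 <= m)%N) (hN : (1 <= N)%N)
    (u0 : 'rV[R]_N -> R[i])
    (u0_L2 : in_L2_rho_star m u0) (u0_neq0 : ~ ae_zero u0)
    (T : R) (hT : 0 < T) (u_zero : solution m u0 0 T = 0) :
  exists (l : nat) (phi : mpoly N R[i]),
    [/\ (1 <= l)%N,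
        phi <> 0,
        in_span_psi_star m l phi,
        Bstar m phi = (- (l%:R / (2 * m)%:R) : R[i]) *: phi &
        exists r : R -> 'rV[R]_N -> R[i],
          (forall (t : R) (x : 'rV[R]_N), 0 < t -> t < T ->
             let y := ((T - t) `^ (2 * m)%:R^-1)^-1 *: x in
             solution m u0 x t =
             ((T - t) `^ (l%:R / (2 * m)%:R))%:C * (evalp phi y + r t y)) /\
          o1_unif_on_compacts T r].
Proof.
have T8 : 0 < T / 8 by rewrite divr_gt0.
have N0 : 0 <= N%:R :> R by [].
have [S0 S00 young] := young_small hm N0 T8.
have [th [th_adm sin_gt0 sin_le0 sin_le]] := choose_angle hm S00.
have growth (r rho : R) : 0 <= r -> 0 <= rho -> N%:R * sin th * r * rho <=
    T / 8 * sin th * r ^+ (2 * m) + rho `^ alpha R m / 4.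
  by move=> r0 h0; apply: young => //; exact: ltW.
have [l [l1 [b bl bn] lmin]] :=
  vanishing_order hm u0_L2 u0_neq0 hT th_adm sin_gt0 sin_le growth u_zero.
exists l, (blow_up m u0 T th l); split => //.
- exact: (blow_up_neq0 hm bl bn).
- exact: blow_up_span.
- exact: blow_up_eigen.
set phi := blow_up m u0 T th l.
pose sg (t : R) := (T - t) `^ (2 * m)%:R^-1.
have M0 : (0 < 2 * m)%N by rewrite muln_gt0.
have MR : (2 * m)%:R != 0 :> R by rewrite pnatr_eq0 -lt0n.
have sg_gt0 t : t < T -> 0 < sg t by move=> tT; rewrite powR_gt0// subr_gt0.
have sgM t : t < T -> sg t ^+ (2 * m) = T - t.
  move=> tT; rewrite -powR_mulrn ?powR_ge0// -powRrM mulVf// powRr1//.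
  by rewrite subr_ge0 ltW.
have sgl t : (T - t) `^ (l%:R / (2 * m)%:R) = sg t ^+ l.
  by rewrite -powR_mulrn ?powR_ge0// -powRrM mulrC.
(* The remainder is defined by the required identity; its decay is the content. *)
exists (fun t y => solution m u0 (sg t *: y) t / (sg t ^+ l)%:C - evalp phi y).
split=> [t x t0 tT y|K /compact_enorm_bounded[Y Y0 KY] e e0].
  have s0 := sg_gt0 t tT.
  have yE : sg t *: y = x.
    by rewrite /y -/(sg t) scalerA mulfV ?scale1r// gt_eqF.
  rewrite yE.
  rewrite sgl addrCA subrr addr0 mulrC divfK; first reflexivity.
  by apply/eqP => -[h]; have := exprn_gt0 l s0; rewrite h ltxx.
have [kap [C [k0 C0 HC]]] := @solution_expansion R m N hm u0 u0_L2 T th hT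
  th_adm sin_gt0 sin_le growth l Y Y0 lmin.
have C1 : 0 < C + 1 by rewrite ltr_wpDl.
pose de := Num.min kap (e / (C + 1)).
have de0 : 0 < de by rewrite lt_min k0 divr_gt0.
have deM : 0 < de ^+ (2 * m) by rewrite exprn_gt0.
near=> t.
have tT : t < T by near: t; exact: nbhs_left_lt.
have td : T - t < de ^+ (2 * m) by near: t; exact: nbhs_left_ltBl.
have s0 := sg_gt0 t tT.
have sd : sg t < de.
  by rewrite -(ltr_pXn2r M0) ?nnegrE ?(ltW s0) ?(ltW de0)// sgM.
move=> y Ky.
have sl0 : 0 < sg t ^+ l by rewrite exprn_gt0.
have slC : (sg t ^+ l)%:C != 0 :> R[i].
  by apply/eqP => -[h]; move: sl0; rewrite h ltxx.
have := HC (sg t) y (ltW s0) (le_trans (ltW sd) _) (KY y Ky).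
rewrite sgM// subKr ge_min lexx => /(_ isT) H.
rewrite (_ : _ - _ = ((sg t ^+ l)%:C)^-1 *
    (solution m u0 (sg t *: y) t - (sg t ^+ l)%:C * evalp phi y)); last first.
  by rewrite mulrBr mulKf// [in RHS]mulrC.
rewrite Normc.normcM Normc.normcV normc_real (gtr0_norm sl0) mulrC ltr_pdivrMr//.
apply: le_lt_trans H _; rewrite exprSr mulrA mulrAC ltr_pM2r//.
apply: (@le_lt_trans _ _ ((C + 1) * sg t)); first by rewrite ler_wpM2r ?(ltW s0)// lerDl.
rewrite mulrC -ltr_pdivlMr//; apply: lt_le_trans sd _.
by rewrite ge_min lexx orbT.
Unshelve. all: by end_near.
Qed.
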